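(* Let $N\ge2$ and let $H_1,\dots,H_N$ be nonzero complex Hilbert spaces whose dimensions $n_k=\dim H_k$ satisfy $n_1\le n_2\le\cdots\le n_N$ and $n_{N-1}<\infty$ ($H_N$ is allowed to be infinite dimensional). Let $V$ be the set of decomposable unit vectors in $H=H_1\otimes\cdots\otimes H_N$. Let $\rho$ be a normal state of $\mathcal B(H_1\otimes\cdots\otimes H_N)$ with density operator $A$, $\rho(X)=\operatorname{trace}(AX)$. The entanglement of $\rho$ is given by $$E(\rho)=\|A\|_\gamma,$$ where $\|\cdot\|_\gamma$ is the greatest cross norm on the projective tensor product of Banach spaces $\mathcal L^1(H_1)\hat\otimes\cdots\hat\otimes\mathcal L^1(H_N)$.
   Context: $V=\{\xi_1\otimes\cdots\otimes\xi_N:\xi_k\in H_k,\ \|\xi_1\|=\cdots=\|\xi_N\|=1\}$. Let $\mathcal K$ be the compact operators on $H$ and $\mathcal A=\{K+\lambda\mathbf 1:K\in\mathcal K,\ \lambda\in\mathbb C\}$. For $X\in\mathcal B(H)$ let $\|X\|_V=\sup_{\xi,\eta\in V}|\langle X\xi,\eta\rangle|$, and for a normal linear functional $\rho$ on $\mathcal B(H)$ let $E(\rho)=\sup\{|\rho(X)|:X\in\mathcal A,\ \|X\|_V\le1\}$. $\mathcal L^1(K)$ denotes the Banach space of trace class operators on $K$ with norm $\|A\|=\operatorname{trace}|A|$. Since at most one $H_k$ is infinite dimensional, $\mathcal L^1(H)$ is identified as a vector space with the algebraic tensor product of $\mathcal L^1(H_1),\dots,\mathcal L^1(H_N)$, and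 $\|A\|_\gamma=\inf\sum_{k=1}^n\|T_1^k\|\cdots\|T_N^k\|$, the infimum over all finite representations $A=\sum_{k=1}^nT_1^k\otimes\cdots\otimes T_N^k$ with $T_j^k\in\mathcal L^1(H_j)$. *)

(* Defs.v *)
From HB Require Import structures.
From mathcomp Require Import all_boot all_order all_algebra sesquilinear.
From mathcomp Require Import complex.
From mathcomp Require Import all_classical all_reals all_analysis.
From mathcomp.analysis Require Import showcase.summability.

Set Implicit Arguments.
Unset Strict Implicit.
Unset Printing Implicit Defensive.

Import Order.TTheory GRing.Theory Num.Theory.
Import numFieldNormedType.Exports.

Local Open Scope classical_set_scope.
Local Open Scope ring_scope.
Local Open Scope complex_scope.

(* The inner product is linear in its first argument and conjugate-linear in
   the second one. *)
Record hilbertType (R : realType) := HilbertType {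
  hilbert_sort :> completeNormedModType R[i] ;
  hdot : {dot hilbert_sort for (@Num.conj R[i])} ;
  hdot_norm : forall x : hilbert_sort, `|x| ^+ 2 = hdot x x }.

Arguments hdot {R h}.

Section Hilbert.
Context {R : realType}.
Implicit Types H : hilbertType R.

Definition orthonormal_basis H (B : set H) : Prop :=
  (forall e f, B e -> B f -> hdot e f = (e == f)%:R) /\
  (forall x, (forall e, B e -> hdot x e = 0) -> x = 0).

(* A chosen orthonormal basis, which exists by Zorn's lemma. The notions below
   that are computed with it (dimension, trace) do not depend on the choice. *)
Definition hbasis H : set H := xget set0 [set B | orthonormal_basis B].
Arguments hbasis : clear implicits.

Definition hdim_le H1 H2 : Prop := (hbasis H1 #<= hbasis H2)%card.

Definition finite_hdim H : Prop := finite_set (hbasis H).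

Definition bounded_op H : set (H -> H) := [set X | linear X /\ continuous X].

Definition positive_op H (X : H -> H) : Prop := forall x, 0 <= hdot (X x) x.

Definition compact_op H : set (H -> H) :=
  [set X | linear X /\ compact (closure (X @` [set x | `|x| <= 1]))].

Definition compact_plus_scalar H : set (H -> H) :=
  [set X | exists K (lambda : R[i]),
    compact_op K /\ X = K + lambda *: (idfun : H -> H)].

(* The positive square root of T^* T; the condition P P = T^* T is tested
   against inner products. *)
Definition abs_op H (T : H -> H) : H -> H :=
  xget 0 [set P | [/\ bounded_op P, positive_op P &
                   forall x y, hdot (P (P x)) y = hdot (T x) (T y)]].

(* The trace of a positive operator, possibly infinite. *)
Definition ptrace H (P : H -> H) : \bar R :=
  \esum_(e in hbasis H) (complex.Re (hdot (P e) e))%:E.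

Definition trace_class H : set (H -> H) :=
  [set T | bounded_op T /\ (ptrace (abs_op T) < +oo)%E].

Definition trace_norm H (T : H -> H) : R := fine (ptrace (abs_op T)).

(* The limit of the sums over the finite subsets of the basis. *)
Definition trace H (X : H -> H) : R[i] :=
  summability.sum (fun e : hbasis H => hdot (X (val e)) (val e) : R[i]^o).

(* A functional on B(H) is a function on all maps H -> H of which only the
   values on the bounded operators are used. *)
Definition state H (rho : (H -> H) -> R[i]) : Prop :=
  [/\ forall (a : R[i]) X Y, bounded_op X -> bounded_op Y ->
        rho (a *: X + Y) = a * rho X + rho Y,
      forall X, bounded_op X -> positive_op X -> 0 <= rho X &
      rho idfun = 1].

Definition density_op H (A : H -> H) : Prop :=
  [/\ trace_class A, positive_op A & trace A = 1].

Definition normal_state_with_density H (rho : (H -> H) -> R[i]) (A : H -> H) :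
    Prop :=
  [/\ state rho, density_op A &
      forall X, bounded_op X -> rho X = trace (A \o X)].

End Hilbert.

Arguments hbasis {R} H.

(* The Hilbert space tensor product of the spaces H k, characterized up to a
   unitary isomorphism that respects the decomposable vectors. *)
Record hilbert_tensor (R : realType) (N : nat) (H : 'I_N -> hilbertType R) :=
  HilbertTensor {
    tensor_space :> hilbertType R ;
    tensor : (forall k, H k) -> tensor_space ;
    tensor_multilinear : forall (xi : forall k, H k) (k : 'I_N) (a : R[i])
        (x y : H k),
      tensor (dfwith xi k (a *: x + y)) =
        a *: tensor (dfwith xi k x) + tensor (dfwith xi k y) ;
    tensor_hdot : forall xi eta : forall k, H k,
      hdot (tensor xi) (tensor eta) = \prod_(k < N) hdot (xi k) (eta k) ;
    tensor_total : dense [set v : tensor_space |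
      exists n (c : 'I_n -> R[i]) (xi : 'I_n -> forall k, H k),
        v = \sum_(i < n) c i *: tensor (xi i)] }.

Arguments tensor {R N H h}.

Section Tensor.
Context {R : realType} {N : nat} {H : 'I_N -> hilbertType R}.
Variable K : hilbert_tensor H.

Definition decomposable_unit : set K :=
  [set v | exists xi : forall k, H k,
    (forall k, `|xi k| = 1) /\ v = tensor xi].

Definition normV (X : K -> K) : \bar R :=
  ereal_sup [set (ComplexField.Normc.normc (hdot (X xi) eta))%:E
            | xi in decomposable_unit & eta in decomposable_unit].

Definition entanglement (rho : (K -> K) -> R[i]) : \bar R :=
  ereal_sup [set (ComplexField.Normc.normc (rho X))%:E
            | X in [set X | compact_plus_scalar X /\ (normV X <= 1)%E]].

(* The operator T_1 (x) ... (x) T_N, for bounded T_k: the unique bounded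
   operator acting factorwise on the decomposable vectors. *)
Definition tensor_op (T : forall k, H k -> H k) : K -> K :=
  xget 0 [set S | bounded_op S /\
    forall xi, S (tensor xi) = tensor (fun k => T k (xi k))].

Definition gamma_norm (A : K -> K) : \bar R :=
  ereal_inf [set s | exists n (T : 'I_n -> forall j, H j -> H j),
    [/\ forall k j, trace_class (T k j),
        A = \sum_(k < n) tensor_op (T k) &
        s = (\sum_(k < n) \prod_(j < N) trace_norm (T k j))%:E]].

End Tensor.

(* Main.v *)
(* Both inequalities use that only one factor [H m] can be infinite dimensional.
   A product operator [T_1 (x) ... (x) T_N] is then a finite sum of operators
   [J_x T_m J_y^*], where [J_x h] puts [h] in the [m]-th place of the product
   vector [x], and the trace norm is handled through the bound [nuc_le] on
   [sum <T u_i, v_i>] over contractive families.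

   Upper bound: expanding [T_m] into rank one operators [w_i (x) q_i^*] with
   [sum |w_i||q_i|] at most its trace norm,
   [trace (J_x T_m J_y^* X) = sum <X J_x w_i, J_y q_i>], and each term is a
   matrix coefficient of [X] between product vectors.

   Lower bound: a projection [Q] onto a finite product grid brings [A] to
   [Q A Q], up to an error that is small in the gamma norm because the finitely
   many blocks [J_g^* A J_f] are trace class on [H m]. If the finite matrix of
   [Q A Q] could not be approximated by combinations of product rank one matrices
   of total weight close to the entanglement, a separating functional would be a
   finite rank operator [X] violating the definition of the entanglement. *)

Require Import Defs.
From mathcomp Require Import all_boot all_order all_algebra sesquilinear.
From mathcomp Require Import all_classical all_reals all_analysis.
From mathcomp Require Import complex ring lra.
From mathcomp.analysis Require Import showcase.summability.

Set Implicit Arguments.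
Unset Strict Implicit.
Unset Printing Implicit Defensive.

Import Order.TTheory GRing.Theory Num.Theory.
Import numFieldNormedType.Exports.

Local Open Scope classical_set_scope.
Local Open Scope ring_scope.
Local Open Scope complex_scope.

(** The trace norm is accessible only through [abs_op], a chosen positive square root of [T^* T],
    where neither the triangle inequality nor the behaviour under two-sided multiplication is
    visible. [nuc_le] has both properties almost by inspection, and [trace_class_nuc_le] and
    [nuc_le_trace_class] translate in the two directions. Each translation rests on a square root,
    obtained from Riesz adjoints and a polynomial iteration instead of spectral theory.

    The entanglement is tested on compact operators plus scalars. On a finite matrix every linear
    functional comes from a finite rank operator, hence the compression to a grid before separating.
    The grid projection keeps product vectors product vectors, because it acts as the identity on
    every factor other than [m]. Separation yields real inequalities whereas the entanglement
    involves moduli; rotating one factor of a product vector by a phase closes this gap. Suprema,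
    hulls and expansions are only approximated, and the arbitrarily small losses are collected at
    the end. *)

Notation normc := ComplexField.Normc.normc.

(** * Complex moduli and Hilbert space norms *)

Section ComplexModulus.
Context {R : realType}.
Implicit Types z w : R[i].

Lemma normcC z : `|z| = (normc z)%:C.
Proof. by case: z. Qed.

Lemma ltr0c (a : R) : (0 < a%:C) = (0 < a).
Proof. exact: (ltcR 0). Qed.

Lemma normc_ge0 z : 0 <= normc z.
Proof. by rewrite -ler0c -normcC. Qed.

Lemma normc_sum (I : Type) (r : seq I) (P : pred I) (F : I -> R[i]) :
  normc (\sum_(i <- r | P i) F i) <= \sum_(i <- r | P i) normc (F i).
Proof.
elim/big_rec2: _ => [|i y x _ le_xy]; first by rewrite ComplexField.Normc.normc0.
exact: le_trans (le_normcD _ _) (lerD _ _).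
Qed.

Lemma normc_real (a : R) : normc a%:C = `|a|.
Proof. by rewrite /= expr0n addr0 sqrtr_sqr. Qed.

Lemma normc_nneg (a : R) : 0 <= a -> normc a%:C = a.
Proof. by move=> a0; rewrite normc_real ger0_norm. Qed.

Lemma normc_conj z : normc (conjc z) = normc z.
Proof. by apply: complexI; rewrite -!normcC normcJ. Qed.

Lemma normc_eq0 z : (normc z == 0) = (z == 0).
Proof.
apply/eqP/eqP => [/ComplexField.Normc.eq0_normc //|->].
by rewrite ComplexField.Normc.normc0.
Qed.

Lemma mulc_conj z : z * conjc z = ((normc z) ^+ 2)%:C.
Proof. by rewrite -sqr_normc normcC rmorphXn. Qed.

Lemma Re_le_normc z : complex.Re z <= normc z.
Proof.
apply: le_trans (ler_norm _) _.
by rewrite -lecR -normcC normc_ge_Re.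
Qed.

End ComplexModulus.

Section HilbertNorm.
Context {R : realType}.
Implicit Types H : hilbertType R.

(** The norm of a complex normed module is [R[i]]-valued; a real-valued copy allows real order
    arithmetic, suprema and infima. *)
Definition nrm H (x : H) : R := complex.Re `|x|.

Lemma nrmE H (x : H) : `|x| = (nrm x)%:C.
Proof. by rewrite /nrm RRe_real // normr_real. Qed.

Lemma nrm_ge0 H (x : H) : 0 <= nrm x.
Proof. by rewrite -ler0c -nrmE. Qed.

Lemma nrm0 H : nrm (0 : H) = 0.
Proof. by rewrite /nrm normr0. Qed.

Lemma nrm_eq0 H (x : H) : (nrm x == 0) = (x == 0).
Proof.
rewrite -[RHS]normr_eq0 nrmE; apply/eqP/eqP => [->//|].
by move=> /complexI.
Qed.

Lemma nrmD H (x y : H) : nrm (x + y) <= nrm x + nrm y.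
Proof. by rewrite -lecR rmorphD /= -!nrmE ler_normD. Qed.

Lemma nrmN H (x : H) : nrm (- x) = nrm x.
Proof. by rewrite /nrm normrN. Qed.

Lemma nrmB H (x y : H) : nrm (x - y) <= nrm x + nrm y.
Proof. by rewrite -[nrm y]nrmN nrmD. Qed.

Lemma nrmBC H (x y : H) : nrm (x - y) = nrm (y - x).
Proof. by rewrite -nrmN opprB. Qed.

Lemma nrmZ H a (x : H) : nrm (a *: x) = normc a * nrm x.
Proof. by apply: complexI; rewrite -nrmE normrZ rmorphM /= -nrmE normcC. Qed.

Lemma nrm_sum H (I : Type) (r : seq I) (P : pred I) (F : I -> H) :
  nrm (\sum_(i <- r | P i) F i) <= \sum_(i <- r | P i) nrm (F i).
Proof.
elim/big_rec2: _ => [|i y x _ le_xy]; first by rewrite nrm0.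
exact: le_trans (nrmD _ _) (lerD _ _).
Qed.

Lemma hdotC H (x y : H) : hdot y x = conjc (hdot x y).
Proof. by have := hermC hdot y x; rewrite expr0 mul1r. Qed.

Lemma hdotDl H (x y z : H) : hdot (x + y) z = hdot x z + hdot y z.
Proof. exact: linearDl. Qed.

Lemma hdotDr H (x y z : H) : hdot x (y + z) = hdot x y + hdot x z.
Proof. exact: linearDr. Qed.

Lemma hdotZl H a (x y : H) : hdot (a *: x) y = a * hdot x y.
Proof. exact: (linearZl_LR hdot y a x). Qed.

Lemma hdotZr H a (x y : H) : hdot x (a *: y) = conjc a * hdot x y.
Proof. exact: (linearZr_LR hdot x a y). Qed.

Lemma hdotNl H (x y : H) : hdot (- x) y = - hdot x y.
Proof. exact: linearNl. Qed.

Lemma hdotNr H (x y : H) : hdot x (- y) = - hdot x y.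
Proof. exact: linearNr. Qed.

Lemma hdotBl H (x y z : H) : hdot (x - y) z = hdot x z - hdot y z.
Proof. by rewrite hdotDl hdotNl. Qed.

Lemma hdotBr H (x y z : H) : hdot x (y - z) = hdot x y - hdot x z.
Proof. by rewrite hdotDr hdotNr. Qed.

Lemma hdot0l H (x : H) : hdot 0 x = 0.
Proof. exact: linear0l. Qed.

Lemma hdot0r H (x : H) : hdot x 0 = 0.
Proof. exact: linear0r. Qed.

Lemma hdot_suml H (I : Type) (r : seq I) (P : pred I) (F : I -> H) y :
  hdot (\sum_(i <- r | P i) F i) y = \sum_(i <- r | P i) hdot (F i) y.
Proof. exact: linear_sumlz. Qed.

Lemma hdot_sumr H (I : Type) (r : seq I) (P : pred I) (F : I -> H) y :
  hdot y (\sum_(i <- r | P i) F i) = \sum_(i <- r | P i) hdot y (F i).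
Proof. exact: linear_sumr. Qed.

Lemma hdot_nrm H (x : H) : hdot x x = (nrm x ^+ 2)%:C.
Proof. by rewrite -hdot_norm nrmE rmorphXn. Qed.

Lemma Re_hdot_nrm H (x : H) : complex.Re (hdot x x) = nrm x ^+ 2.
Proof. by rewrite hdot_nrm. Qed.

Lemma linear_add (U V : lmodType R[i]) (f : U -> V) : linear f ->
  forall x y, f (x + y) = f x + f y.
Proof. by move=> lf x y; rewrite -[x]scale1r lf !scale1r. Qed.

Lemma linear_zero (U V : lmodType R[i]) (f : U -> V) : linear f -> f 0 = 0.
Proof.
by move=> lf; apply: (addrI (f 0)); rewrite -(linear_add lf) !addr0.
Qed.

Lemma linear_scale (U V : lmodType R[i]) (f : U -> V) : linear f ->
  forall a x, f (a *: x) = a *: f x.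
Proof.
by move=> lf a x; rewrite -[a *: x in LHS]addr0 lf (linear_zero lf) addr0.
Qed.

Lemma linear_opp (U V : lmodType R[i]) (f : U -> V) : linear f ->
  forall x, f (- x) = - f x.
Proof. by move=> lf x; rewrite -scaleN1r (linear_scale lf) scaleN1r. Qed.

Lemma linear_sub (U V : lmodType R[i]) (f : U -> V) : linear f ->
  forall x y, f (x - y) = f x - f y.
Proof. by move=> lf x y; rewrite linear_add // linear_opp. Qed.

Lemma linear_sumE (U V : lmodType R[i]) (f : U -> V) : linear f ->
  forall (I : Type) (r : seq I) (P : pred I) (F : I -> U),
  f (\sum_(i <- r | P i) F i) = \sum_(i <- r | P i) f (F i).
Proof.
move=> lf I r P F; elim/big_rec2: _ => [|i y x _ <-]; first exact: linear_zero.
exact: linear_add.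
Qed.

(* Over the complex numbers positivity forces symmetry (polarization with the
   coefficients 1 and i). *)
Lemma positive_op_sym H (P : H -> H) : linear P -> positive_op P ->
  forall x y, hdot (P x) y = hdot x (P y).
Proof.
move=> lP pP x y; rewrite [RHS]hdotC.
have := ger0_Im (pP (x + y)); have := ger0_Im (pP (x + 'i *: y)).
have := ger0_Im (pP x); have := ger0_Im (pP y).
rewrite !(linear_add lP) (linear_scale lP) !(hdotDl, hdotDr, hdotZl, hdotZr).
move: (hdot (P x) x) (hdot (P y) y) (hdot (P x) y) (hdot (P y) x).
move=> [a b] [c d] [u v] [u' v'] /= -> -> e1 e2.
by apply/eqP; rewrite eq_complex /=; apply/andP; split; apply/eqP; lra.
Qed.

Lemma positive_op_Re H (P : H -> H) : positive_op P ->
  forall x, hdot (P x) x = (complex.Re (hdot (P x) x))%:C.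
Proof. by move=> pP x; rewrite RRe_real // ger0_real // pP. Qed.

Lemma positive_op_Re_ge0 H (P : H -> H) : positive_op P ->
  forall x, 0 <= complex.Re (hdot (P x) x).
Proof. by move=> pP x; rewrite -ler0c -positive_op_Re. Qed.

(** The quadratic is [<P w, w>] at [w = x - t <P x, y> y], with [m = |<P x, y>|^2], [p = <P x, x>]
    and [q = <P y, y>]. For [q > 0] the value [t = 1 / q] gives the claim; for [q = 0] a large [t]
    forces [m = 0]. *)
Lemma quadratic_discr (m p q : R) : 0 <= m -> 0 <= p -> 0 <= q ->
  (forall t, 0 <= p - 2 * t * m + t ^+ 2 * m * q) -> m <= p * q.
Proof.
move=> m0 p0 q0 h; have [q00|q_neq0] := eqVneq q 0.
  rewrite q00 mulr0; case: (eqVneq m 0) => [->//|m_neq0].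
  have := h ((p + 1) / (2 * m)); rewrite q00 mulr0 addr0.
  have -> : 2 * ((p + 1) / (2 * m)) * m = p + 1 by field.
  by move=> ?; exfalso; lra.
have qp : 0 < q by rewrite lt_neqAle eq_sym q_neq0.
have := h q^-1.
have -> : p - 2 * q^-1 * m + q^-1 ^+ 2 * m * q = p - m / q by field.
by rewrite subr_ge0 ler_pdivrMr.
Qed.

Lemma positive_cauchy_schwarz H (P : H -> H) : linear P -> positive_op P ->
  forall x y, normc (hdot (P x) y) ^+ 2 <=
    complex.Re (hdot (P x) x) * complex.Re (hdot (P y) y).
Proof.
move=> lP pP x y.
apply: quadratic_discr; rewrite ?sqr_ge0 ?positive_op_Re_ge0// => t.
have := positive_op_Re_ge0 pP (x - (t%:C * hdot (P x) y) *: y).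
rewrite (linear_sub lP) (linear_scale lP) !(hdotBl, hdotBr, hdotZl, hdotZr).
rewrite (positive_op_sym lP pP y x) (hdotC (P x) y).
rewrite (positive_op_Re pP x) (positive_op_Re pP y).
move: (hdot (P x) y) (complex.Re (hdot (P x) x)) (complex.Re (hdot (P y) y)).
move=> [a b] p q /=; rewrite sqr_sqrtr; last by rewrite addr_ge0 ?sqr_ge0.
by congr (is_true (_ <= _)); ring.
Qed.

Lemma cauchy_schwarz H (x y : H) : normc (hdot x y) <= nrm x * nrm y.
Proof.
rewrite -(@ler_pXn2r _ 2) ?nnegrE ?mulr_ge0 ?nrm_ge0 ?normc_ge0 // exprMn.
rewrite -!Re_hdot_nrm; exact: (@positive_cauchy_schwarz _ idfun).
Qed.

Lemma hdot_inj H (x y : H) : (forall z, hdot x z = hdot y z) -> x = y.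
Proof.
move=> xy; apply/eqP; rewrite -subr_eq0 -nrm_eq0 -sqrf_eq0.
by rewrite -Re_hdot_nrm hdotBl xy subrr.
Qed.

Lemma nrm_sqrD H (x y : H) :
  nrm (x + y) ^+ 2 = nrm x ^+ 2 + nrm y ^+ 2 + 2 * complex.Re (hdot x y).
Proof.
rewrite -!Re_hdot_nrm hdotDl !hdotDr (hdotC x y) !raddfD /=.
by case: (hdot x y) => a b /=; lra.
Qed.

Lemma nrm_sqrB H (x y : H) :
  nrm (x - y) ^+ 2 = nrm x ^+ 2 + nrm y ^+ 2 - 2 * complex.Re (hdot x y).
Proof. by rewrite nrm_sqrD nrmN hdotNr raddfN /= mulrN. Qed.

Lemma nrm_le_test H (x : H) c : 0 <= c ->
  (forall y, normc (hdot x y) <= c * nrm y) -> nrm x <= c.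
Proof.
move=> c0 /(_ x); rewrite hdot_nrm normc_nneg ?sqr_ge0// expr2.
have [->//|x0] := eqVneq (nrm x) 0.
by rewrite ler_pM2r // lt_neqAle eq_sym x0 nrm_ge0.
Qed.

End HilbertNorm.

(** * Convergence *)

Section HilbertTopology.
Context {R : realType}.
Implicit Types H : hilbertType R.

Lemma cvg_nrmP (T : Type) (F : set_system T) {FF : Filter F} H (f : T -> H)
    (l : H) :
  f t @[t --> F] --> l <->
  forall e : R, 0 < e -> \forall t \near F, nrm (l - f t) <= e.
Proof.
split=> [/cvgrPdist_le fl e e0|fl].
  have := fl e%:C; rewrite ltr0c => /(_ e0); apply: filterS => t.
  by rewrite nrmE lecR.
apply/cvgrPdist_le => e e0.
have eE : e = (complex.Re e)%:C by rewrite RRe_real // gtr0_real.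
have := fl (complex.Re e); rewrite -ltr0c -eE => /(_ e0).
by apply: filterS => t; rewrite nrmE => h; rewrite eE lecR.
Qed.

Lemma cvg_normcP (T : Type) (F : set_system T) {FF : Filter F}
    (f : T -> R[i]^o) (l : R[i]^o) :
  f t @[t --> F] --> l <->
  forall e : R, 0 < e -> \forall t \near F, normc (l - f t) <= e.
Proof.
split=> [/cvgrPdist_le fl e e0|fl].
  have := fl e%:C; rewrite ltr0c => /(_ e0); apply: filterS => t.
  by rewrite normcC lecR.
apply/cvgrPdist_le => e e0.
have eE : e = (complex.Re e)%:C by rewrite RRe_real // gtr0_real.
have := fl (complex.Re e); rewrite -ltr0c -eE => /(_ e0).
by apply: filterS => t; rewrite normcC => h; rewrite eE lecR.
Qed.

Lemma cvg_cauchy_nrm (T : Type) (F : set_system T) {FF : ProperFilter F} H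
    (f : T -> H) :
  (forall e : R, 0 < e -> exists x : H, \forall t \near F, nrm (x - f t) <= e) ->
  exists l : H, f t @[t --> F] --> l.
Proof.
move=> fC; suff : cvg (f t @[t --> F]) by move=> cf; exists (lim (f t @[t --> F])).
apply/cauchy_cvgP; apply: cauchy_exP => e e0.
have eE : e = (complex.Re e)%:C by rewrite RRe_real // gtr0_real.
have re0 : 0 < complex.Re e by rewrite -ltr0c -eE.
have [|x xP] := fC (complex.Re e / 2); first by rewrite divr_gt0.
exists x; apply: filterS xP => t xt; rewrite -ball_normE /= nrmE eE ltcR.
by apply: le_lt_trans xt _; rewrite ltr_pdivrMr // ltr_pMr // ltr1n.
Qed.

(** Completeness is inherited from the real line: real and imaginary parts are 1-Lipschitz, so each
    of them converges. *)
Lemma cvg_cauchy_normc (T : Type) (F : set_system T) {FF : ProperFilter F}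
    (f : T -> R[i]^o) :
  (forall e : R, 0 < e ->
     exists x : R[i], \forall t \near F, normc (x - f t) <= e) ->
  exists l : R[i]^o, f t @[t --> F] --> l.
Proof.
move=> fC.
have real_part (g : R[i] -> R) : (forall x y, `|g x - g y| <= normc (x - y)) ->
    exists l : R, g (f t) @[t --> F] --> l.
  move=> gL; suff : cvg (g (f t) @[t --> F]).
    by move=> cf; exists (lim (g (f t) @[t --> F])).
  apply/cauchy_cvgP; apply: cauchy_exP => e e0.
  have [|x xP] := fC (e / 2); first by rewrite divr_gt0.
  exists (g x); apply: filterS xP => t xt; rewrite -ball_normE /=.
  apply: le_lt_trans (gL _ _) _; apply: le_lt_trans xt _.
  by rewrite ltr_pdivrMr // ltr_pMr // ltr1n.
have [|a /cvgrPdist_le fa] := real_part (@complex.Re R).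
  move=> [a b] [c d] /=; rewrite -sqrtr_sqr ler_sqrt ?addr_ge0 ?sqr_ge0 //.
  by rewrite lerDl sqr_ge0.
have [|b /cvgrPdist_le fb] := real_part (@complex.Im R).
  move=> [c b] [c' d] /=; rewrite -sqrtr_sqr ler_sqrt ?addr_ge0 ?sqr_ge0 //.
  by rewrite lerDr sqr_ge0.
exists (a +i* b); apply/cvg_normcP => e e0.
have e20 : 0 < e / 2 by rewrite divr_gt0.
near=> t.
have -> : a +i* b - f t = (a - complex.Re (f t))%:C +
    'i * (b - complex.Im (f t))%:C.
  by rewrite [f t]complexE; case: (f t) => c d; simpc.
apply: le_trans (le_normcD _ _) _; rewrite ComplexField.Normc.normcM !normc_real.
rewrite /= expr0n expr1n add0r sqrtr1 mul1r [leRHS](splitr e).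
by apply: lerD; near: t; [exact: fa|exact: fb].
Unshelve. all: by end_near. Qed.

Lemma bounded_opP H1 H2 (X : H1 -> H2) : linear X ->
  continuous X <-> exists c, 0 <= c /\ forall x, nrm (X x) <= c * nrm x.
Proof.
move=> lX; split=> [cX|[c [c0 Xc]] x].
  have := cX 0; rewrite /continuous_at (linear_zero lX).
  move=> /cvg_nrmP /(_ 1 ltr01) /nbhs_normP[d /= d0 dP].
  have dE : d = (complex.Re d)%:C by rewrite RRe_real // gtr0_real.
  have rd0 : 0 < complex.Re d by rewrite -ltr0c -dE.
  exists (2 / complex.Re d); split; first by rewrite divr_ge0 // ltW.
  move=> x; have [->|x0] := eqVneq x 0.
    by rewrite (linear_zero lX) !nrm0 mulr0.
  have nx0 : 0 < nrm x by rewrite lt_neqAle eq_sym nrm_eq0 x0 nrm_ge0.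
  pose t := complex.Re d / (2 * nrm x).
  have t0 : 0 < t by rewrite divr_gt0 // mulr_gt0.
  have : nrm (0 - X (t%:C *: x)) <= 1.
    apply: dP; rewrite /= sub0r normrN nrmE dE ltcR nrmZ (normc_nneg (ltW t0)).
    have -> : t * nrm x = complex.Re d / 2 by rewrite /t; field; rewrite gt_eqF.
    by rewrite ltr_pdivrMr // ltr_pMr // ltr1n.
  rewrite (linear_scale lX) sub0r nrmN nrmZ (normc_nneg (ltW t0)) => h.
  have -> : 2 / complex.Re d * nrm x = t^-1.
    by rewrite /t; field; rewrite !gt_eqF.
  by rewrite -[t^-1]mulr1 mulrC ler_pdivlMr // mulrC.
apply/cvg_nrmP => e e0; apply/nbhs_normP; exists (e / (c + 1))%:C => /=.
  by rewrite ltr0c divr_gt0 // ltr_wpDl.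
move=> y /=; rewrite nrmE ltcR => xy; rewrite -(linear_sub lX).
apply: le_trans (Xc _) _; apply: le_trans (_ : (c + 1) * nrm (x - y) <= _).
  by rewrite ler_wpM2r ?nrm_ge0 // lerDl.
by rewrite mulrC -ler_pdivlMr ?ltW // ltr_wpDl.
Qed.

Lemma cvg_hdot (T : Type) (F : set_system T) {FF : Filter F} H
    (f g : T -> H) (l m : H) :
  f t @[t --> F] --> l -> g t @[t --> F] --> m ->
  (hdot (f t) (g t) : R[i]^o) @[t --> F] --> (hdot l m : R[i]^o).
Proof.
move=> /cvg_nrmP fl /cvg_nrmP gm; apply/cvg_normcP => e e0.
pose c := nrm l + nrm m + 1.
have c1 : 1 <= c by rewrite lerDr addr_ge0 ?nrm_ge0.
have c0 : 0 < c by exact: lt_le_trans c1.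
pose d := Num.min 1 (e / (2 * c)).
have d0 : 0 < d by rewrite lt_min ltr01 divr_gt0 // mulr_gt0.
near=> t.
have -> : hdot l m - hdot (f t) (g t) =
    hdot (l - f t) m + hdot (f t) (m - g t).
  by rewrite hdotBl hdotBr addrA subrK.
have ld : nrm (l - f t) <= d by near: t; exact: fl.
have md : nrm (m - g t) <= d by near: t; exact: gm.
have fc : nrm (f t) <= nrm l + 1.
  have -> : f t = l - (l - f t) by rewrite subKr.
  apply: le_trans (nrmB _ _) _; rewrite lerD2l (le_trans ld) //.
  by rewrite ge_min lexx.
apply: le_trans (le_normcD _ _) _.
apply: le_trans (lerD (cauchy_schwarz _ _) (cauchy_schwarz _ _)) _.
have dE : d * (2 * c) <= e.
  by rewrite -ler_pdivlMr ?mulr_gt0 // ge_min lexx orbT.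
apply: le_trans dE; have -> : d * (2 * c) = d * c + c * d by ring.
have nl := nrm_ge0 l; have nm := nrm_ge0 m.
by apply: lerD; apply: ler_pM; rewrite ?nrm_ge0 // /c; lra.
Unshelve. all: by end_near. Qed.

Lemma cvg_nrm (T : Type) (F : set_system T) {FF : Filter F} H
    (f : T -> H) (l : H) :
  f t @[t --> F] --> l -> nrm (f t) @[t --> F] --> nrm l.
Proof.
move=> /cvg_nrmP fl; apply/cvgrPdist_le => e e0; apply: filterS (fl e e0) => t.
apply: le_trans; have h1 := nrmD (f t - l) l; have h2 := nrmD (l - f t) (f t).
by rewrite !subrK nrmBC in h1 h2; rewrite ler_norml; apply/andP; split; lra.
Qed.

Lemma cvg_complex_ge0 (T : Type) (F : set_system T) {FF : ProperFilter F}
    (f : T -> R[i]^o) (l : R[i]^o) :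
  f t @[t --> F] --> l -> (forall t, 0 <= (f t : R[i])) -> 0 <= (l : R[i]).
Proof.
move=> /cvg_normcP fl f0; have close e : 0 < e ->
    - complex.Re (l : R[i]) <= e /\ `|complex.Im (l : R[i])| <= e.
  move=> /(fl _) /filter_ex[t]; move: (f0 t).
  have -> : l = (l - f t) + f t :> R[i] by rewrite subrK.
  rewrite addrK => ft0 le; have := ger0_Im ft0.
  move: ft0 le; case: (f t) (l - f t) => a b [c d] /=.
  rewrite lecE /= => /andP[_ a0] le ->; rewrite addr0.
  have h (x : R) : `|x| ^+ 2 <= c ^+ 2 + d ^+ 2 -> `|x| <= e.
    move=> xle; apply: le_trans le; rewrite -(normr_id x) -sqrtr_sqr.
    by rewrite ler_sqrt ?addr_ge0 ?sqr_ge0.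
  have := h c; have := h d; rewrite !real_normK ?num_real //.
  rewrite lerDl lerDr !sqr_ge0 => -> // /(_ isT); rewrite ler_norml => /andP[ec _].
  by split=> //; lra.
have : complex.Im (l : R[i]) = 0.
  apply/eqP; rewrite -normr_eq0 eq_le normr_ge0 andbT; apply/ler_addgt0Pl => e.
  by rewrite addr0 => /close[].
have : 0 <= complex.Re (l : R[i]).
  by rewrite -oppr_le0; apply/ler_addgt0Pl => e; rewrite addr0 => /close[].
by case: l {fl close} => a b /= a0 b0; rewrite lecE /= b0 eqxx.
Qed.

End HilbertTopology.

(** * Riesz representation and adjoints *)

Section Riesz.
Context {R : realType}.
Implicit Types H : hilbertType R.

(** First variation at a minimum. The optimal [t] would be [- d / a]; dividing by [a + 1] instead
    also covers [a = 0] and still gives a negative value unless [d = 0]. *)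
Lemma minimizer_ortho (a d : R) : 0 <= a ->
  (forall t, 0 <= t ^+ 2 * a + 2 * t * d) -> d = 0.
Proof.
move=> a0 /(_ (- d / (a + 1))).
have a1 : 0 < a + 1 by rewrite ltr_wpDl.
have -> : (- d / (a + 1)) ^+ 2 * a + 2 * (- d / (a + 1)) * d =
    - (d ^+ 2 * ((a + 2) / (a + 1) ^+ 2)) by field; rewrite gt_eqF.
rewrite oppr_ge0 pmulr_lle0; last first.
  by rewrite divr_gt0 ?exprn_gt0 // ltr_wpDl.
by move=> d2; apply/eqP; rewrite -sqrf_eq0 eq_le d2 sqr_ge0.
Qed.

(** Nested sets of vanishing diameter shrink to a point. The sets are not assumed closed, so the
    limit is only approached from within [P e]. It serves for the sublevel sets in [riesz] and for
    the almost maximal projections in [parseval]. *)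
Lemma cantor_nrm H (P : R -> set H) :
  (forall e e' x, e <= e' -> P e x -> P e' x) ->
  (forall e, 0 < e -> exists x, P e x) ->
  (forall e, 0 < e -> exists2 d, 0 < d &
     forall x y, P d x -> P d y -> nrm (x - y) <= e) ->
  exists l, forall e, 0 < e -> exists2 x, P e x & nrm (l - x) <= e.
Proof.
move=> Pmono Pex Pc.
pose F := filter_from [set e : R | 0 < e] P.
have FF : ProperFilter F.
  apply: filter_from_proper; last by move=> e /Pex.
  apply: filter_from_filter; first by exists 1 => /=.
  move=> e e' /= e0 e'0; exists (Num.min e e'); first by rewrite /= lt_min e0.
  by move=> x Px; split; apply: Pmono Px; rewrite ge_min lexx ?orbT.
have [e e0|l /cvg_nrmP lF] := cvg_cauchy_nrm (F := F) (f := id).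
  have [d d0 dP] := Pc e e0; have [x Px] := Pex d d0.
  by exists x; exists d => // y Py; exact: dP.
exists l => e e0; have : F (P e) by exists e.
by move=> /(filterI (lF e e0)) /filter_ex[x [xl Px]]; exists x.
Qed.

(** The representing vector is the minimizer of [|x|^2 - 2 Re (f x)], which is bounded below because
    [f] is bounded; its first variation gives the representation. *)
Lemma riesz H (f : H -> R[i]) (c : R) :
  (forall a x y, f (a *: x + y) = a * f x + f y) ->
  (forall x, normc (f x) <= c * nrm x) ->
  exists y, forall x, f x = hdot x y.
Proof.
move=> lf fc.
have fD x y : f (x + y) = f x + f y by rewrite -[x]scale1r lf scale1r mul1r.
have f0 : f 0 = 0 by apply: (addrI (f 0)); rewrite -fD !addr0.
have fZ a x : f (a *: x) = a * f x by rewrite -[a *: x]addr0 lf f0 addr0.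
pose g x := complex.Re (f x).
have gD x y : g (x + y) = g x + g y by rewrite /g fD raddfD.
have gZ (t : R) x : g (t%:C *: x) = t * g x.
  by rewrite /g fZ; case: (f x) => a b /=; ring.
have gc x : g x <= c * nrm x by apply: le_trans (Re_le_normc _) (fc x).
pose J x := nrm x ^+ 2 - 2 * g x.
have JB x : - c ^+ 2 <= J x.
  have h := gc x; have : 0 <= (nrm x - c) ^+ 2 by exact: sqr_ge0.
  by rewrite /J => ?; nra.
have infJ : has_inf (range J).
  split; first by exists (J 0), 0.
  by exists (- c ^+ 2) => _ [x _ <-]; exact: JB.
pose m := inf (range J).
have Jm x : m <= J x by apply: ge_inf; [case: infJ|exists x].
have half x : nrm ((2^-1)%:C *: x) ^+ 2 = nrm x ^+ 2 / 4.
  by rewrite nrmZ normc_nneg ?invr_ge0 // exprMn; field.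
have [||e e0|y yP] := @cantor_nrm H (fun e => [set x | J x <= m + e]).
- by move=> e e' x ee' /= /le_trans; apply; rewrite lerD2l.
- move=> e e0; have [_ [x _ <-] xe] := inf_adherent e0 infJ.
  by exists x => /=; rewrite ltW.
(* Parallelogram law: [J x + J y - 2 J ((x + y) / 2) = |x - y|^2 / 2], so two points within [d] of
   the infimum satisfy [|x - y|^2 <= 4 d]. *)
- exists (e ^+ 2 / 4); first by rewrite divr_gt0 ?exprn_gt0.
  move=> x y /= Jx Jy; rewrite -(@ler_pXn2r _ 2) ?nnegrE ?nrm_ge0 ?(ltW e0) //.
  have := Jm ((2^-1)%:C *: (x + y)); move: Jx Jy.
  rewrite /J half nrm_sqrB gZ gD nrm_sqrD; lra.
(* [y] is only a limit of almost minimizers. The variation is therefore computed at a nearby [x];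
   [k] collects the coefficients of the resulting error. *)
have Jy z t : 0 <= t ^+ 2 * nrm z ^+ 2 +
    2 * t * (complex.Re (hdot y z) - g z).
  apply/ler_addgt0Pl => e e0.
  pose k := 2 * `|t| * nrm z + 1.
  have k0 : 0 < k by rewrite ltr_wpDl // mulr_ge0 ?nrm_ge0 ?mulr_ge0.
  have d0 : 0 < e / (k + 1) by rewrite divr_gt0 // ltr_wpDl // ltW.
  have [x /= Jx xy] := yP _ d0.
  have := Jm (x + t%:C *: z); move: Jx; rewrite /J nrm_sqrD nrmZ normc_real.
  rewrite exprMn real_normK ?num_real // gD gZ hdotZr conjc_real.
  have -> : complex.Re (t%:C * hdot x z) =
    t * complex.Re (hdot y z) - t * complex.Re (hdot (y - x) z).
    by rewrite hdotBl; case: (hdot x z) (hdot y z) => a b [u v] /=; ring.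
  have : - (t * complex.Re (hdot (y - x) z)) <= `|t| * (e / (k + 1) * nrm z).
    apply: le_trans (ler_norm _) _; rewrite normrN normrM ler_wpM2l //.
    apply: le_trans (_ : nrm (y - x) * nrm z <= _); last first.
      by rewrite ler_wpM2r ?nrm_ge0.
    apply: le_trans (cauchy_schwarz _ _).
    by rewrite -lecR -normcC normc_ge_Re.
  have kE : e / (k + 1) + 2 * (`|t| * (e / (k + 1) * nrm z)) = e * (k / (k + 1)).
    by rewrite /k; field; rewrite gt_eqF // ltr_wpDl // ltW.
  have : e * (k / (k + 1)) <= e.
    by rewrite ger_pMr // ler_pdivrMr ?mul1r ?lerDl // ltr_wpDl // ltW.
  by rewrite -kE; lra.
have Rey z : complex.Re (f z) = complex.Re (hdot z y).
  have /eqP := minimizer_ortho (sqr_ge0 _) (Jy z).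
  rewrite subr_eq0 eq_sym => /eqP; rewrite /g => ->; rewrite (hdotC z y).
  by case: (hdot z y).
(* The real parts agree at every vector; applying this to ['i *: z] gives the imaginary parts. *)
exists y => z; have := Rey ('i *: z); rewrite fZ hdotZl.
move: (Rey z); case: (f z) (hdot z y) => a b [u v] /= -> e.
by apply/eqP; rewrite eq_complex /=; apply/andP; split; apply/eqP; lra.
Qed.

(** Unlike [bounded_op], this keeps the constant and allows two different spaces, as required by the
    slices between [H m] and the tensor product. *)
Definition bounded_by H1 H2 (X : H1 -> H2) (c : R) : Prop :=
  [/\ linear X, 0 <= c & forall x, nrm (X x) <= c * nrm x].

Lemma bounded_byP H (X : H -> H) : bounded_op X <-> exists c, bounded_by X c.
Proof.
split=> [[lX cX]|[c [lX c0 Xc]]].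
  by have [c [c0 Xc]] := (bounded_opP lX).1 cX; exists c.
by split=> //; apply: (bounded_opP lX).2; exists c.
Qed.

Lemma bounded_by_cvg H1 H2 (X : H1 -> H2) c (T : Type) (F : set_system T)
    {FF : Filter F} (f : T -> H1) (l : H1) :
  bounded_by X c -> f t @[t --> F] --> l -> X (f t) @[t --> F] --> X l.
Proof.
move=> [lX c0 Xc] fl.
apply: cvg_comp fl _; apply: (bounded_opP lX).2.
by exists c.
Qed.

Lemma bounded_by_comp H1 H2 H3 (X : H2 -> H3) (Y : H1 -> H2) c d :
  bounded_by X c -> bounded_by Y d -> bounded_by (X \o Y) (c * d).
Proof.
move=> [lX c0 Xc] [lY d0 Yd]; split; last 2 first.
- by rewrite mulr_ge0.
- by move=> x /=; apply: le_trans (Xc _) _; rewrite -mulrA ler_wpM2l.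
- by move=> a x y /=; rewrite lY lX.
Qed.

Lemma bounded_by_sum H1 H2 (I : Type) (r : seq I) (P : pred I)
    (X : I -> H1 -> H2) (c : I -> R) :
  (forall i, P i -> bounded_by (X i) (c i)) ->
  bounded_by (fun x => \sum_(i <- r | P i) X i x) (\sum_(i <- r | P i) c i).
Proof.
move=> Xc; split.
- move=> a x y; rewrite scaler_sumr -big_split /=.
  by apply: eq_bigr => i /Xc[lX _ _]; rewrite lX.
- by rewrite sumr_ge0 // => i /Xc[].
- move=> x; apply: le_trans (nrm_sum _ _ _) _; rewrite mulr_suml.
  by apply: ler_sum => i /Xc[_ _]; apply.
Qed.

Lemma bounded_by_rank1 H1 H2 (x : H2) (y : H1) :
  bounded_by (fun u => hdot u y *: x) (nrm x * nrm y).
Proof.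
split; last 2 first.
- by rewrite mulr_ge0 ?nrm_ge0.
- move=> u; rewrite nrmZ mulrC -mulrA ler_wpM2l ?nrm_ge0 // mulrC.
  exact: cauchy_schwarz.
- by move=> a u v; rewrite hdotDl hdotZl scalerDl scalerA.
Qed.

Definition adj H1 H2 (X : H1 -> H2) (y : H2) : H1 :=
  xget 0 [set z | forall x, hdot (X x) y = hdot x z].

Lemma adjP H1 H2 (X : H1 -> H2) c : bounded_by X c ->
  forall x y, hdot (X x) y = hdot x (adj X y).
Proof.
move=> [lX c0 Xc] x y; rewrite /adj; case: xgetP => [z _ ->//|none].
have [a u v|u|z zP] := @riesz H1 (fun x => hdot (X x) y) (c * nrm y).
- by rewrite lX hdotDl hdotZl.
- apply: le_trans (cauchy_schwarz _ _) _.
  by rewrite mulrAC ler_wpM2r ?nrm_ge0.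
by case: (none z).
Qed.

Lemma adj_hdot H1 H2 (X : H1 -> H2) c : bounded_by X c ->
  forall x y, hdot (adj X y) x = hdot y (X x).
Proof. by move=> Xc x y; rewrite hdotC -(adjP Xc) -hdotC. Qed.

Lemma adj_bounded_by H1 H2 (X : H1 -> H2) c :
  bounded_by X c -> bounded_by (adj X) c.
Proof.
move=> Xc; have [lX c0 Xn] := Xc; split=> //.
  move=> a u v; apply: hdot_inj => z.
  by rewrite hdotDl hdotZl !(adj_hdot Xc) hdotDl hdotZl.
move=> y; apply: nrm_le_test; first by rewrite mulr_ge0 ?nrm_ge0.
move=> z; rewrite (adj_hdot Xc); apply: le_trans (cauchy_schwarz _ _) _.
by rewrite mulrAC [leRHS]mulrC ler_wpM2l ?nrm_ge0.
Qed.

End Riesz.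

(** * Orthonormal bases *)

Section OrthonormalBasis.
Context {R : realType}.
Implicit Types H : hilbertType R.

Lemma exists_orthonormal_basis H : exists B : set H, orthonormal_basis B.
Proof.
pose ortho (B : set H) :=
  forall e f, B e -> B f -> hdot e f = (e == f)%:R.
have [F Fortho Ftot|B [Bortho Bmax]] := @Zorn_bigcup H ortho.
  move=> e f [X FX Xe] [Y FY Yf].
  by have [XY|YX] := Ftot X Y FX FY;
    [apply: (Fortho Y)|apply: (Fortho X)] => //; [exact: XY|exact: YX].
exists B; split=> // x xB; apply/eqP; apply: contrapT => /negP x0.
have nx : nrm x != 0 by rewrite nrm_eq0.
pose u := (nrm x)^-1%:C *: x.
have uB e : B e -> hdot u e = 0 by move=> /xB xe; rewrite hdotZl xe mulr0.
have uu : hdot u u = 1.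
  rewrite hdotZl hdotZr conjc_real hdot_nrm -!rmorphM /=.
  by have -> : (nrm x)^-1 * ((nrm x)^-1 * nrm x ^+ 2) = 1 by field.
have NBu : ~ B u.
  by move=> /uB; rewrite uu => /eqP; rewrite oner_eq0.
apply: (Bmax (B `|` [set u])).
  by split; [move=> e Be; left|move=> /(_ u) /(_ (or_intror erefl))].
move=> e f [Be|->] [Bf|->]; rewrite ?uu ?eqxx //.
- exact: Bortho.
- rewrite hdotC uB // conjc0; case: eqP => // eu.
  by case: NBu; rewrite -eu.
- by rewrite uB //; case: eqP => // uf; case: NBu; rewrite uf.
Qed.

Lemma hbasisP H : orthonormal_basis (hbasis H).
Proof.
rewrite /hbasis; case: xgetP => [B _ //|none].
by have [B BP] := exists_orthonormal_basis H; case: (none B).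
Qed.

Definition basis_seq H (s : seq H) : Prop :=
  uniq s /\ forall e, e \in s -> hbasis H e.

Definition hproj H (s : seq H) (x : H) : H := \sum_(e <- s) hdot x e *: e.

Lemma hbasis_hdot H (e f : H) :
  hbasis H e -> hbasis H f -> hdot e f = (e == f)%:R.
Proof. exact: (hbasisP H).1. Qed.

Lemma hbasis_nrm H (e : H) : hbasis H e -> nrm e = 1.
Proof.
move=> He; apply/eqP; rewrite -(@eqrXn2 _ 2) ?nrm_ge0 // expr1n.
by rewrite -Re_hdot_nrm hbasis_hdot // eqxx.
Qed.

Lemma basis_seqU H (s t : seq H) :
  basis_seq s -> basis_seq t -> basis_seq (undup (s ++ t)).
Proof.
move=> [_ sH] [_ tH]; split; first exact: undup_uniq.
by move=> e; rewrite mem_undup mem_cat => /orP[/sH|/tH].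
Qed.

Lemma sum_basis_hdot H (s : seq H) (c : H -> R[i]) f : basis_seq s ->
  hbasis H f -> hdot (\sum_(e <- s) c e *: e) f = if f \in s then c f else 0.
Proof.
move=> [us sH] Hf; rewrite hdot_suml.
rewrite (eq_big_seq (fun e => if e == f then c f else 0)); last first.
  move=> e /sH He; rewrite hdotZl hbasis_hdot //.
  by case: eqP => [->|]; rewrite ?mulr1 ?mulr0.
case: ifPn => fs.
  by rewrite (bigD1_seq f) //= eqxx big1 ?addr0 // => e /negPf->.
rewrite big1_seq // => e /andP[_ es]; case: eqP => // ef.
by rewrite -ef es in fs.
Qed.

Lemma hproj_hdot H (s : seq H) x f : basis_seq s -> f \in s ->
  hdot (hproj s x) f = hdot x f.
Proof.
move=> bs fs; have Hf := bs.2 f fs.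
by rewrite (sum_basis_hdot (hdot x) bs Hf) fs.
Qed.

Lemma hproj_linear H (s : seq H) : linear (hproj s).
Proof.
move=> a x y; rewrite /hproj scaler_sumr -big_split /=; apply: eq_bigr => e _.
by rewrite hdotDl hdotZl scalerDl scalerA.
Qed.

Lemma hproj_sub H (s t : seq H) x : basis_seq t -> {subset s <= t} ->
  hproj s (hproj t x) = hproj s x.
Proof. by move=> bt st; apply: eq_big_seq => e /st et; rewrite hproj_hdot. Qed.

Lemma hproj_sym H (s : seq H) x y : hdot (hproj s x) y = hdot x (hproj s y).
Proof.
rewrite hdot_suml hdot_sumr; apply: eq_bigr => e _.
by rewrite hdotZl hdotZr -hdotC mulrC.
Qed.

Lemma hproj_pythagoras H (s : seq H) x : basis_seq s ->
  nrm x ^+ 2 = nrm (hproj s x) ^+ 2 + nrm (x - hproj s x) ^+ 2.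
Proof.
move=> bs.
have xp : hdot x (hproj s x) = (nrm (hproj s x) ^+ 2)%:C.
  by rewrite -[in LHS](@hproj_sub _ s s) // -hproj_sym hdot_nrm.
by rewrite nrm_sqrB xp /=; ring.
Qed.

Lemma hproj_nrm H (s : seq H) x : basis_seq s -> nrm (hproj s x) <= nrm x.
Proof.
move=> bs; rewrite -(@ler_pXn2r _ 2) ?nnegrE ?nrm_ge0 //.
by rewrite (hproj_pythagoras x bs) lerDl sqr_ge0.
Qed.

Lemma hproj_bounded_by H (s : seq H) : basis_seq s -> bounded_by (hproj s) 1.
Proof.
move=> bs; split=> //; first exact: hproj_linear.
by move=> x; rewrite mul1r hproj_nrm.
Qed.

Lemma hproj_mono H (s t : seq H) x : basis_seq s -> basis_seq t ->
  {subset s <= t} -> nrm (x - hproj t x) <= nrm (x - hproj s x).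
Proof.
move=> bs bt st; rewrite -(@ler_pXn2r _ 2) ?nnegrE ?nrm_ge0 //.
have := hproj_pythagoras x bs; have := hproj_pythagoras x bt.
have : nrm (hproj s x) ^+ 2 <= nrm (hproj t x) ^+ 2.
  rewrite ler_pXn2r ?nnegrE ?nrm_ge0 //.
  by rewrite -(hproj_sub x bt st) hproj_nrm.
by move=> h1 h2 h3; lra.
Qed.

(** The squared norms of the finite projections of [x] have a supremum, and by Pythagoras almost
    maximal ones are close to each other. Their limit has the same coefficients as [x], hence equals
    [x] by totality of the basis. *)
Lemma parseval H (x : H) (d : R) : 0 < d ->
  exists2 s, basis_seq s & forall t, basis_seq t -> {subset s <= t} ->
    nrm (x - hproj t x) <= d.
Proof.
pose S := [set nrm (hproj s x) ^+ 2 | s in @basis_seq H].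
have bs0 : basis_seq ([::] : seq H) by split.
have supS : has_sup S.
  split; first by exists (nrm (hproj [::] x) ^+ 2), [::].
  exists (nrm x ^+ 2) => _ [s bs <-].
  by rewrite ler_pXn2r ?nnegrE ?nrm_ge0 // hproj_nrm.
have Ssup s : basis_seq s -> nrm (hproj s x) ^+ 2 <= sup S.
  by move=> bs; apply: ub_le_sup; [case: supS|exists s].
pose P e := [set y | exists s, [/\ basis_seq s, y = hproj s x &
  sup S - e <= nrm (hproj s x) ^+ 2]].
have close e s t : 0 < e -> basis_seq s -> basis_seq t -> {subset s <= t} ->
    sup S - e ^+ 2 <= nrm (hproj s x) ^+ 2 ->
    nrm (hproj t x - hproj s x) <= e.
  move=> e0 bs bt st se; rewrite -(@ler_pXn2r _ 2) ?nnegrE ?nrm_ge0 ?(ltW e0) //.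
  have := hproj_pythagoras (hproj t x) bs; rewrite (hproj_sub x bt st).
  by have := Ssup t bt; lra.
have [e e' y ee' [s [bs -> se]]|e e0|e e0|l lP] := @cantor_nrm R H P.
- by exists s; split=> //; apply: le_trans se; rewrite lerD2l lerN2.
- have [_ [s bs <-] se] := sup_adherent e0 supS.
  by exists (hproj s x), s; split=> //; exact: ltW.
- have e20 : 0 < e / 2 by rewrite divr_gt0.
  exists ((e / 2) ^+ 2); first by rewrite exprn_gt0.
  move=> _ _ [s [bs -> se]] [t [bt -> te]].
  have br := basis_seqU bs bt.
  have h1 : nrm (hproj (undup (s ++ t)) x - hproj s x) <= e / 2.
    by apply: close => // f fs; rewrite mem_undup mem_cat fs.
  have h2 : nrm (hproj (undup (s ++ t)) x - hproj t x) <= e / 2.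
    by apply: close => // f fs; rewrite mem_undup mem_cat fs orbT.
  rewrite nrmBC in h1.
  have := le_trans (nrmD _ _) (lerD h1 h2).
  by rewrite addrA subrK -splitr.
have xl : x = l.
  apply/eqP; rewrite -subr_eq0; apply/eqP; apply: (hbasisP H).2 => f Hf.
  apply/eqP; rewrite -normc_eq0 eq_le normc_ge0 andbT.
  apply/ler_addgt0Pl => e e0; rewrite addr0.
  (* The bound [e / 2] controls the distance to [l]; the bound [(e / 2) ^+ 2] is the one that
     [close] needs when [f] is adjoined to [s]. *)
  pose d' := Num.min (e / 2) ((e / 2) ^+ 2).
  have e20 : 0 < e / 2 by rewrite divr_gt0.
  have d'0 : 0 < d' by rewrite lt_min e20 exprn_gt0.
  have [_ [s [bs -> se]] ls] := lP d' d'0.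
  have bf : basis_seq [:: f] by split=> // g; rewrite inE => /eqP->.
  have bt := basis_seqU bs bf.
  have h1 : nrm (hproj (undup (s ++ [:: f])) x - hproj s x) <= e / 2.
    apply: close => //; first by move=> g gs; rewrite mem_undup mem_cat gs.
    by apply: le_trans se; rewrite lerD2l lerN2 ge_min lexx orbT.
  have h2 : nrm (hproj s x - l) <= e / 2.
    by rewrite nrmBC (le_trans ls) // ge_min lexx.
  have -> : hdot (x - l) f =
      hdot (hproj (undup (s ++ [:: f])) x - hproj s x + (hproj s x - l)) f.
    rewrite addrA subrK !hdotBl hproj_hdot //.
    by rewrite mem_undup mem_cat inE eqxx orbT.
  apply: le_trans (cauchy_schwarz _ _) _; rewrite (hbasis_nrm Hf) mulr1.
  by rewrite [leRHS]splitr; apply: le_trans (nrmD _ _) (lerD h1 h2).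
move=> d0; have [_ [s [bs -> _]]] := lP d d0; rewrite -xl => xs.
by exists s => // t bt st; apply: le_trans xs; exact: hproj_mono.
Qed.

Lemma parseval_fam H (I : finType) (x : I -> H) (d : R) : 0 < d ->
  exists2 s, basis_seq s & forall t, basis_seq t -> {subset s <= t} ->
    forall i, nrm (x i - hproj t (x i)) <= d.
Proof.
move=> d0.
have /choice[s sP] : forall i, exists s, basis_seq s /\
    forall t, basis_seq t -> {subset s <= t} -> nrm (x i - hproj t (x i)) <= d.
  by move=> i; have [s bs sP] := parseval (x i) d0; exists s.
exists (undup (flatten [seq s i | i <- enum I])).
  split; first exact: undup_uniq.
  move=> e; rewrite mem_undup => /flatten_mapP[i _]; exact: (sP i).1.2.
move=> t bt st i; apply: (sP i).2 => // e es; apply: st.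
by rewrite mem_undup; apply/flatten_mapP; exists i; rewrite ?mem_enum.
Qed.

Lemma finite_hbasis H : finite_hdim H ->
  exists2 s, basis_seq s & forall x : H, hproj s x = x.
Proof.
move=> /finite_seqP[s0 s0E]; have s0P e : e \in undup s0 <-> hbasis H e.
  by rewrite mem_undup s0E.
exists (undup s0); first by split; [exact: undup_uniq|move=> e /s0P].
move=> x; apply/eqP; rewrite -subr_eq0; apply/eqP; apply: (hbasisP H).2 => e He.
rewrite hdotBl hproj_hdot ?subrr //; last exact/s0P.
by split; [exact: undup_uniq|move=> f /s0P].
Qed.

Lemma basis_seq_esum H (f : H -> R) : (forall e, 0 <= f e) ->
  forall c : R, ((\esum_(e in hbasis H) (f e)%:E)%E <= c%:E)%E <->
    forall s, basis_seq s -> \sum_(e <- s) f e <= c.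
Proof.
move=> f0 c; split=> [le_c s [us sH]|le_c].
  rewrite -lee_fin -sumEFin; apply: le_trans le_c; apply: esum_ge.
  exists [set` s]; last by rewrite fsbig_seq.
  by split; [exact: finite_seq|move=> e /sH].
apply: ge_ereal_sup => _ [A [finA AH] <-].
rewrite fsbig_finite // sumEFin lee_fin; apply: le_c; split.
  exact: finmap.fset_uniq.
by move=> e; rewrite in_fset_set // inE => /AH.
Qed.

End OrthonormalBasis.

(** * Square roots of positive operators *)

Section OperatorPolynomials.
Context {R : realType} {H : hilbertType R}.
Implicit Types (B X Y : H -> H) (p q : {poly R[i]}).

Definition pev B p (x : H) : H := \sum_(i < size p) p`_i *: iter i B x.

Lemma pevE B p n x : (size p <= n)%N ->
  pev B p x = \sum_(i < n) p`_i *: iter i B x.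
Proof.
move=> pn; rewrite /pev (big_ord_widen n (fun i => p`_i *: iter i B x)) //.
rewrite big_mkcond; apply: eq_bigr => i _; case: ltnP => // ip.
by rewrite nth_default // scale0r.
Qed.

Lemma pevD B p q x : pev B (p + q) x = pev B p x + pev B q x.
Proof.
rewrite (pevE _ _ (size_polyD p q)) (pevE _ _ (leq_maxl (size p) (size q))).
rewrite (pevE _ _ (leq_maxr (size p) (size q))) -big_split /=.
by apply: eq_bigr => i _; rewrite coefD scalerDl.
Qed.

Lemma pevZ B a p x : pev B (a *: p) x = a *: pev B p x.
Proof.
rewrite (pevE _ _ (size_scale_leq a p)) /pev scaler_sumr.
by apply: eq_bigr => i _; rewrite coefZ scalerA.
Qed.

Lemma pevB B p q x : pev B (p - q) x = pev B p x - pev B q x.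
Proof. by rewrite pevD -scaleN1r pevZ scaleN1r. Qed.

Lemma pevC B a x : pev B a%:P x = a *: x.
Proof.
by rewrite (pevE _ _ (size_polyC_leq1 a)) big_ord1 coefC.
Qed.

Lemma pevMX B p x : pev B (p * 'X) x = pev B p (B x).
Proof.
have s : (size (p * 'X)%R <= (size p).+1)%N.
  have [->|p0] := eqVneq p 0; first by rewrite mul0r size_poly0.
  by rewrite size_mulX.
rewrite (pevE _ _ s) big_ord_recl coefMX scale0r add0r.
by apply: eq_bigr => i _; rewrite coefMX /= -iterSr.
Qed.

Lemma pev_comm B Y p x : linear Y -> (forall x, Y (B x) = B (Y x)) ->
  Y (pev B p x) = pev B p (Y x).
Proof.
move=> lY YB; rewrite (linear_sumE lY); apply: eq_bigr => i _.
rewrite (linear_scale lY); congr (_ *: _).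
by elim: (nat_of_ord i) => //= n IHn; rewrite YB IHn.
Qed.

Lemma pev_linear B p : linear B -> linear (pev B p).
Proof.
move=> lB a x y; rewrite /pev scaler_sumr -big_split /=; apply: eq_bigr => i _.
suff -> : iter i B (a *: x + y) = a *: iter i B x + iter i B y.
  by rewrite scalerDr !scalerA mulrC.
by elim: (nat_of_ord i) => //= n ->; rewrite lB.
Qed.

Lemma pevM B p q x : linear B -> pev B (p * q) x = pev B p (pev B q x).
Proof.
move=> lB; elim/poly_ind: p x => [|p c IHp] x.
  by rewrite mul0r -[0]/(0%:P) !pevC !scale0r.
rewrite mulrDl mul_polyC !pevD pevZ pevC pevMX; congr (_ + _).
by rewrite -mulrA [_ * q]mulrC mulrA pevMX IHp (pev_comm _ _ lB).
Qed.

(** In the order of [R[i]] this also says that the coefficients are real, which makes such a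
    polynomial in a symmetric operator symmetric. *)
Definition nneg_coef p : Prop := forall i, 0 <= p`_i.

Lemma nneg_coefC a : 0 <= a -> nneg_coef a%:P.
Proof. by move=> a0 i; rewrite coefC; case: ifP. Qed.

Lemma nneg_coefX : nneg_coef 'X.
Proof. by move=> i; rewrite coefX; case: eqP. Qed.

Lemma nneg_coefD p q : nneg_coef p -> nneg_coef q -> nneg_coef (p + q).
Proof. by move=> p0 q0 i; rewrite coefD addr_ge0. Qed.

Lemma nneg_coefM p q : nneg_coef p -> nneg_coef q -> nneg_coef (p * q).
Proof.
by move=> p0 q0 i; rewrite coefM sumr_ge0 // => j _; rewrite mulr_ge0.
Qed.

Lemma nneg_coefZ a p : 0 <= a -> nneg_coef p -> nneg_coef (a *: p).
Proof. by move=> a0 p0 i; rewrite coefZ mulr_ge0. Qed.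

Lemma pev_sym B p : (forall x y, hdot (B x) y = hdot x (B y)) ->
  nneg_coef p ->
  forall x y, hdot (pev B p x) y = hdot x (pev B p y).
Proof.
move=> symB p0 x y; rewrite hdot_suml hdot_sumr.
apply: eq_bigr => i _; rewrite hdotZl hdotZr.
have /complex_realP[k ->] := ger0_real (p0 i); rewrite conjc_real; congr (_ * _).
by elim: (nat_of_ord i) x y => //= n IHn x y; rewrite symB IHn -iterSr.
Qed.

(* The even powers are squares, so that it is enough to know the positivity of
   [Y] and of [Y \o B]. *)
Lemma pev_positive B Y p : linear Y ->
  (forall x y, hdot (B x) y = hdot x (B y)) ->
  (forall x, Y (B x) = B (Y x)) -> positive_op Y -> positive_op (Y \o B) ->
  nneg_coef p -> positive_op (Y \o pev B p).
Proof.
move=> lY symB YB pY pYB p0 x.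
have symi n u v : hdot (iter n B u) v = hdot u (iter n B v).
  by elim: n u v => //= n IHn u v; rewrite symB IHn -iterSr.
have Yi n u : Y (iter n B u) = iter n B (Y u).
  by elim: n => //= n IHn; rewrite YB IHn.
rewrite /= (linear_sumE lY) hdot_suml sumr_ge0 // => i _.
rewrite (linear_scale lY) hdotZl mulr_ge0 //.
rewrite -(odd_double_half i) -addnn addnCA !iterD Yi symi.
by case: (odd i); [exact: pYB|exact: pY].
Qed.

Lemma pev_bounded_by B p c : bounded_by B c -> exists d, bounded_by (pev B p) d.
Proof.
move=> [lB c0 Bc].
have Bi n : bounded_by (iter n B) (c ^+ n).
  elim: n => [|n [lBn cn0 Bn]].
    by split=> // x; rewrite /= expr0 mul1r.
  split=> [a x y||x]; rewrite ?exprn_ge0 //; first by rewrite /= lBn lB.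
  by rewrite /= exprS -mulrA; apply: le_trans (Bc _) _; rewrite ler_wpM2l.
exists (\sum_(i < size p) normc p`_i * c ^+ i).
apply: bounded_by_sum => i _; have [lBi ci Bic] := Bi i; split.
- by move=> a x y; rewrite lBi scalerDr !scalerA [a * _]mulrC.
- by rewrite mulr_ge0 ?normc_ge0.
- by move=> x; rewrite nrmZ -mulrA ler_wpM2l ?normc_ge0.
Qed.

End OperatorPolynomials.

(** * Strong limits of sequences of operators *)

Section StrongConvergence.
Context {R : realType}.

(** The uniform bound [c] is what lets strong convergence act on a moving argument; it is applied to
    the squares of the iterates. *)
Lemma cvg_strong_comp (H1 H2 : hilbertType R) (X : nat -> H1 -> H2)
    (X0 : H1 -> H2) (c : R) (u : nat -> H1) (l : H1) :
  0 <= c -> (forall n, linear (X n)) ->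
  (forall n x, nrm (X n x) <= c * nrm x) ->
  (forall x, X n x @[n --> \oo] --> X0 x) ->
  u n @[n --> \oo] --> l -> X n (u n) @[n --> \oo] --> X0 l.
Proof.
move=> c0 lX Xc XX0 /cvg_nrmP ul; apply/cvg_nrmP => e e0.
have /cvg_nrmP Xl := XX0 l.
have c1 : 0 < c + 1 by rewrite ltr_wpDl.
near=> n.
have -> : X0 l - X n (u n) = (X0 l - X n l) + X n (l - u n).
  by rewrite (linear_sub (lX n)) addrA subrK.
apply: le_trans (nrmD _ _) _; rewrite [leRHS](splitr e) lerD //.
  by near: n; apply: Xl; rewrite divr_gt0.
apply: le_trans (Xc _ _) _; apply: le_trans (_ : (c + 1) * nrm (l - u n) <= _).
  by rewrite ler_wpM2r ?nrm_ge0 // lerDl.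
rewrite -ler_pdivlMl //; near: n; apply: ul.
by rewrite mulr_gt0 ?invr_gt0 // divr_gt0.
Unshelve. all: by end_near. Qed.

Lemma linear_limit (H1 H2 : hilbertType R) (X : nat -> H1 -> H2)
    (X0 : H1 -> H2) : (forall n, linear (X n)) ->
  (forall x, X n x @[n --> \oo] --> X0 x) -> linear X0.
Proof.
move=> lX XX0 a x y.
apply: (@cvg_unique _ (@norm_hausdorff _ _) (X n (a *: x + y) @[n --> \oo])).
  exact: XX0.
rewrite (_ : (fun n => _) = (fun n => a *: X n x + X n y)); last first.
  by apply/funext => n; rewrite lX.
by apply: cvgD; [apply: cvgZr; exact: XX0|exact: XX0].
Qed.

End StrongConvergence.

(** * A polynomial iteration for the square root *)

Section SquareRoot.
Context {R : realType}.

Let half : R[i] := 2^-1.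

(* The iteration [y |-> (X + y^2) / 2] for [1 - sqrt (1 - X)], started from
   above at [1]: [1 - sqrt_y n = (1 - X) sqrt_r n] increases to [sqrt (1 - X)],
   and its increments [(1 - X) sqrt_c n] are [1 - X] times a polynomial with
   nonnegative coefficients. The factor [1 - X], which the iteration started
   at [0] does not produce, becomes [P] when [X] is replaced by [1 - P], and the
   polar decomposition below depends on it. *)
Fixpoint sqrt_y (n : nat) : {poly R[i]} :=
  if n is m.+1 then half *: ('X + sqrt_y m * sqrt_y m) else 1.

Fixpoint sqrt_c (n : nat) : {poly R[i]} :=
  if n is m.+1 then half *: (sqrt_c m * (sqrt_y m + sqrt_y m.+1)) else half%:P.

Definition sqrt_r (n : nat) : {poly R[i]} := \sum_(k < n) sqrt_c k.

Let halfD (p : {poly R[i]}) : half *: p + half *: p = p.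
Proof. by rewrite -scalerDl -[half]mul1r -splitr scale1r. Qed.

(** Subtracting consecutive steps cancels ['X] and leaves half a difference of squares, so the
    factor [1 - 'X] present at the start is inherited. *)
Lemma sqrt_y_step n : sqrt_y n - sqrt_y n.+1 = (1 - 'X) * sqrt_c n.
Proof.
elim: n => [|n IHn].
  rewrite /= mul1r -mul_polyC -{1}[1](halfD 1) -mul_polyC; ring.
have -> : sqrt_y n.+1 - sqrt_y n.+2 =
    half *: ((sqrt_y n - sqrt_y n.+1) * (sqrt_y n + sqrt_y n.+1)).
  rewrite [sqrt_y n.+2]/= -/(sqrt_y n.+1) [X in X - _]/=.
  by rewrite -scalerBr; congr (_ *: _); ring.
by rewrite IHn [sqrt_c n.+1]/= -scalerAr mulrA.
Qed.

Lemma sqrt_yB n m : (n <= m)%N ->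
  sqrt_y n - sqrt_y m = (1 - 'X) * \sum_(n <= k < m) sqrt_c k.
Proof.
move=> nm; rewrite mulr_sumr (@telescope_sumr_eq _ n m (fun k => - sqrt_y k)) //.
  by rewrite opprK addrC.
by move=> k _; rewrite -sqrt_y_step opprK addrC.
Qed.

Lemma sqrt_q_r n : 1 - sqrt_y n = (1 - 'X) * sqrt_r n.
Proof. by rewrite -[1 in LHS]/(sqrt_y 0) sqrt_yB // big_mkord. Qed.

(** Measures how far [sqrt_r n] is from an inverse square root of [1 - 'X]. The recursion gives [2
    (y_n - y_(n+1)) = (1 - X) - (1 - y_n)^2], and cancelling [1 - X] gives this identity; the
    induction avoids the cancellation. *)
Lemma sqrt_qr n : 1 - (1 - 'X) * (sqrt_r n * sqrt_r n) = 2%:P * sqrt_c n.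
Proof.
elim: n => [|n IHn].
  rewrite /sqrt_r big_ord0 !mulr0 subr0 /= -polyCM /half.
  by rewrite mulfV ?pnatr_eq0.
have -> : sqrt_r n.+1 = sqrt_r n + sqrt_c n by rewrite /sqrt_r big_ord_recr.
have -> : 1 - (1 - 'X) * ((sqrt_r n + sqrt_c n) * (sqrt_r n + sqrt_c n)) =
    (1 - (1 - 'X) * (sqrt_r n * sqrt_r n)) - sqrt_c n *
    ((1 - 'X) * sqrt_r n + ((1 - 'X) * sqrt_r n + (1 - 'X) * sqrt_c n)) by ring.
rewrite IHn -sqrt_q_r -sqrt_y_step [sqrt_c n.+1]/= -/(sqrt_y n.+1).
rewrite -[X in _ = _ * X]mul_polyC mulrA -polyCM /half mulfV ?pnatr_eq0 //.
have -> : 2%:P = 1 + 1 :> {poly R[i]} by rewrite -polyC1 -polyCD.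
ring.
Qed.

Let half_ge0 : 0 <= half.
Proof. by rewrite invr_ge0. Qed.

Lemma sqrt_y_nneg n : nneg_coef (sqrt_y n).
Proof.
elim: n => [|n IHn]; first by apply: nneg_coefC; exact: ler01.
apply: nneg_coefZ => //; apply: nneg_coefD; first exact: nneg_coefX.
exact: nneg_coefM.
Qed.

Lemma sqrt_c_nneg n : nneg_coef (sqrt_c n).
Proof.
elim: n => [|n IHn]; first exact: nneg_coefC.
apply: nneg_coefZ => //; apply: nneg_coefM => //.
by apply: nneg_coefD; exact: sqrt_y_nneg.
Qed.

Lemma sqrt_c_sum_nneg (I : Type) (s : seq I) (n : I -> nat) :
  nneg_coef (\sum_(k <- s) sqrt_c (n k)).
Proof.
elim/big_rec: _ => [|k p _ p0]; first by move=> i; rewrite coef0.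
by apply: nneg_coefD => //; exact: sqrt_c_nneg.
Qed.

Lemma sqrt_r_nneg n : nneg_coef (sqrt_r n).
Proof. exact: sqrt_c_sum_nneg. Qed.

Variable H : hilbertType R.

(** This is [X^2 <= X] for [0 <= X <= 1]: Cauchy-Schwarz for the form of [X] at the pair [x],
    [X x]. *)
Lemma positive_contraction (X : H -> H) : linear X -> positive_op X ->
  (forall x, complex.Re (hdot (X x) x) <= nrm x ^+ 2) ->
  forall x, nrm (X x) ^+ 2 <= complex.Re (hdot (X x) x).
Proof.
move=> lX pX X1 x; have := positive_cauchy_schwarz lX pX x (X x).
have := X1 (X x); have := positive_op_Re_ge0 pX x.
rewrite hdot_nrm normc_nneg ?sqr_ge0 //.
set a := nrm (X x) ^+ 2; set b := complex.Re _; set c := complex.Re _.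
have a0 : 0 <= a by exact: sqr_ge0.
move=> b0 ca ab; have [->//|an0] := eqVneq a 0.
have ap : 0 < a by rewrite lt_neqAle eq_sym an0.
by rewrite -(ler_pM2r ap) -expr2; apply: le_trans ab _; rewrite ler_wpM2l.
Qed.

Lemma positive_contraction_nrm (X : H -> H) : linear X -> positive_op X ->
  (forall x, complex.Re (hdot (X x) x) <= nrm x ^+ 2) ->
  forall x, nrm (X x) <= nrm x.
Proof.
move=> lX pX X1 x; rewrite -(@ler_pXn2r _ 2) ?nnegrE ?nrm_ge0 //.
exact: le_trans (positive_contraction lX pX X1 x) (X1 x).
Qed.

(* [S n] approximates [P^(-1/2)] on the support of [P]. The last clause lets
   [P (S n (S n x))] play the role of the projection onto that support. *)
Definition sqrt_approx (P Q : H -> H) (S : nat -> H -> H) : Prop :=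
  [/\ exists c, bounded_by Q c,
      positive_op Q /\ (forall x, Q (Q x) = P x),
      (forall n, exists c, bounded_by (S n) c),
      (forall x, P (S n x) @[n --> \oo] --> Q x) &
      forall n x, nrm (P (S n (S n x))) <= nrm x /\
        hdot (P x) (P (S n (S n x))) = (nrm (P (S n x)) ^+ 2)%:C].

Lemma sqrt_contraction (P : H -> H) : linear P -> positive_op P ->
  (forall x, complex.Re (hdot (P x) x) <= nrm x ^+ 2) ->
  exists Q S, sqrt_approx P Q S.
Proof.
move=> lP pP P1.
pose B x := x - P x.
have lB : linear B.
  move=> a x y; rewrite /B lP scalerBr opprD addrACA.
  by [].
have symP := positive_op_sym lP pP.
have symB x y : hdot (B x) y = hdot x (B y) by rewrite hdotBl hdotBr symP.
have PB x : P (B x) = B (P x) by rewrite /B (linear_sub lP).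
have pB : positive_op B.
  move=> x; rewrite hdotBl hdot_nrm (positive_op_Re pP) -rmorphB ler0c.
  by rewrite subr_ge0 P1.
have lid : linear (idfun : H -> H) by [].
have pid : positive_op (idfun : H -> H).
  by move=> x; rewrite /= hdot_nrm ler0c sqr_ge0.
have pPB : positive_op (P \o B).
  move=> x; rewrite /= PB /B hdotBl [hdot (P (P x)) x]symP hdot_nrm.
  rewrite (positive_op_Re pP) -rmorphB ler0c subr_ge0.
  exact: positive_contraction.
have pev_pos p : nneg_coef p -> positive_op (pev B p).
  exact: (@pev_positive _ _ B idfun p).
have pev_posP p : nneg_coef p -> positive_op (P \o pev B p).
  exact: (@pev_positive _ _ B P p).
have pev1X p x : pev B ((1 - 'X) * p) x = P (pev B p x).
  rewrite pevM // pevB -polyC1 pevC scale1r -['X]mul1r pevMX.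
  by rewrite -polyC1 pevC scale1r /B subKr.
have pevL p : linear (pev B p) by exact: pev_linear.
pose Qn n := pev B (1 - sqrt_y n); pose Yn n := pev B (sqrt_y n).
pose S n := pev B (sqrt_r n).
have QS n x : Qn n x = P (S n x) by rewrite /Qn sqrt_q_r pev1X.
have QY n x : Qn n x = x - Yn n x by rewrite /Qn pevB -polyC1 pevC scale1r.
have YQ n x : Yn n x = x - Qn n x by rewrite QY subKr.
have posQ n : positive_op (Qn n).
  by move=> x; rewrite QS; apply: pev_posP; exact: sqrt_r_nneg.
have posY n : positive_op (Yn n) by apply: pev_pos; exact: sqrt_y_nneg.
have Re_le n x : complex.Re (hdot (Qn n x) x) <= nrm x ^+ 2.
  have := positive_op_Re_ge0 (posY n) x.
  by rewrite YQ hdotBl raddfB /= Re_hdot_nrm subr_ge0.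
have Q1 n x : nrm (Qn n x) <= nrm x.
  exact: (positive_contraction_nrm (pevL _) (posQ n) (Re_le n)).
have Y1 n x : nrm (Yn n x) <= nrm x.
  apply: (positive_contraction_nrm (pevL _) (posY n)) => z.
  rewrite -[pev _ _ _]/(Yn n z) YQ hdotBl raddfB /=.
  by rewrite Re_hdot_nrm gerBl positive_op_Re_ge0.
(* [Qn m - Qn n] is itself between 0 and 1, so the square of its norm at [x] is at most its
   quadratic form. Bounded monotone forms then give strong convergence. *)
have Qdiff n m x : (n <= m)%N -> nrm (Qn m x - Qn n x) ^+ 2 <=
    complex.Re (hdot (Qn m x) x) - complex.Re (hdot (Qn n x) x).
  move=> nm; pose D := pev B (sqrt_y n - sqrt_y m).
  have DE z : Qn m z - Qn n z = D z.
    by rewrite !QY /D pevB opprB addrC subrKA.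
  have posD : positive_op D.
    move=> z; rewrite /D sqrt_yB // pev1X; apply: pev_posP.
    exact: sqrt_c_sum_nneg.
  have DRe z : complex.Re (hdot (D z) z) =
      complex.Re (hdot (Qn m z) z) - complex.Re (hdot (Qn n z) z).
    by rewrite -DE hdotBl raddfB.
  rewrite DE -DRe; apply: positive_contraction => //; first exact: pevL.
  move=> z; rewrite DRe; have := Re_le m z.
  by have := positive_op_Re_ge0 (posQ n) z; lra.
have lim_ex : forall x, exists l : H, Qn n x @[n --> \oo] --> l.
  move=> x; apply: cvg_cauchy_nrm => e e0.
  pose A := range (fun n => complex.Re (hdot (Qn n x) x)).
  have supA : has_sup A.
    split; first by exists (complex.Re (hdot (Qn 0 x) x)), 0%N.
    by exists (nrm x ^+ 2) => _ [n _ <-].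
  have [_ [N _ <-] AN] := sup_adherent (exprn_gt0 2 e0) supA.
  exists (Qn N x); exists N => // n /= Nn.
  rewrite nrmBC -(@ler_pXn2r _ 2) ?nnegrE ?nrm_ge0 ?(ltW e0) //.
  apply: le_trans (Qdiff _ _ _ Nn) _.
  have : complex.Re (hdot (Qn n x) x) <= sup A.
    by apply: ub_le_sup; [case: supA|exists n].
  by lra.
have [Q QP] := choice lim_ex.
have lQ : linear Q by apply: (linear_limit (X := Qn)) => // n; exact: pevL.
have YP x : Yn n x @[n --> \oo] --> x - Q x.
  rewrite (_ : (fun n => _) = (fun n => x - Qn n x)); last exact/funext.
  by apply: cvgB; [exact: cvg_cst|exact: QP].
have Q1' x : nrm (Q x) <= nrm x.
  apply: (cvgr_to_le (cvg_nrm (QP x))).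
  by apply: nearW => n; exact: Q1.
exists Q, S; split.
- by exists 1; split=> // x; rewrite mul1r.
- split=> x.
    apply: (cvg_complex_ge0 (cvg_hdot (QP x) (cvg_cst _))) => n.
    exact: posQ.
  (* Limit of the recursion: with [y = 1 - Q] and [B = 1 - P], [y = (B + y^2) / 2] amounts to
     [Q^2 = P]. *)
  have YY : half *: (B x + (x - Q x - Q (x - Q x))) = x - Q x.
    apply: (@cvg_unique _ (@norm_hausdorff _ _) (Yn n.+1 x @[n --> \oo])).
      rewrite (_ : (fun n => _) = (fun n => half *: (B x + Yn n (Yn n x)))).
        apply: cvgZr; apply: cvgD; first exact: cvg_cst.
        have := @cvg_strong_comp _ _ _ Yn (fun z => z - Q z) 1 _ _ ler01.
        apply=> //; first by move=> n; exact: pevL.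
          by move=> n z; rewrite mul1r.
      apply/funext => n; rewrite /Yn /= pevZ pevD pevM //.
      by rewrite -['X]mul1r pevMX -polyC1 pevC scale1r.
    have := YP x; rewrite -(cvg_shiftS (fun n => Yn n x)); exact.
  have {}YY : B x + (x - Q x - Q (x - Q x)) = 2 *: (x - Q x).
    by rewrite -[in RHS]YY scalerA mulfV ?pnatr_eq0 // scale1r.
  move: YY; rewrite /B (linear_sub lQ) scaler_nat mulr2n addrCA.
  move=> /addrI; rewrite opprB addrA => /addIr; rewrite -addrA -[RHS]addr0.
  by move=> /addrI /eqP; rewrite addrC subr_eq0 => /eqP.
- have BB : bounded_by B 1.
    split=> // z; rewrite mul1r; apply: positive_contraction_nrm => // u.
    by rewrite /B hdotBl raddfB /= Re_hdot_nrm gerBl positive_op_Re_ge0.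
  move=> n; exact: pev_bounded_by BB.
- move=> x; rewrite (_ : (fun n => _) = Qn^~ x) //.
  by apply/funext => n; rewrite QS.
- move=> n x.
  have lS : linear (S n) by exact: pevL.
  have SP u : P (S n u) = S n (P u) by apply: pev_comm.
  have symS u v : hdot (S n u) v = hdot u (S n v).
    by apply: pev_sym => //; exact: sqrt_r_nneg.
  split; last first.
    by rewrite SP -symS -SP hdot_nrm.
  pose X z := P (S n (S n z)).
  have lX : linear X by move=> a u v; rewrite /X !(lS, lP).
  have XE z : X z = pev B ((1 - 'X) * (sqrt_r n * sqrt_r n)) z.
    by rewrite pev1X pevM.
  apply: (@positive_contraction_nrm X) => // z.
    by rewrite XE pev1X; apply: pev_posP; apply: nneg_coefM; exact: sqrt_r_nneg.
  (* By [sqrt_qr] this operator is [1 - X], so its positivity bounds [X] by the identity. *)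
  have : positive_op (pev B (2%:P * sqrt_c n)).
    by apply: pev_pos; apply: nneg_coefM (sqrt_c_nneg n); exact: nneg_coefC.
  move=> /positive_op_Re_ge0 /(_ z); rewrite -sqrt_qr pevB -XE.
  by rewrite -polyC1 pevC scale1r hdotBl raddfB /= Re_hdot_nrm subr_ge0.
Qed.

Lemma sqrt_bounded (P : H -> H) c : bounded_by P c -> positive_op P ->
  exists Q S, sqrt_approx P Q S.
Proof.
move=> [lP c0 Pc] pP.
(* Dividing by [C] makes [P] a contraction; the added 1 keeps [C] positive when [c = 0]. *)
pose C := c + 1; have C0 : 0 < C by rewrite ltr_wpDl.
pose r := Num.sqrt C; have r0 : 0 < r by rewrite sqrtr_gt0.
have rr : r%:C * r%:C = C%:C by rewrite -rmorphM -expr2 sqr_sqrtr // ltW.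
have rC0 : r%:C != 0 by rewrite eq_sym lt_eqF // ltr0c.
have C_unit : C%:C != 0 by rewrite -rr mulf_neq0.
pose P' x := C%:C^-1 *: P x.
have PE x : P x = C%:C *: P' x by rewrite /P' scalerA mulfV // scale1r.
have rK : r%:C * r%:C / r%:C = r%:C by rewrite -mulrA mulfV ?mulr1.
have rrV : r%:C * r%:C * (r%:C^-1 * r%:C^-1) = 1 by rewrite mulrA rK mulfV.
have CV : C%:C^-1 = (C^-1)%:C by rewrite fmorphV.
have lP' : linear P' by move=> a x y; rewrite /P' lP scalerDr !scalerA mulrC.
have pP' : positive_op P'.
  by move=> x; rewrite /P' hdotZl mulr_ge0 // CV ler0c invr_ge0 ltW.
have P'1 x : complex.Re (hdot (P' x) x) <= nrm x ^+ 2.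
  rewrite /P' hdotZl (positive_op_Re pP) CV -rmorphM /=.
  rewrite ler_pdivrMl //; apply: le_trans (Re_le_normc _) _.
  apply: le_trans (cauchy_schwarz _ _) _; rewrite expr2 mulrA.
  rewrite ler_wpM2r ?nrm_ge0 //; apply: le_trans (Pc x) _.
  by rewrite ler_wpM2r ?nrm_ge0 // lerDl.
clearbody P'.
have [Q [S [[d [lQ d0 Qd]] [pQ QQ] Sd SQ PS]]] := sqrt_contraction lP' pP' P'1.
have lS n : linear (S n) by have [? []] := Sd n.
exists (fun x => r%:C *: Q x), (fun n x => r%:C^-1 *: S n x).
have scaled (X : H -> H) a e : bounded_by X e ->
    bounded_by (fun x => a *: X x) (normc a * e).
  move=> [lX e0 Xe]; split=> [b x y||x].
  - by rewrite lX scalerDr !scalerA mulrC.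
  - by rewrite mulr_ge0 ?normc_ge0.
  - by rewrite nrmZ -mulrA ler_wpM2l ?normc_ge0.
split.
- by exists (normc r%:C * d); exact: scaled.
- split=> x; first by rewrite hdotZl mulr_ge0 // ler0c ltW.
  by rewrite (linear_scale lQ) scalerA rr QQ -PE.
- by move=> n; have [e Se] := Sd n; exists (normc r%:C^-1 * e); exact: scaled.
- move=> x; rewrite (_ : (fun n => _) = (fun n => r%:C *: P' (S n x))).
    by apply: cvgZr; exact: SQ.
  apply/funext => n; rewrite PE (linear_scale lP') scalerA -rr.
  by congr (_ *: _); exact: rK.
move=> n x; have [Sx eSx] := PS n x.
have PSS : P (r%:C^-1 *: S n (r%:C^-1 *: S n x)) = P' (S n (S n x)).
  rewrite (linear_scale (lS n)) PE !(linear_scale lP') !scalerA -rr.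
  rewrite -[RHS]scale1r; congr (_ *: _).
  exact: rrV.
rewrite PSS; split=> //.
have -> : P (r%:C^-1 *: S n x) = r%:C *: P' (S n x).
  by rewrite PE (linear_scale lP') scalerA -rr; congr (_ *: _); exact: rK.
rewrite PE hdotZl eSx nrmZ exprMn normc_nneg ?(ltW r0) // -rmorphM /=.
by rewrite sqr_sqrtr // ltW.
Qed.
End SquareRoot.

(** * Trace class operators *)

Section NuclearBound.
Context {R : realType}.
Implicit Types H : hilbertType R.

(** The synthesis map from [l^2(I)] to [H] has norm at most [a]. Orthonormal families are
    contractive, and unlike orthonormality this survives bounded operators up to a factor. *)
Definition contr H (I : finType) (u : I -> H) (a : R) : Prop :=
  0 <= a /\ forall c : I -> R[i],
    nrm (\sum_i c i *: u i) ^+ 2 <= a ^+ 2 * \sum_i normc (c i) ^+ 2.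

(* [nuc_le T s] says that the trace norm of [T] is at most [s], in the dual
   form that needs neither an absolute value nor a polar decomposition. *)
Definition nuc_le H1 H2 (T : H1 -> H2) (s : R) : Prop :=
  forall (I : finType) (u : I -> H1) (v : I -> H2), contr u 1 -> contr v 1 ->
  normc (\sum_i hdot (T (u i)) (v i)) <= s.

Definition rank1 H1 H2 (x : H2) (y : H1) (u : H1) : H2 := hdot u y *: x.

Lemma rank1_linear H1 H2 (x : H2) (y : H1) : linear (rank1 x y).
Proof. by case: (bounded_by_rank1 x y). Qed.

Lemma contr_scale H (I : finType) (u : I -> H) a b : 0 <= b ->
  contr u a -> contr (fun i => b%:C *: u i) (b * a).
Proof.
move=> b0 [a0 ua]; split=> [|c]; first by rewrite mulr_ge0.
rewrite (eq_bigr (fun i => b%:C *: (c i *: u i))); last first.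
  by move=> i _; rewrite !scalerA mulrC.
rewrite -scaler_sumr nrmZ normc_nneg // !exprMn -[leRHS]mulrA.
by apply: ler_wpM2l; rewrite ?sqr_ge0.
Qed.

Lemma contr_bounded H1 H2 (I : finType) (u : I -> H1) a (X : H1 -> H2) c :
  bounded_by X c -> contr u a -> contr (X \o u) (c * a).
Proof.
move=> [lX c0 Xc] [a0 ua]; split=> [|d]; first by rewrite mulr_ge0.
rewrite (eq_bigr (fun i => X (d i *: u i))); last first.
  by move=> i _; rewrite (linear_scale lX).
rewrite -(linear_sumE lX) exprMn -mulrA.
apply: le_trans (_ : (c * nrm (\sum_i d i *: u i)) ^+ 2 <= _).
  by rewrite ler_pXn2r ?nnegrE ?mulr_ge0 ?nrm_ge0.
by rewrite exprMn ler_wpM2l ?sqr_ge0.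
Qed.

Lemma contr0 H (I : finType) (u : I -> H) : contr u 0 -> forall i, u i = 0.
Proof.
move=> [_ u0] i; have := u0 (fun j => (j == i)%:R).
rewrite (bigD1 i) //= eqxx scale1r big1 ?addr0 => [|j /negPf->]; last first.
  by rewrite scale0r.
rewrite expr0n mul0r => h; apply/eqP; rewrite -nrm_eq0 -sqrf_eq0.
by rewrite eq_le h sqr_ge0.
Qed.

Lemma contr_orthonormal H (I : finType) (u : I -> H) :
  (forall i j, hdot (u i) (u j) = (i == j)%:R) -> contr u 1.
Proof.
move=> uE; split=> // c; rewrite expr1n mul1r -Re_hdot_nrm hdot_suml raddf_sum.
apply: ler_sum => i _; rewrite hdot_sumr (bigD1 i) //= big1 => [|j /negPf ji].
  by rewrite addr0 hdotZl hdotZr uE eqxx mulr1 mulc_conj.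
by rewrite hdotZl hdotZr uE eq_sym ji !mulr0.
Qed.

Lemma contr_basis H (s : seq H) : basis_seq s ->
  contr (fun i : 'I_(size s) => tnth (in_tuple s) i) 1.
Proof.
move=> [us sH]; apply: contr_orthonormal => i j.
rewrite hbasis_hdot; try by apply: sH; exact: mem_tnth.
by rewrite !(tnth_nth 0) /= nth_uniq.
Qed.

(** The analysis map is the adjoint of the synthesis map and has the same bound: pair [x] with [w],
    the synthesis of its own coefficients. *)
Lemma bessel_contr H (I : finType) (u : I -> H) x : contr u 1 ->
  \sum_i normc (hdot x (u i)) ^+ 2 <= nrm x ^+ 2.
Proof.
move=> [_ u1]; set S := \sum_i _; have S0 : 0 <= S.
  by apply: sumr_ge0 => i _; rewrite sqr_ge0.
pose w := \sum_i hdot x (u i) *: u i.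
have wS : nrm w ^+ 2 <= S.
  by have := u1 (fun i => hdot x (u i)); rewrite expr1n mul1r.
have xw : hdot x w = S%:C.
  rewrite hdot_sumr raddf_sum /=; apply: eq_bigr => i _.
  by rewrite hdotZr mulrC mulc_conj.
have := cauchy_schwarz x w; rewrite xw normc_nneg // => Sle.
have [->|SN0] := eqVneq S 0; first by rewrite sqr_ge0.
have Sp : 0 < S by rewrite lt_neqAle eq_sym SN0.
rewrite -(ler_pM2r Sp); apply: le_trans (_ : nrm x ^+ 2 * nrm w ^+ 2 <= _).
  by rewrite -exprMn -expr2 ler_pXn2r ?nnegrE ?mulr_ge0 ?nrm_ge0.
by rewrite ler_wpM2l ?sqr_ge0.
Qed.

Lemma nuc_le_ge0 H1 H2 (T : H1 -> H2) s : nuc_le T s -> 0 <= s.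
Proof.
move=> /(_ 'I_0 (fun=> 0) (fun=> 0)); rewrite big_ord0 ComplexField.Normc.normc0.
by apply; split=> // c; rewrite !big_ord0 mulr0 nrm0 expr0n.
Qed.

Lemma nuc_le_ext H1 H2 (T T' : H1 -> H2) s :
  T =1 T' -> nuc_le T s -> nuc_le T' s.
Proof. by move=> /funext ->. Qed.

Lemma nuc_le_trans H1 H2 (T : H1 -> H2) s t : s <= t -> nuc_le T s -> nuc_le T t.
Proof. by move=> st Ts I u v cu cv; apply: le_trans (Ts I u v cu cv) st. Qed.

Lemma nuc_le_sum H1 H2 (J : Type) (r : seq J) (P : pred J)
    (T : J -> H1 -> H2) (s : J -> R) :
  (forall j, P j -> nuc_le (T j) (s j)) ->
  nuc_le (fun x => \sum_(j <- r | P j) T j x) (\sum_(j <- r | P j) s j).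
Proof.
move=> Ts I u v cu cv.
rewrite (eq_bigr (fun i => \sum_(j <- r | P j) hdot (T j (u i)) (v i))).
  rewrite exchange_big /=; apply: le_trans (normc_sum _ _ _) _.
  by apply: ler_sum => j /Ts Tj; exact: Tj.
by move=> i _; rewrite hdot_suml.
Qed.

Lemma nuc_leD H1 H2 (T T' : H1 -> H2) s s' : nuc_le T s -> nuc_le T' s' ->
  nuc_le (fun x => T x + T' x) (s + s').
Proof.
move=> Ts Ts' I u v cu cv.
under eq_bigr do rewrite hdotDl; rewrite big_split /=.
by apply: le_trans (le_normcD _ _) (lerD (Ts _ _ _ cu cv) (Ts' _ _ _ cu cv)).
Qed.

Lemma nuc_le_scale H1 H2 (T : H1 -> H2) s a b (I : finType)
    (u : I -> H1) (v : I -> H2) : linear T -> nuc_le T s ->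
  contr u a -> contr v b -> normc (\sum_i hdot (T (u i)) (v i)) <= a * b * s.
Proof.
move=> lT Ts cu cv; have s0 := nuc_le_ge0 Ts.
have [a0|aN0] := eqVneq a 0.
  rewrite a0 in cu *; rewrite big1 ?ComplexField.Normc.normc0 ?mul0r // => i _.
  by rewrite (contr0 cu) (linear_zero lT) hdot0l.
have [b0|bN0] := eqVneq b 0.
  rewrite b0 in cv *.
  rewrite big1 ?ComplexField.Normc.normc0 ?mulr0 ?mul0r // => i _.
  by rewrite (contr0 cv) hdot0r.
have ap : 0 < a by rewrite lt_neqAle eq_sym aN0; case: cu.
have bp : 0 < b by rewrite lt_neqAle eq_sym bN0; case: cv.
have a'0 : 0 <= a^-1 by rewrite invr_ge0 ltW.
have b'0 : 0 <= b^-1 by rewrite invr_ge0 ltW.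
have cu' := contr_scale a'0 cu; have cv' := contr_scale b'0 cv.
rewrite mulVf // in cu'; rewrite mulVf // in cv'.
have := Ts _ _ _ cu' cv'.
rewrite (eq_bigr (fun i => (a^-1 * b^-1)%:C * hdot (T (u i)) (v i))).
  rewrite -mulr_sumr ComplexField.Normc.normcM normc_nneg ?mulr_ge0 //.
  by rewrite -invfM ler_pdivrMl ?mulr_gt0.
move=> i _; rewrite (linear_scale lT) hdotZl hdotZr conjc_real rmorphM mulrA.
by [].
Qed.

(** Ideal property in dual form: [Y] acts on the family [u], and the adjoint of [X] acts on the
    family [v]. *)
Lemma nuc_le_comp H1 H2 H3 H4 (T : H2 -> H3) s (X : H3 -> H4) c (Y : H1 -> H2) d :
  linear T -> nuc_le T s -> bounded_by X c -> bounded_by Y d ->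
  nuc_le (fun x => X (T (Y x))) (c * d * s).
Proof.
move=> lT Ts Xc Yd I u v cu cv.
under eq_bigr do rewrite (adjP Xc).
have cu' := contr_bounded Yd cu; have cv' := contr_bounded (adj_bounded_by Xc) cv.
by have := nuc_le_scale lT Ts cu' cv'; rewrite !mulr1 [d * c]mulrC.
Qed.

Lemma nuc_le_rank1 H1 H2 (x : H2) (y : H1) : nuc_le (rank1 x y) (nrm x * nrm y).
Proof.
move=> I u v cu cv.
have -> : \sum_i hdot (rank1 x y (u i)) (v i) =
    hdot x (\sum_i hdot y (u i) *: v i).
  rewrite hdot_sumr; apply: eq_bigr => i _.
  by rewrite hdotZl hdotZr -hdotC.
apply: le_trans (cauchy_schwarz _ _) _; rewrite ler_wpM2l ?nrm_ge0 //.
rewrite -(@ler_pXn2r _ 2) ?nnegrE ?nrm_ge0 //.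
by apply: le_trans (cv.2 _) _; rewrite expr1n mul1r bessel_contr.
Qed.

End NuclearBound.

Section TraceClass.
Context {R : realType}.
Implicit Types H : hilbertType R.

Lemma abs_opP H (T : H -> H) : bounded_op T ->
  [/\ bounded_op (abs_op T), positive_op (abs_op T) &
    forall x y, hdot (abs_op T (abs_op T x)) y = hdot (T x) (T y)].
Proof.
move=> /bounded_byP[c Tc]; rewrite /abs_op; case: xgetP => [P _ //|none].
have aTc := adj_bounded_by Tc.
have pTT : positive_op (adj T \o T).
  by move=> x; rewrite /= (adj_hdot Tc) hdot_nrm ler0c sqr_ge0.
have [Q [S [Qd [pQ QQ] _ _ _]]] := sqrt_bounded (bounded_by_comp aTc Tc) pTT.
case: (none Q); split=> //; first exact/bounded_byP.
by move=> x y; rewrite QQ /= (adj_hdot Tc).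
Qed.

(* Since [P (S n x)] tends to [Q x] and [|T z| = |P z|], the limit [W] of
   [T (S n x)] exists; it is the partial isometry of the polar decomposition
   composed with the square root [Q] of [|T|]. *)
Lemma polar_sqrt H (T : H -> H) : trace_class T ->
  exists W Q : H -> H, [/\ exists c, bounded_by W c,
    exists c, bounded_by Q c,
    (forall x y, hdot (Q x) y = hdot x (Q y)) /\
      (forall x, nrm (W x) = nrm (Q x)),
    (forall x, T x = W (Q x)) &
    forall s, basis_seq s -> \sum_(e <- s) nrm (Q e) ^+ 2 <= trace_norm T].
Proof.
move=> [bT trT]; have [bP pP PP] := abs_opP bT.
have /bounded_byP[c Tc] := bT; have /bounded_byP[d Pd] := bP.
have [lT c0 Tn] := Tc; have [lP d0 Pn] := Pd.
have [Q [S [[q Qq] [pQ QQ] Sb PS _]]] := sqrt_bounded Pd pP.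
have [lQ q0 Qn] := Qq; have symQ := positive_op_sym lQ pQ.
have TP x : nrm (T x) = nrm (abs_op T x).
  apply/eqP; rewrite -(@eqrXn2 _ 2) ?nrm_ge0 // -!Re_hdot_nrm -PP.
  by rewrite (positive_op_sym lP pP).
have lS n : linear (S n) by have [? []] := Sb n.
have lim_ex x : exists l : H, T (S n x) @[n --> \oo] --> l.
  apply: cvg_cauchy_nrm => e e0.
  have /cvg_nrmP PSx := PS x.
  have e20 : 0 < e / 2 by rewrite divr_gt0.
  have [N _ NP] := PSx _ e20.
  exists (T (S N x)); exists N => // n /= Nn.
  rewrite -(linear_sub lT) TP (linear_sub lP).
  have := nrmD (abs_op T (S N x) - Q x) (Q x - abs_op T (S n x)).
  rewrite addrA subrK => /le_trans; apply; rewrite [leRHS](splitr e).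
  by apply: lerD; [rewrite nrmBC|]; apply: NP => //=.
have [W WP] := choice lim_ex.
have lW : linear W.
  apply: (linear_limit (X := fun n x => T (S n x))) => // n a x y.
  by rewrite (lS n) lT.
have WQ x : nrm (W x) = nrm (Q x).
  apply: (@cvg_unique _ (@Rhausdorff R) (nrm (T (S n x)) @[n --> \oo])).
    by apply: cvg_nrm; exact: WP.
  rewrite (_ : (fun n => _) = (fun n => nrm (abs_op T (S n x)))).
    by apply: cvg_nrm; exact: PS.
  by apply/funext => n; rewrite TP.
exists W, Q; split=> //.
- by exists q; split=> // x; rewrite WQ.
- by exists q.
- move=> x; apply: (@cvg_unique _ (@norm_hausdorff _ _)
      (T (S n (Q x)) @[n --> \oo])); last exact: WP.
  apply/cvg_nrmP => e e0; have /cvg_nrmP /(_ e e0) := PS (Q x).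
  by apply: filterS => n; rewrite QQ -(linear_sub lP) -TP (linear_sub lT).
move=> s bs; rewrite (eq_bigr (fun e => complex.Re (hdot (abs_op T e) e))).
  apply: ((@basis_seq_esum _ H (fun e => complex.Re (hdot (abs_op T e) e)) _
    (trace_norm T)).1 _ s bs); first exact: positive_op_Re_ge0.
  rewrite /trace_norm fineK // ge0_fin_numE //; apply: esum_ge0 => e _.
  by rewrite lee_fin positive_op_Re_ge0.
by move=> e _; rewrite -QQ symQ Re_hdot_nrm.
Qed.

(** For [T = W Q], inserting a finite part of the identity between the factors gives rank one terms.
    As [|W e| = |Q e|], their weights are [|Q e|^2 = <|T| e, e>], whose sums are bounded by the
    trace norm. *)
Lemma expansion_rank1 H (W Q : H -> H) (s : seq H) x : linear W ->
  (forall x y, hdot (Q x) y = hdot x (Q y)) ->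
  W (hproj s (Q x)) = \sum_(e <- s) rank1 (W e) (Q e) x.
Proof.
move=> lW symQ; rewrite (linear_sumE lW); apply: eq_bigr => e _.
by rewrite (linear_scale lW) symQ.
Qed.

Lemma sum_tnth (V : nmodType) (T : Type) (s : seq T) (F : T -> V) :
  \sum_(e <- s) F e = \sum_(i < size s) F (tnth (in_tuple s) i).
Proof. by rewrite (big_tnth _ _ s). Qed.

Lemma perm_split (T : eqType) (r s : seq T) : uniq r -> uniq s ->
  {subset s <= r} -> perm_eq r (s ++ [seq x <- r | x \notin s]).
Proof.
move=> ur us sr; apply: uniq_perm => //.
  rewrite cat_uniq us filter_uniq // andbT -all_predC.
  by apply/allP => x; rewrite mem_filter => /andP[].
move=> x; rewrite mem_cat mem_filter; case xs : (x \in s) => //=.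
by rewrite sr.
Qed.

(** [s] nearly exhausts the supremum of the weights, so every finite set of further basis vectors
    has total weight below [d]. *)
Lemma trace_class_approx H (T : H -> H) d : trace_class T -> 0 < d ->
  exists n (x y : 'I_n -> H),
    \sum_i nrm (x i) * nrm (y i) <= trace_norm T /\
    nuc_le (fun u => T u - \sum_i rank1 (x i) (y i) u) d.
Proof.
move=> trT d0.
have [W [Q [[w Ww] [q Qq] [symQ WQ] TE tr]]] := polar_sqrt trT.
have [lW w0 Wn] := Ww; have [lQ _ _] := Qq.
pose S := [set \sum_(e <- s) nrm (Q e) ^+ 2 | s in @basis_seq R H].
have supS : has_sup S.
  split; last by exists (trace_norm T) => _ [s bs <-]; exact: tr.
  by exists (\sum_(e <- [::]) nrm (Q e) ^+ 2), [::].
have [_ [s bs <-] sd] := sup_adherent d0 supS.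
exists (size s), (fun i => W (tnth (in_tuple s) i)),
  (fun i => Q (tnth (in_tuple s) i)).
rewrite -(sum_tnth s (fun e => nrm (W e) * nrm (Q e))); split.
  by rewrite (eq_bigr _ (fun e _ => congr1 (fun a => a * _) (WQ e))) tr.
move=> I u v cu cv; apply/ler_addgt0Pl => e e0.
pose k := w * \sum_i nrm (v i) + 1.
have k0 : 0 < k.
  by rewrite ltr_wpDl // mulr_ge0 // sumr_ge0 // => i _; rewrite nrm_ge0.
have ek : 0 < e / k by rewrite divr_gt0.
(* The tail is infinite, but [nuc_le] tests only finitely many vectors at a time. Cutting off at a
   set [t] adapted to these vectors costs at most [e]. *)
have [t bt tP] := parseval_fam (fun i => Q (u i)) ek.
have br := basis_seqU bs bt; set r := undup (s ++ t) in br.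
have sr : {subset s <= r} by move=> f fs; rewrite mem_undup mem_cat fs.
have rP i : nrm (Q (u i) - hproj r (Q (u i))) <= e / k.
  by apply: tP => // f ft; rewrite mem_undup mem_cat ft orbT.
have perm := perm_split (undup_uniq _ : uniq r) bs.1 sr.
pose D x := \sum_(f <- [seq f <- r | f \notin s]) rank1 (W f) (Q f) x.
have TD x : T x - \sum_(i < size s) rank1 (W (tnth (in_tuple s) i))
    (Q (tnth (in_tuple s) i)) x = W (Q x - hproj r (Q x)) + D x.
  rewrite -(sum_tnth s (fun e => rank1 (W e) (Q e) x)) TE (linear_sub lW).
  rewrite (expansion_rank1 r x lW symQ) -addrA; congr (_ + _); rewrite /D.
  by rewrite (perm_big _ perm) big_cat /= opprD -addrA addNr addr0.
have Dd : nuc_le D d.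
  suff sum_le : \sum_(f <- [seq f <- r | f \notin s]) nrm (W f) * nrm (Q f) <= d.
    apply: (nuc_le_trans sum_le); apply: nuc_le_sum => f _.
    exact: nuc_le_rank1.
  rewrite (eq_bigr _ (fun e _ => congr1 (fun a => a * _) (WQ e))).
  have : \sum_(f <- r) nrm (Q f) ^+ 2 <= sup S.
    by apply: ub_le_sup; [case: supS|exists r].
  have -> : \sum_(f <- r) nrm (Q f) ^+ 2 = \sum_(f <- s) nrm (Q f) ^+ 2 +
      \sum_(f <- [seq f <- r | f \notin s]) nrm (Q f) * nrm (Q f).
    by rewrite (perm_big _ perm) big_cat.
  by move=> rS; move: sd; lra.
rewrite (eq_bigr (fun i => hdot (W (Q (u i) - hproj r (Q (u i)))) (v i) +
    hdot (D (u i)) (v i))); last by move=> i _; rewrite TD hdotDl.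
rewrite big_split /= addrC; apply: le_trans (le_normcD _ _) _.
rewrite [leRHS]addrC lerD //; first exact: Dd.
apply: le_trans (normc_sum _ _ _) _.
apply: le_trans (_ : \sum_i w * (e / k) * nrm (v i) <= _).
  apply: ler_sum => i _; apply: le_trans (cauchy_schwarz _ _) _.
  rewrite ler_wpM2r ?nrm_ge0 //; apply: le_trans (Wn _) _.
  by rewrite ler_wpM2l.
rewrite -mulr_sumr mulrAC mulrA ler_pdivrMr // mulrC.
by rewrite ler_wpM2l ?(ltW e0) // /k lerDl.
Qed.

Lemma trace_class_expansion H (T : H -> H) : finite_hdim H -> trace_class T ->
  exists n (x y : 'I_n -> H),
    \sum_i nrm (x i) * nrm (y i) <= trace_norm T /\
    forall u, T u = \sum_i rank1 (x i) (y i) u.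
Proof.
move=> finH trT; have [s bs sE] := finite_hbasis finH.
have [W [Q [[w [lW _ _]] _ [symQ WQ] TE tr]]] := polar_sqrt trT.
exists (size s), (fun i => W (tnth (in_tuple s) i)),
  (fun i => Q (tnth (in_tuple s) i)).
rewrite -(sum_tnth s (fun e => nrm (W e) * nrm (Q e))); split.
  by rewrite (eq_bigr _ (fun e _ => congr1 (fun a => a * _) (WQ e))) tr.
move=> u; rewrite -(sum_tnth s (fun e => rank1 (W e) (Q e) u)) TE.
by rewrite -{1}[Q u]sE (expansion_rank1 s u lW symQ).
Qed.

Lemma trace_class_nuc_le H (T : H -> H) :
  trace_class T -> nuc_le T (trace_norm T).
Proof.
move=> trT I u v cu cv; apply/ler_addgt0Pl => d d0; rewrite addrC.
have [n [x [y [xy Td]]]] := trace_class_approx trT d0.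
have Tn : nuc_le (fun u => \sum_i rank1 (x i) (y i) u) (trace_norm T).
  apply: nuc_le_trans xy _; apply: nuc_le_sum => i _; exact: nuc_le_rank1.
apply: (nuc_le_ext _ (nuc_leD Tn Td)) cu cv => z.
by rewrite addrC subrK.
Qed.

(* For a partial sum of the trace of [|T| = P], [<P e, e>] is the limit of
   [<T e, T (S n (S n e))>], and [T \o S n \o S n] is a contraction. *)
Lemma nuc_le_trace_class H (T : H -> H) s : bounded_op T -> nuc_le T s ->
  trace_class T /\ trace_norm T <= s.
Proof.
move=> bT Ts; have [bP pP PP] := abs_opP bT.
have /bounded_byP[c Tc] := bT; have /bounded_byP[d Pd] := bP.
have [lT _ _] := Tc; have [lP _ _] := Pd.
have [Q [S [[q [lQ _ _]] [pQ QQ] Sb PS Scontr]]] := sqrt_bounded Pd pP.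
have symP := positive_op_sym lP pP; have symQ := positive_op_sym lQ pQ.
have TP x : nrm (T x) = nrm (abs_op T x).
  by apply/eqP; rewrite -(@eqrXn2 _ 2) ?nrm_ge0 // -!Re_hdot_nrm -PP symP.
have lS n : linear (S n) by have [? []] := Sb n.
have tr_le : (ptrace (abs_op T) <= s%:E)%E.
  apply/(basis_seq_esum (f := fun e => complex.Re (hdot (abs_op T e) e))).
    exact: positive_op_Re_ge0.
  move=> t bt.
  pose a n := \sum_(e <- t) nrm (abs_op T (S n e)) ^+ 2.
  have a_le n : a n <= s.
    have cT : contr (fun i : 'I_(size t) => T (S n (S n (tnth (in_tuple t) i)))) 1.
      have [_ ct] := contr_basis bt; split=> // f; apply: le_trans (ct f).
      rewrite ler_pXn2r ?nnegrE ?nrm_ge0 //.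
      rewrite (eq_bigr (fun i => T (S n (S n (f i *: tnth (in_tuple t) i))))).
        rewrite -(linear_sumE lT) -!(linear_sumE (lS n)) TP.
        exact: (Scontr n _).1.
      by move=> i _; rewrite !(linear_scale (lS n)) (linear_scale lT).
    have := Ts _ _ _ (contr_basis bt) cT.
    rewrite -(sum_tnth t (fun e => hdot (T e) (T (S n (S n e))))).
    rewrite (eq_bigr (fun e => (nrm (abs_op T (S n e)) ^+ 2)%:C)).
      rewrite -raddf_sum normc_nneg //; apply: sumr_ge0 => e _; exact: sqr_ge0.
    by move=> e _; rewrite -PP symP (Scontr n e).2.
  rewrite (eq_bigr (fun e => nrm (Q e) ^+ 2)); last first.
    by move=> e _; rewrite -QQ symQ ?Re_hdot_nrm.
  suff a_cvg : a n @[n --> \oo] --> \sum_(e <- t) nrm (Q e) ^+ 2.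
    by apply: (cvgr_to_le a_cvg); apply: nearW.
  rewrite /a; elim: t {bt a_le} @a => [|e t IHt].
    rewrite big_nil (_ : (fun n => _) = fun=> 0); first exact: cvg_cst.
    by apply/funext => n; rewrite big_nil.
  rewrite big_cons (_ : (fun n => _) = (fun n => nrm (abs_op T (S n e)) ^+ 2 +
      \sum_(f <- t) nrm (abs_op T (S n f)) ^+ 2)).
    by apply: cvgD => //; apply: cvgM; exact: cvg_nrm.
  by apply/funext => n; rewrite big_cons.
have trT : trace_class T by split=> //; apply: le_lt_trans tr_le (ltry _).
split=> //; rewrite /trace_norm -lee_fin fineK // ge0_fin_numE ?trT.2 //.
apply: esum_ge0 => e _; by rewrite lee_fin positive_op_Re_ge0.
Qed.

End TraceClass.

(** * The trace *)

Section Trace.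
Context {R : realType}.
Implicit Types H : hilbertType R.

(** Convergence along this filter is unordered summation over the basis; [has_traceE] relates it to
    [trace]. *)
Definition basis_net H : set_system (seq H) :=
  filter_from (@basis_seq R H) (fun s => [set t | basis_seq t /\ {subset s <= t}]).

Arguments basis_net {H}.

Global Instance basis_net_filter H : ProperFilter (@basis_net H).
Proof.
apply: filter_from_proper; last by move=> s bs; exists s; split.
apply: filter_from_filter; first by exists [::].
move=> s t bs bt; exists (undup (s ++ t)); first exact: basis_seqU.
move=> r [br str]; split; split=> // e es; apply: str.
  by rewrite mem_undup mem_cat es.
by rewrite mem_undup mem_cat es orbT.
Qed.

Definition has_trace H (X : H -> H) (l : R[i]) : Prop :=
  (\sum_(e <- t) hdot (X e) e : R[i]^o) @[t --> basis_net] --> (l : R[i]^o).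

Lemma hproj_cvg H (x : H) : hproj t x @[t --> basis_net] --> x.
Proof.
apply/cvg_nrmP => e e0; have [s bs sP] := parseval x e0.
by exists s => // t [bt st]; exact: sP.
Qed.

Lemma has_traceE H (X : H -> H) l : has_trace X l -> trace X = l.
Proof.
move=> Xl; have FF := totally_filter (I := hbasis H).
rewrite /trace /summability.sum.
apply: (@cvg_lim (R[i]^o : normedModType R[i]) (@norm_hausdorff _ _) _ _ FF).
apply/cvg_normcP => e e0.
have /cvg_normcP /(_ e e0) [s bs sP] := Xl.
have [A AP] : exists A : seq (hbasis H), forall f : hbasis H,
    val f \in s -> f \in A.
  elim: s bs {sP} => [|f s IHs] [us sH]; first by exists [::].
  have [|A AP] := IHs.
    by split; [case/andP: us|move=> g gs; apply: sH; rewrite inE gs orbT].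
  exists ((SigSub (mem_set (sH f (mem_head _ _))) : hbasis H) :: A) => g.
  rewrite inE => /orP[/eqP gf|/AP gA]; rewrite inE ?gA ?orbT //.
  by apply/orP; left; apply/eqP/val_inj.
exists (finmap.seq_fset tt A) => // B /= AB.
rewrite /partial_sum -(@finmap.big_seq_fsetE _ _ _ _ B xpredT
  (fun e : hbasis H => hdot (X (val e)) (val e) : R[i]^o)) /=.
rewrite -(big_map (fun e : hbasis H => val e) xpredT (fun e => hdot (X e) e)).
apply: sP; split; last first.
  move=> f fs; have Hf := bs.2 f fs.
  apply/mapP; exists (SigSub (mem_set Hf) : hbasis H) => //.
  apply: (finmap.fsubsetP AB (SigSub (mem_set Hf))).
  by rewrite (finmap.seq_fsetE tt); exact: AP.
split; last by move=> _ /mapP[f _ ->]; exact: set_valP.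
by rewrite map_inj_uniq ?finmap.fset_uniq //; exact: val_inj.
Qed.

Lemma has_trace_sum H (I : Type) (r : seq I) (X : I -> H -> H) (l : I -> R[i]) :
  (forall i, has_trace (X i) (l i)) ->
  has_trace (fun x => \sum_(i <- r) X i x) (\sum_(i <- r) l i).
Proof.
move=> Xl; rewrite /has_trace; elim: r => [|i r IHr].
  rewrite big_nil (_ : (fun t => _) = fun=> 0); first exact: cvg_cst.
  by apply/funext => t; rewrite big1 // => e _; rewrite big_nil hdot0l.
rewrite big_cons (_ : (fun t => _) = fun t =>
    (\sum_(e <- t) hdot (X i e) e : R[i]^o) +
    \sum_(e <- t) hdot (\sum_(j <- r) X j e) e).
  exact: (cvgD (Xl i) IHr).
apply/funext => t; rewrite -big_split /=; apply: eq_bigr => e _.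
by rewrite big_cons hdotDl.
Qed.

(** The partial sum over [t] is [<X (hproj t x), y>], and [hproj t x] tends to [x]. *)
Lemma has_trace_rank1 H (X : H -> H) c (x y : H) : bounded_by X c ->
  has_trace (rank1 x y \o X) (hdot (X x) y).
Proof.
move=> Xc; have [lX _ _] := Xc; rewrite /has_trace.
rewrite (_ : (fun t => _) = fun t => hdot (X (hproj t x)) y : R[i]^o).
  apply: cvg_hdot; last exact: cvg_cst.
  by apply: (bounded_by_cvg Xc); exact: hproj_cvg.
apply/funext => t; rewrite (linear_sumE lX) hdot_suml; apply: eq_bigr => e _.
by rewrite (linear_scale lX) /rank1 /= !hdotZl mulrC.
Qed.

Section NuclearTrace.
Variables (H : hilbertType R) (B X : H -> H) (c : R).
Hypotheses (lB : linear B) (Xc : bounded_by X c).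

Lemma nuc_le_sum_basis (D : H -> H) d t : linear D -> nuc_le D d -> basis_seq t ->
  normc (\sum_(e <- t) hdot (D (X e)) e) <= c * d.
Proof.
move=> lD Dd bt; rewrite (sum_tnth t (fun e => hdot (D (X e)) e)).
have ct := contr_basis bt; have cXt := contr_bounded Xc ct.
by have := nuc_le_scale lD Dd cXt ct; rewrite !mulr1.
Qed.

(** The remainder contributes at most [c * d] to every partial sum, uniformly in [t]. Both existence
    of the trace and its approximation follow from this uniformity. *)
Lemma near_trace_approx n (x y : 'I_n -> H) d e :
  nuc_le (fun u => B u - \sum_i rank1 (x i) (y i) u) d -> 0 < e ->
  \forall t \near basis_net,
    normc (\sum_i hdot (X (x i)) (y i) - \sum_(f <- t) hdot (B (X f)) f)
      <= c * d + e.
Proof.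
set D := (fun u => _) => Dd e0.
have lD : linear D.
  move=> a u v; rewrite /D lB scalerBr scaler_sumr addrACA -opprD -big_split /=.
  congr (_ - _); apply: eq_bigr => i _; exact: rank1_linear.
have := has_trace_sum (r := index_enum 'I_n) (fun i =>
  @has_trace_rank1 _ X c (x i) (y i) Xc).
move=> /cvg_normcP /(_ e e0) [s bs sP]; exists s => // t [bt st].
have := sP t (conj bt st).
rewrite (_ : \sum_(f <- t) hdot (B (X f)) f = \sum_(f <- t)
    hdot (\sum_i (rank1 (x i) (y i) \o X) f) f + \sum_(f <- t) hdot (D (X f)) f).
  move=> le; rewrite opprD addrA; apply: le_trans (le_normcD _ _) _.
  rewrite [leRHS]addrC; apply: lerD => //; rewrite normcN.
  exact: nuc_le_sum_basis.
rewrite -big_split /=; apply: eq_bigr => f _.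
by rewrite -hdotDl /D addrC subrK.
Qed.

Lemma nuc_approx_has_trace :
  (forall d, 0 < d -> exists n (x y : 'I_n -> H),
     nuc_le (fun u => B u - \sum_i rank1 (x i) (y i) u) d) ->
  exists l, has_trace (B \o X) l.
Proof.
move=> Bapprox; apply: cvg_cauchy_normc => e e0.
have c0 : 0 <= c by case: Xc.
have d0 : 0 < e / 2 / (c + 1) by rewrite !divr_gt0 // ltr_wpDl.
have [n [x [y Dd]]] := Bapprox _ d0.
have e20 : 0 < e / 2 by rewrite divr_gt0.
exists (\sum_i hdot (X (x i)) (y i)).
apply: filterS (near_trace_approx Dd e20) => t le; apply: le_trans le _.
rewrite [leRHS](splitr e) lerD2r mulrCA ger_pMr //.
by rewrite ler_pdivrMr ?mul1r ?lerDl // ltr_wpDl.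
Qed.

Lemma has_trace_approx n (x y : 'I_n -> H) d l :
  nuc_le (fun u => B u - \sum_i rank1 (x i) (y i) u) d ->
  has_trace (B \o X) l ->
  normc (l - \sum_i hdot (X (x i)) (y i)) <= c * d.
Proof.
move=> Dd /cvg_normcP Bl; apply/ler_addgt0Pr => e e0.
have e20 : 0 < e / 2 by rewrite divr_gt0.
have [t [le1 le2]] := @filter_ex _ _ (basis_net_filter H) _
  (@filterI _ _ (basis_net_filter H) _ _ (Bl _ e20) (near_trace_approx Dd e20)).
rewrite -[l](subrK (\sum_(f <- t) hdot (B (X f)) f)) -addrA.
apply: le_trans (le_normcD _ _) _.
rewrite -[normc (_ - \sum_i _)]normcN opprB.
by have := lerD le1 le2; rewrite addrCA -splitr.
Qed.

End NuclearTrace.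

End Trace.

(** * Compact operators *)

Section CompactOperators.
Context {R : realType}.
Implicit Types H : hilbertType R.

Lemma compact_op_bounded H (X : H -> H) : compact_op X -> bounded_op X.
Proof.
move=> [lX cX]; apply/bounded_byP.
have cont_nrm : continuous (@nrm R H) by move=> x; apply: cvg_nrm; exact: cvg_id.
have := continuous_compact (continuous_subspaceT cont_nrm) cX.
move=> /compact_bounded [M [_ MP]].
pose m := `|M| + 1; have Mm : M < m by rewrite ltr_pwDr // ler_norm.
have m0 : 0 <= m by rewrite addr_ge0.
exists m; split=> // x; have [->|x0] := eqVneq x 0.
  by rewrite (linear_zero lX) !nrm0 mulr0.
have nx0 : 0 < nrm x by rewrite lt_neqAle eq_sym nrm_eq0 x0 nrm_ge0.
have : nrm (X ((nrm x)^-1%:C *: x)) <= m.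
  apply: le_trans (ler_norm _) _; apply: (MP m Mm) => /=.
  exists (X ((nrm x)^-1%:C *: x)) => //; apply: subset_closure.
  exists ((nrm x)^-1%:C *: x) => //=.
  by rewrite nrmE nrmZ normc_nneg ?invr_ge0 ?nrm_ge0 // mulVf ?gt_eqF.
rewrite (linear_scale lX) nrmZ normc_nneg ?invr_ge0 ?nrm_ge0 //.
by rewrite ler_pdivrMl // mulrC.
Qed.

Lemma compact_plus_scalar_bounded H (X : H -> H) :
  compact_plus_scalar X -> bounded_op X.
Proof.
move=> [Y [a [cY ->]]]; have := compact_op_bounded cY.
move=> /bounded_byP[c [lY c0 Yc]]; apply/bounded_byP; exists (c + normc a).
have E u : (Y + a *: (idfun : H -> H)) u = Y u + a *: u by [].
split=> [b x y||x]; rewrite ?E ?addr_ge0 ?normc_ge0 //.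
- by rewrite lY !scalerDr addrACA !scalerA [a * b]mulrC.
- by apply: le_trans (nrmD _ _) _; rewrite mulrDl lerD // nrmZ.
Qed.

(** The combinations of the listed vectors with real and imaginary parts of each coefficient in
    [[- m, m]]. The two parts are separate parameters so that a box is a continuous image of a
    product of real segments. *)
Fixpoint box H (s : seq (H * R)) : set H :=
  if s is (x, m) :: s' then
    [set p.1.1%:C *: x + (p.1.2%:C *: ('i *: x) + p.2) |
      p in `[- m, m] `*` `[- m, m] `*` box s']
  else [set 0].

Lemma real_scale_continuous H (x : H) : continuous (fun a : R => a%:C *: x).
Proof.
move=> a; apply/cvg_nrmP => e e0; apply/nbhs_normP.
exists (e / (nrm x + 1)) => [|b /= ab].
  by rewrite /= divr_gt0 // ltr_wpDl ?nrm_ge0.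
have nx1 : 0 < nrm x + 1 by rewrite ltr_wpDl ?nrm_ge0.
rewrite -scalerBl -rmorphB nrmZ normc_real.
apply: le_trans (_ : `|a - b| * (nrm x + 1) <= _).
  by rewrite ler_wpM2l // lerDl.
by rewrite -ler_pdivlMr // ltW.
Qed.

Lemma box_compact H (s : seq (H * R)) : compact (box s).
Proof.
elim: s => [|[x m] s IHs] /=; first exact: compact_set1.
apply: continuous_compact; last first.
  apply: compact_setX => //; apply: compact_setX; exact: segment_compact.
apply: continuous_subspaceT => p.
apply: cvgD; last apply: cvgD.
- apply: (cvg_comp (fun p : R * R * H => p.1.1) (fun a : R => a%:C *: x)).
    apply: (cvg_comp (@fst (R * R)%type H) (@fst R R)); exact: cvg_fst.
  exact: real_scale_continuous.
- apply: (cvg_comp (fun p : R * R * H => p.1.2) (fun a : R => a%:C *: _)).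
    by apply: (cvg_comp (@fst (R * R)%type H) (@snd R R));
      [exact: cvg_fst|exact: cvg_snd].
  exact: real_scale_continuous.
- exact: cvg_snd.
Qed.

Lemma box_in H (I : Type) (s : seq I) (x : I -> H) (c : I -> R[i]) (m : I -> R) :
  (forall i, normc (c i) <= m i) ->
  box [seq (x i, m i) | i <- s] (\sum_(i <- s) c i *: x i).
Proof.
move=> cm; elim: s => [|i s IHs]; first by rewrite big_nil.
rewrite big_cons; exists (complex.Re (c i), complex.Im (c i),
  \sum_(j <- s) c j *: x j).
  have := cm i; case: (c i) => a b /= le.
  have h (d : R) : d ^+ 2 <= a ^+ 2 + b ^+ 2 -> d \in `[- m i, m i].
    move=> dle; rewrite itv_boundlr /= !bnd_simp -ler_norml.
    by apply: le_trans le; rewrite -sqrtr_sqr ler_sqrt ?addr_ge0 ?sqr_ge0.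
  by split=> //; split; apply: h; rewrite ?lerDl ?lerDr sqr_ge0.
rewrite /= addrA scalerA -scalerDl; congr (_ *: _ + _).
by rewrite [RHS]complexE mulrC.
Qed.

(** The coefficients of the image of a unit ball vector are bounded by the norms of the [y i], so
    the image lies in a compact box. *)
Lemma finite_rank_compact H (I : finType) (x y : I -> H) :
  compact_op (fun u => \sum_i rank1 (x i) (y i) u).
Proof.
split.
  move=> a u v; rewrite scaler_sumr -big_split /=; apply: eq_bigr => i _.
  exact: rank1_linear.
pose C := box [seq (x i, nrm (y i)) | i <- index_enum I].
apply: (@subclosed_compact _ _ C); first exact: closed_closure.
  exact: box_compact.
have closedC : closed C.
  by apply: compact_closed; [exact: norm_hausdorff|exact: box_compact].
rewrite (_ : C = closure C); last exact/closure_id.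
apply: closure_subset => _ [u /= u1 <-]; apply: box_in => i.
apply: le_trans (cauchy_schwarz _ _) _; rewrite -[leRHS]mul1r.
by rewrite ler_wpM2r ?nrm_ge0 // -lecR -nrmE.
Qed.

End CompactOperators.

(** * Separation from a convex hull *)

Section Separation.
Context {R : realType} {S : finType}.
Implicit Types (D : set (S -> R)) (x y z : S -> R).

(** The cone over [D] with the total weight recorded; this weight later becomes the bound on a
    tensor representation. *)
Inductive hull D : R -> (S -> R) -> Prop :=
| hull_nil : hull D 0 (fun=> 0)
| hull_cons c d m y : 0 <= c -> D d -> hull D m y ->
    hull D (c + m) (fun s => c * d s + y s).

Lemma hull_scale D m y t : 0 <= t -> hull D m y ->
  hull D (t * m) (fun s => t * y s).
Proof.
move=> t0; elim=> [|c d m' y' c0 Dd _ IH].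
  by rewrite mulr0; exact: hull_nil.
rewrite mulrDr (_ : (fun s => _) = fun s => (t * c) * d s + t * y' s).
  by apply: hull_cons => //; exact: mulr_ge0.
by apply/funext => s; rewrite mulrDr mulrA.
Qed.

Lemma hull_add D m y m' y' : hull D m y -> hull D m' y' ->
  hull D (m + m') (fun s => y s + y' s).
Proof.
move=> + h'; elim=> [|c d m0 y0 c0 Dd _ IH].
  rewrite add0r (_ : (fun s => _) = y') //.
  by apply/funext => s; rewrite add0r.
rewrite -addrA (_ : (fun s => _) = fun s => c * d s + (y0 s + y' s)).
  exact: hull_cons.
by apply/funext => s; rewrite addrA.
Qed.

Lemma hull_single D d c : 0 <= c -> D d -> hull D c (fun s => c * d s).
Proof.
move=> c0 Dd; have := hull_cons c0 Dd (hull_nil D).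
rewrite addr0 (_ : (fun s => _) = fun s => c * d s) //.
by apply/funext => s; rewrite addr0.
Qed.

Lemma hull_bound D m y : (forall d, D d -> forall s, `|d s| <= 1) ->
  hull D m y -> forall s, `|y s| <= m.
Proof.
move=> D1; elim=> [|c d m' y' c0 Dd _ IH] s; first by rewrite normr0.
apply: le_trans (ler_normD _ _) _; rewrite lerD // normrM (ger0_norm c0).
by rewrite ler_piMr // D1.
Qed.

(* The hyperplane is the one orthogonal to [z - y] for an almost nearest point
   [y] of the hull; this avoids taking closures. *)
Lemma hull_separation D z e d : 0 <= e -> 0 < d ->
  (forall x, D x -> forall s, `|x s| <= 1) ->
  (forall (phi : S -> R) nu, 0 < nu ->
    (forall x, D x -> \sum_s phi s * x s <= nu) ->
    \sum_s phi s * z s <= e * nu) ->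
  exists m y, [/\ hull D m y, m <= e + d & forall s, `|z s - y s| <= d].
Proof.
move=> e0 d0 D1 zD; pose E := e + d; have E0 : 0 < E by rewrite ltr_wpDl.
pose C := [set y | exists2 m, hull D m y & m <= E].
pose q y := \sum_s (z s - y s) ^+ 2.
have q0 y : 0 <= q y by apply: sumr_ge0 => s _; exact: sqr_ge0.
have C0 : C (fun=> 0) by exists 0; [exact: hull_nil|exact: ltW].
have CB y s : C y -> `|y s| <= E.
  by move=> [m hy mE]; apply: le_trans (hull_bound D1 hy s) mE.
have infq : has_inf (q @` C).
  split; first by exists (q (fun=> 0)), (fun=> 0).
  by exists 0 => _ [y _ <-].
pose mu := inf (q @` C).
have mu_le y : C y -> mu <= q y.
  by move=> Cy; apply: ge_inf; [case: infq|exists y].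
have [mu_d|d_mu] := ltP mu (d ^+ 2).
  have gap : 0 < d ^+ 2 - mu by rewrite subr_gt0.
  have [_ [y [m hy mE] <-]] := inf_adherent gap infq.
  rewrite addrC subrK => qd; exists m, y; split=> // s.
  rewrite -(@ler_pXn2r _ 2) ?nnegrE ?(ltW d0) // real_normK ?num_real //.
  apply: le_trans (ltW qd); rewrite /q (bigD1 s) //= lerDl.
  by apply: sumr_ge0 => s' _; exact: sqr_ge0.
exfalso; have mu0 : 0 < mu by apply: lt_le_trans d_mu; rewrite exprn_gt0.
pose L := \sum_(s : S) (2 * E) ^+ 2.
have L0 : 0 <= L by apply: sumr_ge0 => s _; exact: sqr_ge0.
(* The step length towards a competitor, short enough for the quadratic term of [q], at most
   [t ^+ 2 * L], to stay below [t * mu / 2]. *)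
pose t := Num.min 1 (mu / (2 * (L + 1))).
have L1 : 0 < L + 1 by rewrite ltr_wpDl.
have t0 : 0 < t by rewrite lt_min ltr01 divr_gt0 // mulr_gt0.
have t1 : t <= 1 by rewrite ge_min lexx.
have tL : t * L <= mu / 2.
  apply: le_trans (_ : t * (L + 1) <= _).
    by apply: ler_wpM2l; [exact: ltW|rewrite lerDl].
  rewrite -ler_pdivlMr // (_ : mu / 2 / (L + 1) = mu / (2 * (L + 1))).
    by rewrite ge_min lexx orbT.
  by field; rewrite gt_eqF.
have k0 : 0 < t * mu / 2 by rewrite divr_gt0 // mulr_gt0.
have [_ [y Cy <-] qy] := inf_adherent k0 infq; rewrite -/mu in qy.
pose phi s := z s - y s.
(* Moving from [y] towards [p] by [t] stays in the convex set [C], so [q] cannot fall below [mu]. As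
   [q y] exceeds [mu] by less than [t * mu / 2], the first order term is controlled. *)
have sep p : C p -> \sum_s phi s * p s <= \sum_s phi s * z s - mu / 2.
  move=> Cp; pose w s := (1 - t) * y s + t * p s.
  have Cw : C w.
    have [m hy mE] := Cy; have [m' hp m'E] := Cp.
    have t1' : 0 <= 1 - t by rewrite subr_ge0.
    exists ((1 - t) * m + t * m').
      by apply: hull_add; apply: hull_scale => //; exact: ltW.
    have -> : E = (1 - t) * E + t * E by ring.
    by rewrite lerD //; apply: ler_wpM2l => //; exact: ltW.
  have := mu_le w Cw.
  pose a := \sum_s phi s * (p s - y s); pose b := \sum_s (p s - y s) ^+ 2.
  have -> : q w = q y - 2 * t * a + t ^+ 2 * b.
    rewrite /q /a /b !mulr_sumr -sumrB -big_split /=.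
    by apply: eq_bigr => s _; rewrite /w /phi; ring.
  have bL : b <= L.
    apply: ler_sum => s _; rewrite -real_normK ?num_real //.
    rewrite ler_pXn2r ?nnegrE ?mulr_ge0 ?(ltW E0) //.
    apply: le_trans (ler_normB _ _) _; rewrite mulr_natl mulr2n.
    by apply: lerD; exact: CB.
  have -> : \sum_s phi s * p s = a + \sum_s phi s * z s - q y.
    rewrite /a /q -big_split -sumrB /=; apply: eq_bigr => s _.
    by rewrite /phi; ring.
  have qmu : mu <= q y by exact: mu_le.
  move=> h; suff : a <= mu / 2 by move=> ?; lra.
  have : 2 * t * a <= t * mu.
    have : t ^+ 2 * b <= t * (mu / 2).
      rewrite expr2 -mulrA; apply: ler_wpM2l; first exact: ltW.
      by apply: le_trans tL; apply: ler_wpM2l => //; exact: ltW.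
    by move=> ?; lra.
  rewrite -mulrA mulrCA ler_pM2l //; lra.
pose w := \sum_s phi s * z s.
have w_mu : mu / 2 <= w.
  have := sep _ C0; rewrite big1 ?subr_ge0 // => s _; exact: mulr0.
(* By [sep] at [E * x], the functional is at most [(w - mu / 2) / E] on [D]. Taking [mu / 4] leaves
   [nu] positive, since [w >= mu / 2], while [e * nu <= w - mu / 4] contradicts the hypothesis. *)
have nu0 : 0 < (w - mu / 4) / E by rewrite divr_gt0 //; lra.
have := zD phi _ nu0; rewrite -/w.
have step : e * ((w - mu / 4) / E) <= w - mu / 4.
  rewrite mulrCA ger_pMr; last by lra.
  by rewrite ler_pdivrMr // mul1r lerDl ltW.
move=> h; suff : w <= e * ((w - mu / 4) / E) by lra.
apply: h => x Dx.
rewrite ler_pdivlMr // mulrC mulr_sumr.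
rewrite (eq_bigr (fun s => phi s * (E * x s))); last by move=> s _; rewrite mulrCA.
have : C (fun s => E * x s).
  by exists E => //; apply: hull_single => //; exact: ltW.
by move=> /sep; rewrite -/w; lra.
Qed.

End Separation.

(** * Slices of the tensor product *)

Section TensorSlices.
Context {R : realType} {N : nat} {H : 'I_N -> hilbertType R}.
Variables (K : hilbert_tensor H) (m : 'I_N).
Implicit Types (x y z xi eta : forall k, H k).

Definition weight y z : R[i] := \prod_(k | k != m) hdot (y k) (z k).

Definition pnrm y : R := \prod_(k | k != m) nrm (y k).

Lemma pnrm_ge0 y : 0 <= pnrm y.
Proof. by apply: prodr_ge0 => k _; exact: nrm_ge0. Qed.

Lemma dfwith_same y : dfwith y m (y m) = y.
Proof. by apply: functional_extensionality_dep => k; case: dfwithP. Qed.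

Lemma hdot_tensor_weight y z h g :
  hdot (tensor (dfwith y m h) : K) (tensor (dfwith z m g)) =
  weight y z * hdot h g.
Proof.
rewrite tensor_hdot (bigD1 m) //= !dfwithin mulrC; congr (_ * _).
by apply: eq_bigr => k km; rewrite !dfwithout // eq_sym.
Qed.

(* Only the values of [y] outside [m] matter. *)
Definition slice y (h : H m) : K := tensor (dfwith y m h).

Lemma slice_hdot y z h g : hdot (slice y h) (slice z g) = weight y z * hdot h g.
Proof. exact: hdot_tensor_weight. Qed.

Lemma slice_tensor xi : slice xi (xi m) = tensor xi.
Proof. by rewrite /slice dfwith_same. Qed.

Lemma slice_hdot_tensor y h eta :
  hdot (slice y h) (tensor eta) = weight y eta * hdot h (eta m).
Proof. by rewrite -slice_tensor slice_hdot. Qed.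

Lemma weight_nrm y : weight y y = (pnrm y ^+ 2)%:C.
Proof.
rewrite /weight /pnrm -prodrXl rmorph_prod /=.
by apply: eq_bigr => k _; rewrite hdot_nrm.
Qed.

Lemma slice_nrm y h : nrm (slice y h) = pnrm y * nrm h.
Proof.
apply/eqP; rewrite -(@eqrXn2 _ 2) ?mulr_ge0 ?pnrm_ge0 ?nrm_ge0 //.
by rewrite -Re_hdot_nrm slice_hdot weight_nrm hdot_nrm -rmorphM exprMn.
Qed.

Lemma tensor_nrm xi : nrm (tensor xi : K) = \prod_k nrm (xi k).
Proof. by rewrite -slice_tensor slice_nrm [RHS](bigD1 m) //= mulrC. Qed.

Lemma slice_bounded y : bounded_by (slice y) (pnrm y).
Proof.
split; first by move=> a h g; exact: tensor_multilinear.
  exact: pnrm_ge0.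
by move=> h; rewrite slice_nrm.
Qed.

Definition coslice y : K -> H m := adj (slice y).

Lemma coslice_bounded y : bounded_by (coslice y) (pnrm y).
Proof. exact: adj_bounded_by (slice_bounded y). Qed.

Lemma coslice_tensor y xi : coslice y (tensor xi) = weight xi y *: xi m.
Proof.
apply: hdot_inj => h; rewrite (adj_hdot (slice_bounded y)) -slice_tensor.
by rewrite slice_hdot hdotZl.
Qed.

Lemma tensor_total_eq0 (u : K) : (forall xi, hdot u (tensor xi) = 0) -> u = 0.
Proof.
move=> u0; apply/eqP; rewrite -nrm_eq0 eq_le nrm_ge0 andbT.
apply/ler_addgt0Pl => e e0; rewrite addr0.
have Be : ball u e%:C !=set0 by exists u; apply: ballxx; rewrite ltr0c.
have [v [ub [n [c [xi vE]]]]] := tensor_total (h := K) Be (ball_open u _).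
have uv : hdot u v = 0.
  by rewrite vE hdot_sumr big1 // => i _; rewrite hdotZr u0 mulr0.
have {}ub : nrm (u - v) <= e.
  by move: ub; rewrite -ball_normE /= nrmE ltcR => /ltW.
have [->|nu0] := eqVneq (nrm u) 0; first exact: ltW.
have nu : 0 < nrm u by rewrite lt_neqAle eq_sym nu0 nrm_ge0.
rewrite -(ler_pM2l nu) -expr2 -Re_hdot_nrm.
have -> : hdot u u = hdot u (u - v) by rewrite hdotBr uv subr0.
apply: le_trans (Re_le_normc _) _; apply: le_trans (cauchy_schwarz _ _) _.
by rewrite ler_wpM2l ?nrm_ge0.
Qed.

Lemma tensor_vec_ext (u v : K) :
  (forall eta, hdot u (tensor eta) = hdot v (tensor eta)) -> u = v.
Proof.
move=> uv; apply/eqP; rewrite -subr_eq0; apply/eqP; apply: tensor_total_eq0.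
by move=> eta; rewrite hdotBl uv subrr.
Qed.

Lemma tensor_op_ext (X Y : K -> K) c d : bounded_by X c -> bounded_by Y d ->
  (forall xi, X (tensor xi) = Y (tensor xi)) -> X = Y.
Proof.
move=> Xc Yd XY; apply/funext => u; apply: hdot_inj => v.
rewrite (adjP Xc) (adjP Yd); congr (hdot u _); apply: tensor_vec_ext => eta.
by rewrite (adj_hdot Xc) (adj_hdot Yd) XY.
Qed.

Lemma tensor_opE (T : forall k, H k -> H k) (X : K -> K) c : bounded_by X c ->
  (forall xi, X (tensor xi) = tensor (fun k => T k (xi k))) ->
  tensor_op T = X.
Proof.
move=> Xc XT; rewrite /tensor_op; case: xgetP => [Y _ [bY YT]|none].
  have /bounded_byP[d Yd] := bY; apply: tensor_op_ext Yd Xc _ => xi.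
  by rewrite YT XT.
by case: (none X); split=> //; apply/bounded_byP; exists c.
Qed.

(* The multi-indices only run over the factors other than [m]; at [m] they are
   frozen to [ord0]. *)
Definition multi_index (n : nat) : pred {ffun 'I_N -> 'I_n.+1} :=
  [pred f | f \in pffun_on ord0 (predC1 m) predT].

Definition mix (n : nat) (x : forall k, 'I_n.+1 -> H k)
    (f : {ffun 'I_N -> 'I_n.+1}) : forall k, H k := fun k => x k (f k).

Lemma prod_sum_multi_index (A : comNzRingType) (n : nat)
    (F : 'I_N -> 'I_n.+1 -> A) :
  \prod_(k | k != m) \sum_i F k i =
  \sum_(f | multi_index f) \prod_(k | k != m) F k (f k).
Proof. exact: (big_distr_big ord0). Qed.

(** Against a decomposable [eta] both sides factor over the indices; distributing the product of the
    rank one sums gives the sum over multi-indices. *)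
Lemma slice_expansion (n : nat) (x y : forall k, 'I_n.+1 -> H k)
    (T : forall k, H k -> H k) xi : linear (T m) ->
  (forall k, k != m -> forall u, T k u = \sum_i rank1 (x k i) (y k i) u) ->
  \sum_(f | multi_index f) slice (mix x f) (T m (coslice (mix y f) (tensor xi)))
    = tensor (fun k => T k (xi k)).
Proof.
move=> lT TE; apply: tensor_vec_ext => eta; rewrite hdot_suml.
rewrite (eq_bigr (fun f : {ffun 'I_N -> 'I_n.+1} => (\prod_(k | k != m)
    (hdot (xi k) (y k (f k)) * hdot (x k (f k)) (eta k))) *
    hdot (T m (xi m)) (eta m))); last first.
  move=> f _; rewrite coslice_tensor slice_hdot_tensor (linear_scale lT) hdotZl.
  by rewrite mulrCA mulrA -big_split.
rewrite -mulr_suml -(prod_sum_multi_index (fun k i =>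
  hdot (xi k) (y k i) * hdot (x k i) (eta k))).
rewrite tensor_hdot [RHS](bigD1 m) //= mulrC; congr (_ * _).
apply: eq_bigr => k km; rewrite TE // hdot_suml.
by apply: eq_bigr => i _; rewrite hdotZl.
Qed.

Lemma slice_op_bounded (x y : forall k, H k) (T : H m -> H m) c : bounded_by T c ->
  bounded_by (fun u => slice x (T (coslice y u))) (pnrm x * (c * pnrm y)).
Proof.
move=> Tc; have := bounded_by_comp (slice_bounded x)
  (bounded_by_comp Tc (coslice_bounded y)).
by [].
Qed.

Lemma tensor_op_slices (n : nat) (x y : forall k, 'I_n.+1 -> H k)
    (T : forall k, H k -> H k) c : bounded_by (T m) c ->
  (forall k, k != m -> forall u, T k u = \sum_i rank1 (x k i) (y k i) u) ->
  tensor_op T = (fun u => \sum_(f | multi_index f)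
    slice (mix x f) (T m (coslice (mix y f) u)) : K).
Proof.
move=> Tc TE; have lT : linear (T m) by case: Tc.
apply: tensor_opE; last by move=> xi; exact: slice_expansion.
by apply: bounded_by_sum => f _; exact: (slice_op_bounded _ _ Tc).
Qed.

Lemma tensor_op_slice (x y : forall k, H k) (T : H m -> H m) c :
  bounded_by T c ->
  tensor_op (dfwith (fun k => rank1 (x k) (y k)) m T) =
  (fun u => slice x (T (coslice y u)) : K).
Proof.
move=> Tc; apply: tensor_opE (slice_op_bounded x y Tc) _ => xi.
have [lT _ _] := Tc.
apply: tensor_vec_ext => eta; rewrite coslice_tensor slice_hdot_tensor.
rewrite (linear_scale lT) hdotZl tensor_hdot [RHS](bigD1 m) //= dfwithin.
rewrite mulrCA mulrA mulrC -big_split /=; congr (_ * _).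
apply: eq_bigr => k km; rewrite dfwithout 1?eq_sym // hdotZl.
by rewrite mulrC.
Qed.

End TensorSlices.

Section CommonLength.
Context {R : realType} {N : nat} {H : 'I_N -> hilbertType R}.
Variable m : 'I_N.

(** Expansions in different factors have different lengths, while multi-indices use one index type;
    zero pairs fill the gap at no cost in weight. *)
Definition pad (V : zmodType) (n M : nat) (x : 'I_n -> V * V) (i : 'I_M) : V * V :=
  if insub (val i) is Some j then x j else (0, 0).

Lemma sum_pad (V A : zmodType) (n M : nat) (x : 'I_n -> V * V) (F : V * V -> A) :
  (n <= M)%N -> F (0, 0) = 0 ->
  \sum_(i < M) F (pad x i) = \sum_(i < n) F (x i).
Proof.
move=> nM F0.
pose G (i : nat) := if insub i is Some j then F (x j) else 0.
rewrite (eq_bigr (fun i : 'I_M => G i)); last first.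
  by move=> i _; rewrite /pad /G; case: insub.
rewrite [RHS](eq_bigr (fun i : 'I_n => G i)); last first.
  by move=> i _; rewrite /G insubT // => lt; congr (F (x _)); exact: val_inj.
rewrite (big_ord_widen M G nM) [RHS]big_mkcond; apply: eq_bigr => i _.
by case: ifPn => // ni; rewrite /G insubN.
Qed.

Lemma common_length (Q : forall k n, ('I_n -> H k * H k) -> Prop) :
  (forall k n M x, (n <= M)%N -> Q k n x -> Q k M (pad x)) ->
  (forall k, k != m -> exists n x, Q k n x) ->
  exists n (x : forall k, 'I_n.+1 -> H k * H k),
    forall k, k != m -> Q k n.+1 (x k).
Proof.
move=> Qpad Qex.
have ex k : exists p : {n & 'I_n -> H k * H k}, k != m -> Q k (tag p) (tagged p).
  have [km|km] := eqVneq k m.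
    by exists (existT _ 0%N (fun=> (0, 0))).
  by have [n [x Qx]] := Qex k km; exists (existT _ n x).
pose p k := projT1 (cid (ex k)).
have pP k : k != m -> Q k (tag (p k)) (tagged (p k)) := projT2 (cid (ex k)).
pose n := \max_k tag (p k).
exists n, (fun k => pad (tagged (p k))) => k km.
by apply: Qpad; [apply: leqW; exact: leq_bigmax|exact: pP].
Qed.

End CommonLength.

(** * Finite sums of product operators and their total weight *)

Section Representations.
Context {R : realType} {N : nat} {H : 'I_N -> hilbertType R}.
Variables (K : hilbert_tensor H) (m : 'I_N).
Hypothesis fin_dim : forall k, k != m -> finite_hdim (H k).

Lemma tensor_op_trace_class_slices (T : forall k, H k -> H k) :
  (forall k, trace_class (T k)) ->
  exists n (x y : forall k, 'I_n.+1 -> H k),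
    tensor_op T = (fun u => \sum_(f | multi_index m f)
      slice K (mix x f) (T m (coslice m (mix y f) u))) /\
    \sum_(f : {ffun 'I_N -> 'I_n.+1} | multi_index m f)
      pnrm m (mix x f) * pnrm m (mix y f) <= \prod_(k | k != m) trace_norm (T k).
Proof.
move=> trT.
have [k n M x nM [xs xT]|k km|n [x xP]] := @common_length R N H m
    (fun k n x => \sum_(i < n) nrm (x i).1 * nrm (x i).2 <= trace_norm (T k) /\
      forall u, T k u = \sum_(i < n) rank1 (x i).1 (x i).2 u).
- split=> [|u].
    rewrite (@sum_pad (H k) R _ _ x (fun p => nrm p.1 * nrm p.2)) //.
    by rewrite /= nrm0 mul0r.
  rewrite xT (@sum_pad (H k) (H k) _ _ x (fun p => rank1 p.1 p.2 u)) //.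
  by rewrite /rank1 /= scaler0.
- have [n [x [y [xy xyT]]]] := trace_class_expansion (fin_dim km) (trT k).
  by exists n, (fun i => (x i, y i)).
exists n, (fun k i => (x k i).1), (fun k i => (x k i).2); split.
  have [/bounded_byP[c Tc] _] := trT m.
  by apply: (tensor_op_slices K Tc) => k km u; have [_ ->] := xP k km.
rewrite (eq_bigr (fun f : {ffun 'I_N -> 'I_n.+1} => \prod_(k | k != m)
    (nrm (x k (f k)).1 * nrm (x k (f k)).2))); last first.
  by move=> f _; rewrite -big_split.
rewrite -(prod_sum_multi_index m (fun k i => nrm (x k i).1 * nrm (x k i).2)).
apply: ler_prod => k km; rewrite (xP k km).1 andbT.
by apply: sumr_ge0 => i _; rewrite mulr_ge0 ?nrm_ge0.
Qed.

Lemma trace_norm_ge0 (H0 : hilbertType R) (T : H0 -> H0) :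
  trace_class T -> 0 <= trace_norm T.
Proof. by move=> /trace_class_nuc_le /nuc_le_ge0. Qed.

(** An upper bound for the gamma norm witnessed by an actual representation, so that bounds add
    without handling infima. *)
Definition rep (A : K -> K) (s : R) : Prop :=
  exists n (T : 'I_n -> forall j, H j -> H j),
    [/\ forall k j, trace_class (T k j), A = \sum_(k < n) tensor_op (T k) &
      \sum_(k < n) \prod_(j < N) trace_norm (T k j) <= s].

Lemma rep_gamma_norm A s : rep A s -> (gamma_norm A <= s%:E)%E.
Proof.
move=> [n [T [trT AE sE]]]; rewrite /gamma_norm.
apply: (@le_trans _ _ (\sum_(k < n) \prod_(j < N) trace_norm (T k j))%:E).
  by apply: ereal_inf_lbound; exists n, T.
by rewrite lee_fin.
Qed.

Lemma rep_le A s t : s <= t -> rep A s -> rep A t.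
Proof.
by move=> st [n [T [trT AE sE]]]; exists n, T; split=> //; apply: le_trans st.
Qed.

Lemma rep0 : rep (fun=> 0) 0.
Proof.
exists 0%N, (fun _ _ => fun=> 0); split.
- by case.
- by rewrite big_ord0.
- by rewrite big_ord0.
Qed.

Lemma rep_add A B s t : rep A s -> rep B t -> rep (fun u => A u + B u) (s + t).
Proof.
move=> [n [T [trT AE sE]]] [p [U [trU BE tE]]].
pose Z k := match fintype.split k with inl i => T i | inr j => U j end.
have Zl i : Z (lshift p i) = T i by rewrite /Z (unsplitK (inl i)).
have Zr i : Z (rshift n i) = U i by rewrite /Z (unsplitK (inr i)).
exists (n + p)%N, Z; split.
- by move=> k j; rewrite /Z; case: (fintype.split k).
- rewrite big_split_ord /= AE BE.
  by congr (_ + _); apply: eq_bigr => i _; rewrite ?Zl ?Zr.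
- rewrite big_split_ord /=; apply: lerD.
    by apply: le_trans sE; apply: ler_sum => i _; rewrite Zl.
  by apply: le_trans tE; apply: ler_sum => i _; rewrite Zr.
Qed.

Lemma rep_sum (I : Type) (r : seq I) (P : pred I) (A : I -> K -> K) (s : I -> R) :
  (forall i, P i -> rep (A i) (s i)) ->
  rep (fun u => \sum_(i <- r | P i) A i u) (\sum_(i <- r | P i) s i).
Proof.
move=> As; elim: r => [|i r IHr].
  rewrite big_nil (_ : (fun u => _) = fun=> 0); first exact: rep0.
  by apply/funext => u; rewrite big_nil.
rewrite big_cons (_ : (fun u => _) = fun u => (if P i then
    A i u + \sum_(j <- r | P j) A j u else \sum_(j <- r | P j) A j u)).
  by case: ifP => // /As Ai; exact: rep_add.
by apply/funext => u; rewrite big_cons.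
Qed.

(** A slice operator is one product operator with rank one factors away from [m]; here [nuc_le]
    bounds become trace norms again. *)
Lemma rep_slice (x y : forall k, H k) (T : H m -> H m) c s :
  bounded_by T c -> nuc_le T s ->
  rep (fun u => slice K x (T (coslice m y u))) (pnrm m x * pnrm m y * s).
Proof.
move=> Tc Ts.
have [trT Tle] : trace_class T /\ trace_norm T <= s.
  by apply: nuc_le_trace_class Ts; apply/bounded_byP; exists c.
have tr1 k : trace_class (rank1 (x k) (y k)) /\
    trace_norm (rank1 (x k) (y k)) <= nrm (x k) * nrm (y k).
  apply: nuc_le_trace_class; last exact: nuc_le_rank1.
  by apply/bounded_byP; exists (nrm (x k) * nrm (y k)); exact: bounded_by_rank1.
pose U := dfwith (fun k => rank1 (x k) (y k)) m T.
have trU k : trace_class (U k).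
  by rewrite /U; case: dfwithP => [//|j _]; exact: (tr1 j).1.
exists 1%N, (fun=> U); split=> //.
  by rewrite big_ord1 -(tensor_op_slice K x y Tc).
rewrite big_ord1 (bigD1 m) //= mulrC /pnrm -big_split /=.
apply: ler_pM.
- by apply: prodr_ge0 => k _; exact: trace_norm_ge0.
- exact: trace_norm_ge0.
- apply: ler_prod => k km; rewrite trace_norm_ge0 //=.
  by rewrite /U dfwithout 1?eq_sym //; exact: (tr1 k).2.
- by rewrite /U dfwithin.
Qed.

Lemma rank1_slice (x y : forall k, H k) (h g : H m) (u : K) :
  rank1 (slice K x h) (slice K y g) u = slice K x (rank1 h g (coslice m y u)).
Proof.
have [lS _ _] := slice_bounded K m x.
by rewrite /rank1 (linear_scale lS) (adj_hdot (slice_bounded K m y)).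
Qed.

Lemma rep_rank1 (x y : forall k, H k) (h g : H m) (a : R[i]) :
  rep (fun u => a *: rank1 (slice K x h) (slice K y g) u)
    (normc a * (nrm (slice K x h) * nrm (slice K y g))).
Proof.
rewrite (_ : (fun u => _) = fun u => slice K x (rank1 (a *: h) g (coslice m y u))).
  have := rep_slice x y (bounded_by_rank1 (a *: h) g) (nuc_le_rank1 (a *: h) g).
  apply: rep_le; rewrite !slice_nrm nrmZ le_eqVlt; apply/orP; left.
  by apply/eqP; ring.
apply/funext => u; rewrite rank1_slice; have [lS _ _] := slice_bounded K m x.
by rewrite -(linear_scale lS) /rank1 !scalerA mulrC.
Qed.

End Representations.

(** * The entanglement is at most the gamma norm *)

Section EntanglementUpperBound.
Context {R : realType} {N : nat} {H : 'I_N -> hilbertType R}.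
Variables (K : hilbert_tensor H) (m : 'I_N).
Hypothesis fin_dim : forall k, k != m -> finite_hdim (H k).

Lemma tensor_scale (a : 'I_N -> R[i]) (xi : forall k, H k) :
  tensor (fun k => a k *: xi k) = (\prod_k a k) *: tensor xi :> K.
Proof.
apply: tensor_vec_ext => eta; rewrite hdotZl !tensor_hdot -big_split /=.
by apply: eq_bigr => k _; rewrite hdotZl.
Qed.

Lemma tensor_normalize (xi : forall k, H k) :
  exists2 v : K, v = 0 \/ decomposable_unit v &
    tensor xi = (\prod_k nrm (xi k))%:C *: v.
Proof.
have [p0|pN0] := eqVneq (\prod_k nrm (xi k)) 0.
  exists 0; first by left.
  by apply/eqP; rewrite scaler0 -nrm_eq0 (tensor_nrm K m) p0.
pose a k : R[i] := (nrm (xi k))^-1%:C.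
have nN0 k : nrm (xi k) != 0.
  by apply: contraNneq pN0 => xk0; rewrite (bigD1 k) //= xk0 mul0r.
exists (tensor (fun k => a k *: xi k)).
  right; exists (fun k => a k *: xi k); split=> // k.
  by rewrite nrmE nrmZ normc_nneg ?invr_ge0 ?nrm_ge0 // mulVf.
rewrite tensor_scale scalerA rmorph_prod -big_split /=.
rewrite big1 ?scale1r // => k _.
by rewrite -rmorphM /= mulfV.
Qed.

Lemma normV_bound (X : K -> K) (xi eta : forall k, H k) : linear X ->
  (normV X <= 1)%E ->
  normc (hdot (X (tensor xi)) (tensor eta)) <=
  \prod_k nrm (xi k) * \prod_k nrm (eta k).
Proof.
move=> lX X1.
have [v vP ->] := tensor_normalize xi; have [w wP ->] := tensor_normalize eta.
rewrite (linear_scale lX) hdotZl hdotZr conjc_real !ComplexField.Normc.normcM.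
have p0 (z : forall k, H k) : 0 <= \prod_k nrm (z k).
  by apply: prodr_ge0 => k _; exact: nrm_ge0.
rewrite !normc_nneg // mulrA -[leRHS]mulr1 ler_wpM2l ?mulr_ge0 //.
case: vP => [->|dv].
  by rewrite (linear_zero lX) hdot0l ComplexField.Normc.normc0.
case: wP => [->|dw]; first by rewrite hdot0r ComplexField.Normc.normc0.
rewrite -lee_fin; apply: le_trans X1; apply: ereal_sup_ubound.
by exists v => //; exists w.
Qed.

Lemma slice_normV_bound (X : K -> K) (x y : forall k, H k) (h g : H m) :
  linear X -> (normV X <= 1)%E ->
  normc (hdot (X (slice K x h)) (slice K y g)) <=
  pnrm m x * pnrm m y * (nrm h * nrm g).
Proof.
move=> lX X1; have := normV_bound (dfwith x m h) (dfwith y m g) lX X1.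
move=> le; apply: le_trans le _; rewrite -!(tensor_nrm K m).
by rewrite -/(slice K x h) -/(slice K y g) !slice_nrm mulrACA.
Qed.

Lemma slice_has_trace (X : K -> K) (x y : forall k, H k) (T : H m -> H m) c :
  bounded_by X c -> (normV X <= 1)%E -> trace_class T ->
  exists2 l, has_trace ((fun u : K => slice K x (T (coslice m y u))) \o X) l &
    normc l <= pnrm m x * pnrm m y * trace_norm T.
Proof.
move=> Xc X1 trT; have [lX c0 _] := Xc.
have [/bounded_byP[b Tb] _] := trT; have [lT _ _] := Tb.
pose B (u : K) := slice K x (T (coslice m y u)).
have [lB _ _] : bounded_by B _ := slice_op_bounded K x y Tb.
pose p := pnrm m x * pnrm m y.
have p0 : 0 <= p by rewrite mulr_ge0 ?pnrm_ge0.
have Bapprox d : 0 < d -> exists n (h g : 'I_n -> H m),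
    \sum_i nrm (h i) * nrm (g i) <= trace_norm T /\
    nuc_le (fun u => B u - \sum_i rank1 (slice K x (h i)) (slice K y (g i)) u) d.
  move=> d0; have d'0 : 0 < d / (p + 1) by rewrite divr_gt0 // ltr_wpDl.
  have [n [h [g [hg Tn]]]] := trace_class_approx trT d'0.
  exists n, h, g; split=> //.
  have lD : linear (fun u => T u - \sum_i rank1 (h i) (g i) u).
    move=> a u v; rewrite lT scalerBr scaler_sumr addrACA -opprD -big_split /=.
    by congr (_ - _); apply: eq_bigr => i _; exact: rank1_linear.
  have := nuc_le_comp lD Tn (slice_bounded K m x) (coslice_bounded K m y).
  have pd : p * (d / (p + 1)) <= d.
    rewrite mulrCA ger_pMr // ler_pdivrMr ?mul1r ?lerDl //.
    by rewrite ltr_wpDl.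
  move=> /(nuc_le_trans pd); apply: nuc_le_ext => u.
  have [lS _ _] := slice_bounded K m x.
  rewrite (linear_sub lS) (linear_sumE lS); congr (_ - _).
  by apply: eq_bigr => i _; rewrite rank1_slice.
have [l Bl] : exists l, has_trace (B \o X) l.
  apply: (nuc_approx_has_trace lB Xc) => d d0.
  have [n [h [g [_ nn]]]] := Bapprox d d0.
  by exists n, (fun i => slice K x (h i)), (fun i => slice K y (g i)).
exists l => //; apply/ler_addgt0Pr => e e0.
have d0 : 0 < e / (c + 1) by rewrite divr_gt0 // ltr_wpDl.
have [n [h [g [hg nn]]]] := Bapprox _ d0.
have := has_trace_approx lB Xc nn Bl.
set z := \sum_i hdot _ _ => lz.
have cd : c * (e / (c + 1)) <= e.
  by rewrite mulrCA ger_pMr // ler_pdivrMr ?mul1r ?lerDl // ltr_wpDl.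
rewrite -[l](subrK z) addrC; apply: le_trans (le_normcD _ _) _.
apply: lerD; last exact: le_trans cd.
apply: le_trans (normc_sum _ _ _) _; rewrite -/p.
apply: le_trans (_ : p * \sum_i nrm (h i) * nrm (g i) <= _).
  by rewrite mulr_sumr; apply: ler_sum => i _; exact: slice_normV_bound.
by rewrite ler_wpM2l.
Qed.

Lemma trace_representation_le (X A : K -> K) c n
    (T : 'I_n -> forall j, H j -> H j) :
  bounded_by X c -> (normV X <= 1)%E -> (forall k j, trace_class (T k j)) ->
  A = \sum_(k < n) tensor_op (T k) ->
  normc (trace (A \o X)) <= \sum_(k < n) \prod_(j < N) trace_norm (T k j).
Proof.
move=> Xc X1 trT AE.
have tens k : exists l, has_trace (tensor_op (T k) \o X) l /\
    normc l <= \prod_(j < N) trace_norm (T k j).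
  have [p [x [y [-> xyT]]]] := tensor_op_trace_class_slices K fin_dim (trT k).
  have /choice[l lP] f : exists l, has_trace ((fun u : K => slice K (mix x f)
      (T k m (coslice m (mix y f) u))) \o X) l /\
    normc l <= pnrm m (mix x f) * pnrm m (mix y f) * trace_norm (T k m).
    have [l Bl ll] := slice_has_trace (mix x f) (mix y f) Xc X1 (trT k m).
    by exists l.
  exists (\sum_(f | multi_index m f) l f); split.
    rewrite -big_filter.
    have := has_trace_sum (r := [seq f <- index_enum _ | multi_index m f])
      (fun f => (lP f).1).
    by under [X in has_trace X]eq_fun do rewrite big_filter.
  apply: le_trans (normc_sum _ _ _) _.
  apply: le_trans (ler_sum _ (fun f _ => (lP f).2)) _.
  rewrite -mulr_suml (bigD1 m) //= mulrC ler_wpM2l //.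
  exact: trace_norm_ge0.
have [l lP] := choice tens.
rewrite (@has_traceE _ _ _ (\sum_k l k)); last first.
  have := has_trace_sum (r := index_enum 'I_n) (fun k => (lP k).1).
  rewrite (_ : (fun x => _) = A \o X) //; apply/funext => u.
  by rewrite AE /= fct_sumE.
apply: le_trans (normc_sum _ _ _) _.
by apply: ler_sum => k _; exact: (lP k).2.
Qed.

Lemma entanglement_le_gamma (rho : (K -> K) -> R[i]) (A : K -> K) :
  normal_state_with_density rho A -> (entanglement rho <= gamma_norm A)%E.
Proof.
move=> [_ _ rhoE]; apply: le_ereal_inf_tmp => _ [n [T [trT AE ->]]].
apply: ge_ereal_sup => _ [X [cX X1] <-]; rewrite lee_fin.
have bX := compact_plus_scalar_bounded cX; rewrite rhoE //.
have /bounded_byP[c Xc] := bX.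
exact: trace_representation_le Xc X1 trT AE.
Qed.

End EntanglementUpperBound.

(** * The gamma norm is at most the entanglement *)

Section Compression.
Context {R : realType}.

Lemma nuc_leN (H1 H2 : hilbertType R) (T : H1 -> H2) s :
  nuc_le T s -> nuc_le (fun u => - T u) s.
Proof.
move=> Ts I u v cu cv; under eq_bigr do rewrite hdotNl.
by rewrite sumrN normcN; exact: Ts.
Qed.

(** With [D] the remainder of a finite rank approximation and [P] the projection, [B - P B P] is
    [D - P D P] plus the errors of the rank one terms; the three parts get [d / 3] each. Validity
    for all larger [t] lets finitely many blocks share one [t]. *)
Lemma trace_class_compress (H : hilbertType R) (B : H -> H) d :
  trace_class B -> 0 < d ->
  exists2 s, basis_seq s & forall t, basis_seq t -> {subset s <= t} ->
    nuc_le (fun u => B u - hproj t (B (hproj t u))) d.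
Proof.
move=> trB d0; have [/bounded_byP[b Bb] _] := trB; have [lB _ _] := Bb.
have d3 : 0 < d / 3 by rewrite divr_gt0.
have [n [x [y [_ Dd]]]] := trace_class_approx trB d3.
pose D u := B u - \sum_i rank1 (x i) (y i) u; rewrite -/D in Dd.
have lD : linear D.
  move=> a u v; rewrite /D lB scalerBr scaler_sumr addrACA -opprD -big_split /=.
  by congr (_ - _); apply: eq_bigr => i _; exact: rank1_linear.
pose k := \sum_i (nrm (x i) + nrm (y i)) + 1.
have k0 : 0 < k.
  by rewrite ltr_wpDl // sumr_ge0 // => i _; rewrite addr_ge0 ?nrm_ge0.
have dk : 0 < d / 3 / k by rewrite divr_gt0.
have [s1 bs1 s1P] := parseval_fam x dk; have [s2 bs2 s2P] := parseval_fam y dk.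
exists (undup (s1 ++ s2)); first exact: basis_seqU.
move=> t bt st.
have {}s1P i : nrm (x i - hproj t (x i)) <= d / 3 / k.
  by apply: s1P => // e es; apply: st; rewrite mem_undup mem_cat es.
have {}s2P i : nrm (y i - hproj t (y i)) <= d / 3 / k.
  by apply: s2P => // e es; apply: st; rewrite mem_undup mem_cat es orbT.
have PDP : nuc_le (fun u => - hproj t (D (hproj t u))) (d / 3).
  have := nuc_le_comp lD Dd (hproj_bounded_by bt) (hproj_bounded_by bt).
  by rewrite !mul1r; exact: nuc_leN.
pose F i u := rank1 (x i - hproj t (x i)) (y i) u +
  rank1 (hproj t (x i)) (y i - hproj t (y i)) u.
have Fd : nuc_le (fun u => \sum_i F i u) (d / 3).
  suff le : \sum_i (nrm (x i - hproj t (x i)) * nrm (y i) +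
      nrm (hproj t (x i)) * nrm (y i - hproj t (y i))) <= d / 3.
    apply: (nuc_le_trans le); apply: nuc_le_sum => i _.
    by apply: nuc_leD; exact: nuc_le_rank1.
  apply: le_trans (_ : d / 3 / k * k <= _); last by rewrite divfK ?gt_eqF.
  apply: le_trans (_ : \sum_i d / 3 / k * (nrm (x i) + nrm (y i)) <= _).
    apply: ler_sum => i _; rewrite mulrDr addrC; apply: lerD.
      by rewrite mulrC; apply: ler_pM; rewrite ?nrm_ge0 // hproj_nrm.
    by apply: ler_wpM2r; rewrite ?nrm_ge0.
  by rewrite -mulr_sumr; apply: ler_wpM2l; [exact: ltW|rewrite /k lerDl].
have d3E : d / 3 + d / 3 + d / 3 <= d by lra.
apply: (nuc_le_trans d3E); apply: nuc_le_ext (nuc_leD (nuc_leD Dd PDP) Fd) => u.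
have lP := hproj_linear t.
rewrite /D (linear_sub lP) (linear_sumE lP) opprB.
have FE i : F i u = rank1 (x i) (y i) u -
    hproj t (rank1 (x i) (y i) (hproj t u)).
  rewrite /F /rank1 (linear_scale lP) scalerBr hdotBr scalerBl hproj_sym.
  by rewrite addrA subrK.
rewrite (eq_bigr _ (fun i _ => FE i)) sumrB.
set p := \sum_i rank1 _ _ u; set q := \sum_i hproj t _.
set Bu := B u; set PB := hproj t _.
by rewrite addrAC !addrA !subrK.
Qed.

End Compression.

Section EntanglementLowerBound.
Context {R : realType} {N : nat} {H : 'I_N -> hilbertType R}.
Variables (K : hilbert_tensor H) (m : 'I_N).
Hypothesis fin_dim : forall k, k != m -> finite_hdim (H k).

(** Orthonormal bases padded by zeros: orthonormality is lost, but the resolution of the identity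
    and the bound 1 on norms persist. *)
Lemma common_frames : exists n (b : forall k, 'I_n.+1 -> H k),
  forall k, k != m -> (forall u, u = \sum_i rank1 (b k i) (b k i) u) /\
    forall i, nrm (b k i) <= 1.
Proof.
have [k n M x nM [xE x1]|k km|n [x xP]] := @common_length R N H m
    (fun k n x => (forall u, u = \sum_(i < n) rank1 (x i).1 (x i).1 u) /\
      forall i, nrm (x i).1 <= 1).
- split=> [u|i].
    rewrite {1}(xE u).
    rewrite (@sum_pad (H k) (H k) _ _ x (fun p => rank1 p.1 p.1 u)) //.
    by rewrite /rank1 /= scaler0.
  by rewrite /pad; case: insub => //=; rewrite nrm0.
- have [s bs sE] := finite_hbasis (fin_dim km).
  exists (size s), (fun i => (tnth (in_tuple s) i, 0)); split=> [u|i] /=.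
    by rewrite -(sum_tnth s (fun e => rank1 e e u)) -{1}(sE u).
  by rewrite hbasis_nrm //; apply: bs.2; exact: mem_tnth.
by exists n, (fun k i => (x k i).1) => k km; exact: xP.
Qed.

Section Compressed.
Variables (n : nat) (b : forall k, 'I_n.+1 -> H k).
Hypothesis b_frame : forall k, k != m ->
  (forall u, u = \sum_i rank1 (b k i) (b k i) u) /\ forall i, nrm (b k i) <= 1.

Let J (f : {ffun 'I_N -> 'I_n.+1}) := slice K (m := m) (mix b f).
Let J' (f : {ffun 'I_N -> 'I_n.+1}) : K -> H m := coslice m (mix b f).

Lemma slices_id (u : K) : u = \sum_(f | multi_index m f) J f (J' f u).
Proof.
have id1 (H0 : hilbertType R) : bounded_by (idfun : H0 -> H0) 1.
  by split=> // x; rewrite mul1r.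
have idE : tensor_op (fun k => idfun) = idfun :> (K -> K).
  by apply: (tensor_opE (id1 _)).
have e := tensor_op_slices K (T := fun k => idfun) (id1 (H m))
  (fun k km => (b_frame km).1).
by rewrite -[u in LHS]/(idfun u) -idE e.
Qed.

Variable t : seq (H m).
Hypothesis bt : basis_seq t.

Definition grid : finType := ({ffun 'I_N -> 'I_n.+1} * 'I_(size t))%type.

(** Functions that are not multi-indices give the zero vector, so the grid can be a full product
    type. *)
Definition grid_vec (p : grid) : K :=
  J p.1 (if multi_index m p.1 then tnth (in_tuple t) p.2 else 0).

Definition grid_proj (u : K) : K := \sum_p rank1 (grid_vec p) (grid_vec p) u.

Lemma grid_projE u :
  grid_proj u = \sum_(f | multi_index m f) J f (hproj t (J' f u)).
Proof.
rewrite /grid_proj -(pair_bigA _ (fun f i => rank1 (grid_vec (f, i))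
  (grid_vec (f, i)) u)) /= [RHS]big_mkcond; apply: eq_bigr => f _.
have [lJ _ _] := slice_bounded K m (mix b f).
case: ifPn => mf; last first.
  rewrite big1 // => i _; rewrite /rank1 /grid_vec /= (negPf mf) /J.
  by rewrite (linear_zero lJ) scaler0.
rewrite /hproj /J (linear_sumE lJ) -/(J f).
rewrite (sum_tnth t (fun e => J f (hdot (J' f u) e *: e))).
by apply: eq_bigr => i _; rewrite /grid_vec /= mf /J rank1_slice.
Qed.

(** The frames resolve the identity in every factor but [m], so only the [m]-th factor is projected
    and product vectors stay product vectors. *)
Lemma grid_proj_tensor xi :
  grid_proj (tensor xi) = slice K xi (hproj t (xi m)).
Proof.
rewrite grid_projE.
have lP : linear (dfwith (fun k => idfun : H k -> H k) m (hproj t) m).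
  by rewrite dfwithin; exact: hproj_linear.
have := slice_expansion K xi lP (x := b) (y := b).
rewrite dfwithin => ->.
  congr (tensor _); apply: functional_extensionality_dep => k.
  by case: dfwithP => [|j jm]; rewrite ?dfwithin // dfwithout.
by move=> k km u; rewrite dfwithout 1?eq_sym //; exact: (b_frame km).1.
Qed.

Lemma pnrm_mix_le1 f : pnrm m (mix b f) <= 1.
Proof.
rewrite -[leRHS](@big1 _ 1 *%R _ (index_enum 'I_N) (fun k => k != m) (fun=> 1)) //.
by apply: ler_prod => k km; rewrite nrm_ge0; exact: (b_frame km).2.
Qed.

Lemma grid_vec_nrm p : nrm (grid_vec p) <= 1.
Proof.
rewrite /grid_vec /J slice_nrm -[leRHS]mulr1; apply: ler_pM; rewrite ?nrm_ge0 //.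
- exact: pnrm_ge0.
- exact: pnrm_mix_le1.
case: ifP => _; last by rewrite nrm0.
by rewrite hbasis_nrm //; apply: bt.2; exact: mem_tnth.
Qed.

Variables (A : K -> K) (a : R).
Hypothesis Aa : bounded_by A a.

(** Resolving the identity on both sides splits [A] into blocks on [H m]; compressing [A] compresses
    each block by [hproj t], and every block error costs at most [d]. *)
Lemma grid_compression_rep d :
  (forall f g, nuc_le (fun u => J' g (A (J f u)) -
     hproj t (J' g (A (J f (hproj t u))))) d) ->
  rep (fun u => A u - grid_proj (A (grid_proj u)))
    (\sum_(g | multi_index (n := n) m g) \sum_(f | multi_index (n := n) m f) d).
Proof.
move=> Ad; have [lA a0 An] := Aa.
pose B f g u := J' g (A (J f u)) - hproj t (J' g (A (J f (hproj t u)))).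
have -> : (fun u => A u - grid_proj (A (grid_proj u))) = (fun u =>
    \sum_(g | multi_index m g) \sum_(f | multi_index m f) J g (B f g (J' f u))).
  apply/funext => u.
  rewrite {1}[A u]slices_id [grid_proj (A _)]grid_projE -sumrB.
  apply: eq_bigr => g _.
  have [lJ _ _] := slice_bounded K m (mix b g).
  have [lJ' _ _] := coslice_bounded K m (mix b g).
  have lP := hproj_linear t.
  rewrite -(linear_sumE lJ) -(linear_sub lJ) {1}[u]slices_id grid_projE.
  rewrite /J' !(linear_sumE lA) !(linear_sumE lJ') (linear_sumE lP) -sumrB.
  by [].
apply: rep_sum => g mg; apply: rep_sum => f mf.
have Bb : exists c, bounded_by (B f g) c.
  have bP := hproj_bounded_by bt.
  have bA := bounded_by_comp (coslice_bounded K m (mix b g))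
    (bounded_by_comp Aa (slice_bounded K m (mix b f))).
  have bPAP := bounded_by_comp bP (bounded_by_comp bA bP).
  have [lB _ _] := bA; have [lC _ _] := bPAP.
  eexists; split; last first.
  - move=> u; apply: le_trans (nrmB _ _) _; have [_ _ h1] := bA.
    by have [_ _ h2] := bPAP; rewrite (le_trans (lerD (h1 u) (h2 u))) // -mulrDl.
  - by rewrite addr_ge0 //; [case: bA|case: bPAP].
  - move=> c x y; rewrite /B /J /J' scalerBr.
    by have := lB c x y; have := lC c x y => /= -> ->; rewrite opprD addrACA.
have [c Bc] := Bb.
have d0 := nuc_le_ge0 (Ad f g).
apply: rep_le (rep_slice K (mix b g) (mix b f) Bc (Ad f g)).
rewrite -[leRHS]mul1r ler_wpM2r // -[leRHS]mul1r.
by apply: ler_pM; rewrite ?pnrm_ge0 // pnrm_mix_le1.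
Qed.

(* Separation is done over the reals: the boolean selects the real ([true]) or
   the imaginary part of a matrix entry. *)
Let S : finType := (grid * grid * bool)%type.

Let entry (x : S -> R) (p q : grid) : R[i] := x (p, q, true) +i* x (p, q, false).

Let grid_op (x : S -> R) (u : K) : K :=
  \sum_(pq : grid * grid)
    entry x pq.1 pq.2 *: rank1 (grid_vec pq.2) (grid_vec pq.1) u.

Let coord (z : grid -> grid -> R[i]) (s : S) : R :=
  if s.2 then complex.Re (z s.1.1 s.1.2) else complex.Im (z s.1.1 s.1.2).

Let entry_coord z p q : entry (coord z) p q = z p q.
Proof. by rewrite /entry /coord /=; case: (z p q). Qed.

(** The matrix entry, with input [p] and output [q] as in [A_entry], of the rank one operator from
    [tensor eta] to [tensor xi]. *)
Let product_entry (xi eta : forall k, H k) (p q : grid) : R[i] :=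
  hdot (tensor xi) (grid_vec q) * conjc (hdot (tensor eta) (grid_vec p)).

Let product_coords : set (S -> R) := [set x | exists xi eta : forall k, H k,
  [/\ forall k, `|xi k| = 1, forall k, `|eta k| = 1 &
      x = coord (product_entry xi eta)]].

Let unit_tensor_nrm (xi : forall k, H k) : (forall k, `|xi k| = 1) ->
  nrm (tensor xi : K) = 1.
Proof.
move=> xi1; rewrite (tensor_nrm K m) big1 // => k _.
by rewrite /nrm xi1.
Qed.

Let grid_op_product xi eta u : grid_op (coord (product_entry xi eta)) u =
  rank1 (grid_proj (tensor xi)) (grid_proj (tensor eta)) u.
Proof.
rewrite /grid_op -(pair_bigA _ (fun p q => entry (coord (product_entry xi eta)) p q
  *: rank1 (grid_vec q) (grid_vec p) u)) /=.
rewrite /rank1 {2}/grid_proj scaler_sumr exchange_big /=.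
apply: eq_bigr => q _; rewrite {1}/grid_proj hdot_sumr.
rewrite /rank1 scalerA mulr_suml scaler_suml; apply: eq_bigr => p _.
rewrite entry_coord /product_entry hdotZr !scalerA; congr (_ *: _).
by ring.
Qed.

(** Each generator is the grid compression of a product rank one operator, again of product form and
    of weight at most 1. *)
Let grid_op_hull c x : hull product_coords c x -> rep (grid_op x) c.
Proof.
elim=> [|r x' c' y r0 [xi [eta [xi1 eta1 ->]]] _ IH].
  rewrite (_ : grid_op _ = fun=> 0); first exact: rep0.
  apply/funext => u; rewrite /grid_op big1 // => pq _.
  by rewrite /entry (_ : 0 +i* 0 = 0) // scale0r.
rewrite (_ : grid_op _ = fun u => r%:C *: grid_op (coord (product_entry xi eta)) u
    + grid_op y u).
  apply: rep_add IH.
  rewrite (_ : (fun u => _) = fun u => r%:C *: rank1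
      (slice K xi (hproj t (xi m))) (slice K eta (hproj t (eta m))) u).
    apply: rep_le (rep_rank1 K xi eta (hproj t (xi m)) (hproj t (eta m)) r%:C).
    have le1 (z : forall k, H k) : (forall k, `|z k| = 1) ->
        nrm (slice K z (hproj t (z m))) <= 1.
      move=> z1.
      rewrite slice_nrm -(unit_tensor_nrm z1) -(slice_tensor K m) slice_nrm.
      by rewrite ler_wpM2l ?pnrm_ge0 // hproj_nrm.
    rewrite normc_nneg // -[leRHS]mulr1 ler_wpM2l // -[leRHS]mulr1.
    by apply: ler_pM; rewrite ?nrm_ge0 ?le1.
  by apply/funext => u; rewrite grid_op_product !grid_proj_tensor.
apply/funext => u; rewrite /grid_op scaler_sumr -big_split /=.
apply: eq_bigr => pq _; rewrite scalerA -scalerDl; congr (_ *: _).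
by rewrite /entry; simpc.
Qed.

Let A_entry (p q : grid) : R[i] := hdot (A (grid_vec p)) (grid_vec q).

Let grid_op_A u : grid_op (coord A_entry) u = grid_proj (A (grid_proj u)).
Proof.
have [lA _ _] := Aa.
rewrite /grid_op -(pair_bigA _ (fun p q => entry (coord A_entry) p q
  *: rank1 (grid_vec q) (grid_vec p) u)) /=.
rewrite {1}/grid_proj exchange_big /=; apply: eq_bigr => q _.
rewrite /rank1 /grid_proj (linear_sumE lA) hdot_suml scaler_suml.
apply: eq_bigr => p _; rewrite entry_coord /rank1 (linear_scale lA) hdotZl.
by rewrite scalerA mulrC.
Qed.

(** The factor 2 adds real and imaginary parts. The bound grows with the grid, which is harmless
    because the separation error is chosen after the grid. *)
Let grid_op_small x d : 0 <= d -> (forall s, `|x s| <= d) ->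
  rep (grid_op x) (\sum_(pq : grid * grid) 2 * d).
Proof.
move=> d0 xd; apply: rep_sum => -[p q] _ /=.
apply: rep_le (rep_rank1 K (mix b q.1) (mix b p.1) _ _ (entry x p q)).
rewrite -/(J q.1 _) -/(J p.1 _) -/(grid_vec q) -/(grid_vec p).
have entry_le : normc (entry x p q) <= 2 * d.
  rewrite [entry x p q]complexE; apply: le_trans (le_normcD _ _) _.
  rewrite ComplexField.Normc.normcM !normc_real /= expr0n expr1n add0r sqrtr1.
  by rewrite mul1r mulr_natl mulr2n lerD.
apply: le_trans entry_le; rewrite -[leRHS]mulr1 ler_wpM2l ?normc_ge0 //.
by rewrite -[leRHS]mulr1; apply: ler_pM; rewrite ?nrm_ge0 ?grid_vec_nrm.
Qed.

Variables (rho : (K -> K) -> R[i]) (E : R).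
Hypothesis rhoE : forall X, bounded_op X -> rho X = trace (A \o X).
Hypothesis E_ge : (entanglement rho <= E%:E)%E.

Let phase z : exists2 w : R[i], normc w = 1 & w * z = (normc z)%:C.
Proof.
have [->|z0] := eqVneq z 0.
  by exists 1; rewrite ?ComplexField.Normc.normc1 // ComplexField.Normc.normc0 mulr0.
have nz0 : normc z != 0 by rewrite normc_eq0.
exists ((normc z)^-1%:C * conjc z).
  rewrite ComplexField.Normc.normcM normc_nneg ?invr_ge0 ?normc_ge0 //.
  by rewrite normc_conj mulVf.
rewrite -mulrA [conjc z * z]mulrC mulc_conj -rmorphM; congr (_%:C).
by rewrite expr2 mulrA mulVf // mul1r.
Qed.

(** The functional [phi] is turned into a finite rank operator [X], normalized by [nu]: its matrix
    coefficients at product unit vectors are [phi] at product matrices, and [trace (A X)] is [phi]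
    at [A], so the entanglement bounds the latter. *)
Let tests_bound (phi : S -> R) nu : 0 < nu ->
  (forall x, product_coords x -> \sum_s phi s * x s <= nu) ->
  \sum_s phi s * coord A_entry s <= E * nu.
Proof.
move=> nu0 phi_nu; have [lA _ _] := Aa.
(* The conjugate sign makes the real pairing with [phi] the real part of a complex pairing. *)
pose Phi (p q : grid) : R[i] := phi (p, q, true) -i* phi (p, q, false).
have pairing (z : grid -> grid -> R[i]) : \sum_s phi s * coord z s =
    complex.Re (\sum_(pq : grid * grid) Phi pq.1 pq.2 * z pq.1 pq.2).
  rewrite (eq_bigr (fun s : S => phi (s.1, s.2) * coord z (s.1, s.2))).
    2: by case.
  rewrite raddf_sum -(pair_bigA _ (fun pq e => phi (pq, e) * coord z (pq, e))) /=.
  apply: eq_bigr => -[p q] _; rewrite big_bool /coord /Phi /=.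
  by case: (z p q) => c d /=; rewrite mulNr opprK.
pose X (u : K) := \sum_(pq : grid * grid)
  rank1 ((nu^-1%:C * Phi pq.1 pq.2) *: grid_vec pq.1) (grid_vec pq.2) u.
have cX : compact_op X by exact: finite_rank_compact.
have cX' : compact_plus_scalar X.
  by exists X, 0; split=> //; rewrite scale0r addr0.
have bX := compact_plus_scalar_bounded cX'.
have X_product xi eta : hdot (X (tensor xi)) (tensor eta) = nu^-1%:C *
    \sum_(pq : grid * grid) Phi pq.1 pq.2 * product_entry xi eta pq.1 pq.2.
  rewrite hdot_suml mulr_sumr; apply: eq_bigr => -[p q] _ /=.
  rewrite /rank1 !hdotZl /product_entry -hdotC.
  by ring.
have X1 : (normV X <= 1)%E.
  apply: ge_ereal_sup => _ [_ [xi [xi1 ->]]] [_ [eta [eta1 ->]]] <-.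
  rewrite lee_fin X_product.
  have [w w1 wE] := phase (\sum_(pq : grid * grid)
    Phi pq.1 pq.2 * product_entry xi eta pq.1 pq.2).
  rewrite ComplexField.Normc.normcM normc_nneg ?invr_ge0 ?(ltW nu0) //.
  rewrite ler_pdivrMl // mulr1.
  (* Putting the phase into the [m]-th factor keeps a product of unit vectors and makes the pairing
     equal to its modulus. *)
  pose xi' := dfwith xi m (w *: xi m).
  have [lS _ _] := slice_bounded K m xi.
  have xi'E : tensor xi' = w *: tensor xi :> K.
    by rewrite -[tensor xi' : K]/(slice K xi (w *: xi m)) (linear_scale lS)
      (slice_tensor K m).
  have xi'1 k : `|xi' k| = 1.
    rewrite /xi'; case: dfwithP => [|j _]; last exact: xi1.
    by rewrite normrZ xi1 mulr1 normcC w1.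
  have := phi_nu _ (ex_intro _ xi' (ex_intro _ eta
    (And3 xi'1 eta1 (erefl (coord (product_entry xi' eta)))))).
  rewrite pairing.
  have -> : \sum_(pq : grid * grid) Phi pq.1 pq.2 * product_entry xi' eta pq.1 pq.2
      = w * \sum_(pq : grid * grid) Phi pq.1 pq.2 * product_entry xi eta pq.1 pq.2.
    rewrite mulr_sumr; apply: eq_bigr => pq _.
    by rewrite /product_entry xi'E hdotZl; ring.
  by rewrite wE.
have trX : has_trace (A \o X)
    (nu^-1%:C * \sum_(pq : grid * grid) Phi pq.1 pq.2 * A_entry pq.1 pq.2).
  have id1 : bounded_by (idfun : K -> K) 1 by split=> // u; rewrite mul1r.
  have := has_trace_sum (r := index_enum (grid * grid)%type) (fun pq =>
    @has_trace_rank1 _ _ idfun 1 (A ((nu^-1%:C * Phi pq.1 pq.2) *: grid_vec pq.1))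
      (grid_vec pq.2) id1).
  rewrite (_ : (fun u => _) = A \o X); last first.
    apply/funext => u; rewrite /X /= (linear_sumE lA); apply: eq_bigr => pq _.
    by rewrite /rank1 /= -(linear_scale lA).
  congr (has_trace _ _); rewrite mulr_sumr; apply: eq_bigr => pq _ /=.
  by rewrite (linear_scale lA) hdotZl mulrA.
have : normc (rho X) <= E.
  rewrite -lee_fin; apply: le_trans E_ge; apply: ereal_sup_ubound.
  by exists X.
rewrite rhoE // (has_traceE trX) ComplexField.Normc.normcM.
rewrite normc_nneg ?invr_ge0 ?(ltW nu0) // ler_pdivrMl // mulrC => le.
by rewrite pairing; apply: le_trans (Re_le_normc _) le.
Qed.

Lemma grid_rep d : 0 <= E -> 0 < d ->
  rep (fun u => grid_proj (A (grid_proj u))) (E + d).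
Proof.
move=> E0 d0.
(* Separation with error [d / M] costs one share [d / M] in hull weight and [M - 1] shares in the
   residual matrix, [d] in total. *)
pose M := \sum_(pq : grid * grid) (2 : R) + 1.
have M0 : 0 < M by rewrite ltr_wpDl // sumr_ge0.
have dM : 0 < d / M by rewrite divr_gt0.
have coords1 x : product_coords x -> forall s, `|x s| <= 1.
  move=> [xi [eta [xi1 eta1 ->]]] [[p q] e].
  have : normc (product_entry xi eta p q) <= 1.
    rewrite /product_entry ComplexField.Normc.normcM normc_conj -[leRHS]mulr1.
    by apply: ler_pM; rewrite ?normc_ge0 //; apply: le_trans (cauchy_schwarz _ _) _;
      rewrite unit_tensor_nrm // mul1r grid_vec_nrm.
  apply: le_trans; rewrite /coord /=; case: (product_entry xi eta p q) => c c' /=.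
  case: e; rewrite -sqrtr_sqr ler_sqrt ?addr_ge0 ?sqr_ge0 // ?lerDl ?lerDr.
    exact: sqr_ge0.
  exact: sqr_ge0.
have [c [x [hx cE xz]]] := hull_separation E0 dM coords1 tests_bound.
have := rep_add (grid_op_hull hx)
  (grid_op_small (x := fun s => coord A_entry s - x s) (ltW dM) xz).
rewrite (_ : (fun u => _) = fun u => grid_proj (A (grid_proj u))).
  apply: rep_le; rewrite -mulr_suml.
  have -> : E + d = E + d / M + (M - 1) * (d / M) by field; rewrite gt_eqF.
  by rewrite lerD // /M addrK.
apply/funext => u; rewrite -grid_op_A /grid_op -big_split /=.
apply: eq_bigr => pq _; rewrite -scalerDl; congr (_ *: _).
by rewrite /entry; simpc; rewrite !subrKC.
Qed.

End Compressed.
End EntanglementLowerBound.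

Section EntanglementGamma.
Context {R : realType} {N : nat} {H : 'I_N -> hilbertType R}.
Variables (K : hilbert_tensor H) (m : 'I_N).
Hypothesis fin_dim : forall k, k != m -> finite_hdim (H k).

(** The zero operator, written as an empty finite rank sum, is an admissible test; this excludes
    [-oo] and gives the sign needed for separation. *)
Lemma entanglement_ge0 (rho : (K -> K) -> R[i]) : (0 <= entanglement rho)%E.
Proof.
pose X (u : K) : K := \sum_(i < 0) rank1 0 0 u.
have X0 u : X u = 0 by rewrite /X big_ord0.
apply: (@le_trans _ _ (normc (rho X))%:E); first by rewrite lee_fin normc_ge0.
apply: ereal_sup_ubound; exists X => //; split.
  exists X, 0; split; first exact: finite_rank_compact.
  by rewrite scale0r addr0.
apply: ge_ereal_sup => _ [xi _] [eta _] <-.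
by rewrite lee_fin X0 hdot0l ComplexField.Normc.normc0.
Qed.

Lemma gamma_le_entanglement (rho : (K -> K) -> R[i]) (A : K -> K) :
  normal_state_with_density rho A -> (gamma_norm A <= entanglement rho)%E.
Proof.
move=> [_ [trA _ _] rhoE]; have [/bounded_byP[a Aa] _] := trA.
have [lA _ _] := Aa.
have := entanglement_ge0 rho; case EE : (entanglement rho) => [E| |] //.
  2: by move=> _; exact: leey.
rewrite lee_fin => E0; apply/lee_addgt0Pr => e e0.
have [n [b bP]] := common_frames fin_dim.
pose F : finType := {ffun 'I_N -> 'I_n.+1}.
pose M : R := \sum_(g : F | multi_index m g) \sum_(f : F | multi_index m f) 1.
have M0 : 0 <= M by apply: sumr_ge0 => g _; apply: sumr_ge0.
have M1 : 0 < M + 1 by rewrite ltr_wpDl.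
have e20 : 0 < e / 2 by rewrite divr_gt0.
(* [M] counts the blocks, so their errors add up to at most [e / 2]; the other half is left for
   [grid_rep]. *)
pose d := e / 2 / (M + 1); have d0 : 0 < d by rewrite divr_gt0.
pose B (p : F * F) (u : H m) := coslice m (mix b p.2) (A (slice K (mix b p.1) u)).
have trB p : trace_class (B p).
  have bS := slice_bounded K m (mix b p.1).
  have bC := coslice_bounded K m (mix b p.2).
  have Bb : bounded_by (B p) _ := bounded_by_comp bC (bounded_by_comp Aa bS).
  have Bn := nuc_le_comp lA (trace_class_nuc_le trA) bC bS.
  apply: (nuc_le_trace_class _ Bn).1.
  by apply/bounded_byP; eexists; exact: Bb.
have /choice[s sP] p : exists s, basis_seq s /\ forall t, basis_seq t ->
    {subset s <= t} -> nuc_le (fun u => B p u - hproj t (B p (hproj t u))) d.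
  by have [s bs sP] := trace_class_compress (trB p) d0; exists s.
pose t := undup (flatten [seq s p | p <- enum {: F * F}]).
have bt : basis_seq t.
  split; first exact: undup_uniq.
  move=> f; rewrite mem_undup => /flatten_mapP[p _]; exact: (sP p).1.2.
have tP f g : nuc_le (fun u => B (f, g) u - hproj t (B (f, g) (hproj t u))) d.
  apply: (sP (f, g)).2 => // h hs; rewrite mem_undup; apply/flatten_mapP.
  by exists (f, g); rewrite ?mem_enum.
have := rep_add (grid_compression_rep bP bt Aa tP)
  (grid_rep bP bt Aa rhoE _ E0 e20).
rewrite (_ : (fun u => _) = A); last by apply/funext => u; rewrite subrK.
rewrite EE lexx => /(_ isT) /(rep_le _) repA.
rewrite -EFinD; apply: rep_gamma_norm; apply: repA.
have -> : \sum_(g : F | multi_index m g) \sum_(f : F | multi_index m f) d = M * d.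
  rewrite mulr_suml; apply: eq_bigr => g _; rewrite mulr_suml.
  by apply: eq_bigr => f _; rewrite mul1r.
have : M * d <= e / 2.
  by rewrite /d mulrCA ger_pMr // ler_pdivrMr ?mul1r ?lerDl.
by move=> Md; lra.
Qed.

End EntanglementGamma.

Theorem theorem9p1 (R : realType) (N : nat) (N_ge2 : (2 <= N)%N)
    (H : 'I_N -> hilbertType R)
    (H_nonzero : forall k : 'I_N, exists x : H k, x <> 0%R)
    (H_sorted : forall j k : 'I_N, (j <= k)%N -> hdim_le (H j) (H k))
    (H_finite : forall k : 'I_N, (k.+2 = N)%N -> finite_hdim (H k))
    (K : hilbert_tensor H)
    (rho : (K -> K) -> complex R) (A : K -> K)
    (rho_A : normal_state_with_density rho A) :
  entanglement rho = gamma_norm A.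
Proof.
have N_gt0 : (0 < N)%N by exact: ltnW.
have NP_gt0 : (0 < N.-1)%N by rewrite -subn1 subn_gt0.
have ltm : (N.-1 < N)%N by rewrite prednK.
have ltl : (N.-2 < N)%N by rewrite (leq_trans _ ltm) // ltnS leq_pred.
(* Here [m] is the last index. Any other index is at most [N.-2], whose space is finite dimensional,
   and sortedness transfers this downwards. *)
have fin_dim k : k != Ordinal ltm -> finite_hdim (H k).
  rewrite -val_eqE /= => km; have kl : (k <= Ordinal ltl)%N.
    rewrite /= -ltnS prednK // ltn_neqAle; apply/andP; split; first exact: km.
    by rewrite -ltnS prednK.
  apply: card_le_finite (H_sorted k _ kl) _; apply: H_finite.
  by rewrite /= !prednK.
apply/eqP; rewrite eq_le (entanglement_le_gamma fin_dim rho_A).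
exact: gamma_le_entanglement fin_dim _ _ rho_A.
Qed.
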